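(* Let $\{\mathbf{A}_i\}_{i\in\mathbb{N}}$ be a nondecreasing sequence of finite dimensional $C^\ast$-algebras with inclusion mappings $h_k:\mathbf{A}_k\to\mathbf{A}_{k+1}$, and let $\mathfrak{B}$ be a hyperfinite dimensional internal $C^\ast$-algebra. There exists an injective $C^\ast$-algebra morphism from $\overline{\bigcup_{i=1}^\infty\mathbf{A}_i}$ into $\mathbf{S}(\mathfrak{B})$ if and only if for every $k\in\mathbb{N}$ the dimension vector $\overline{\dim}(\mathbf{A}_k)$ divides $\overline{\dim}(\mathfrak{B})$.
   Context: Nonstandard setting. For a set $G$ let $V_0(G)=G$, $V_{n+1}(G)=V_n(G)\cup\mathcal{P}(V_n(G))$, $V(G)=\bigcup_n V_n(G)$. Fix a nontrivial nonstandard extension ${}^{\bullet}: V(\mathbb{R})\to V({}^{\bullet}\mathbb{R})$ which is the identity on $\mathbb{R}$, satisfies the transfer principle, and is countably saturated (every sequence $\{x_n\}_{n\in\mathbb{N}}$ of elements of an internal set extends to an internal family indexed by ${}^{\bullet}\mathbb{N}$). Standard objects live in $V(\mathbb{R})$; internal objects are elements of the sets ${}^{\bullet}(V_n(\mathbb{R}))$. An internal $C^\ast$-algebra is an internal object satisfying the transferred definition of $C^\ast$-algebra (over ${}^{\bullet}\mathbb{C}$); it is hyperfinite dimensional if its internal dimension is an element of ${}^{\bullet}\mathbb{N}$. All algebras are unital and all involutive morphisms ($C^\ast$-algebra morphisms, including inclusions) are unit-preserving. Infinitesimal hull. For an internal $C^\ast$-algebra $\mathfrak{B}$, $\operatorname{Fin}(\mathfrak{B})$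 is the set of elements of limited norm, $\mathbf{S}(\mathfrak{B})=\operatorname{Fin}(\mathfrak{B})/\{x:\|x\|\cong 0\}$ with quotient map $\pi$ and norm $\|\pi(x)\|=\operatorname{st}\|x\|$; it is an ordinary $C^\ast$-algebra. Dimension vectors. For a hyperfinite dimensional $\mathfrak{B}$, $\min\mathfrak{B}$ is the (hyperfinite) set of minimal nonzero central projections; for $e\in\min\mathfrak{B}$, $\mathfrak{B}e\cong M_{\dim(e)}({}^{\bullet}\mathbb{C})$ internally, and $\overline{\dim}(\mathfrak{B})=\{\dim(e)\}_{e\in\min\mathfrak{B}}$ is the dimension vector; similarly for ordinary finite dimensional $C^\ast$-algebras. Divisibility. An inclusion matrix is an internal family $\{\Gamma_{fe}\}_{(f,e)\in J\times I}$ of nonnegative hyperintegers such that for each $f\in J$ there is $e\in I$ with $\Gamma_{fe}>0$, and for each $e\in I$ there is $f\in J$ with $\Gamma_{fe}>0$. A dimension vector $\bar m$ (indexed on $I$) divides a dimension vector $\bar n$ (indexed on $J$) iff there is an inclusion matrix $\Gamma$ with $\bar n=\Gamma\bar m$. *)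

(* Defs.v *)
From HB Require Import structures.
From mathcomp Require Import all_boot all_order all_algebra complex.
From mathcomp Require Import all_classical all_reals all_analysis.

Set Implicit Arguments.
Unset Strict Implicit.
Unset Printing Implicit Defensive.

Import Order.TTheory GRing.Theory Num.Theory numFieldNormedType.Exports.

Local Open Scope classical_set_scope.
Local Open Scope ring_scope.
Local Open Scope complex_scope.

Definition the (T : Type) (x0 : T) (P : set T) : T := @xget {classic T} x0 P.

(* Unital, with 1 != 0 (a consequence of [algType]).  The norm is a separate
   operation, because [algType] and [normedModType] have no common extension in
   the hierarchy besides number structures. *)
HB.mixin Record isCStarAlgebra (R : realType) A of GRing.Algebra R[i] A := {
  adj : A -> A;
  cnorm : A -> R;
  adjD : forall x y : A, adj (x + y) = adj x + adj y;
  adjZ : forall (z : R[i]) (x : A), adj (z *: x) = z^* *: adj x;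
  adjM : forall x y : A, adj (x * y) = adj y * adj x;
  adjK : forall x : A, adj (adj x) = x;
  cnormD_le : forall x y : A, cnorm (x + y) <= cnorm x + cnorm y;
  cnormZ : forall (z : R[i]) (x : A),
    cnorm (z *: x) = complex.Re `|z| * cnorm x;
  cnorm_eq0 : forall x : A, cnorm x = 0 -> x = 0;
  cnormM_le : forall x y : A, cnorm (x * y) <= cnorm x * cnorm y;
  cnorm_adjM : forall x : A, cnorm (adj x * x) = cnorm x ^+ 2;
  cnorm_complete : forall u : nat -> A,
    (forall r : R, 0 < r -> exists N, forall m n, (N <= m)%N -> (N <= n)%N ->
       cnorm (u m - u n) < r) ->
    exists l : A, (fun n => cnorm (u n - l)) @ \oo --> (0 : R)
}.

#[short(type="cstarType")]
HB.structure Definition CStarAlgebra (R : realType) :=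
  {A of GRing.Algebra R[i] A & isCStarAlgebra R A}.

(* The operations of an involutive unital algebra on a subset [sa_dom] of a
   type; their values outside of [sa_dom] are irrelevant. *)
Record staralg (R : realType) := StarAlg {
  sa_car :> Type;
  sa_dom : set sa_car;
  sa_add : sa_car -> sa_car -> sa_car;
  sa_mul : sa_car -> sa_car -> sa_car;
  sa_scale : R[i] -> sa_car -> sa_car;
  sa_adj : sa_car -> sa_car;
  sa_one : sa_car
}.
Arguments sa_dom {R} s _ : rename.

Record star_morphism (R : realType) (A B : staralg R) (f : A -> B) : Prop := {
  star_morphism_fun : set_fun (sa_dom A) (sa_dom B) f;
  star_morphismD : {in sa_dom A &, {morph f : x y / sa_add x y}};
  star_morphismM : {in sa_dom A &, {morph f : x y / sa_mul x y}};
  star_morphismZ : forall z, {in sa_dom A, {morph f : x / sa_scale z x}};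
  star_morphism_adj : {in sa_dom A, {morph f : x / sa_adj x}};
  star_morphism1 : f (sa_one A) = sa_one B
}.

Definition star_monomorphism (R : realType) (A B : staralg R) (f : A -> B) :=
  star_morphism f /\ set_inj (sa_dom A) f.

Definition star_isomorphism (R : realType) (A B : staralg R) (f : A -> B) :=
  star_morphism f /\ set_bij (sa_dom A) (sa_dom B) f.

Definition staralg_of (R : realType) (A : cstarType R) : staralg R :=
  {| sa_car := A; sa_dom := setT; sa_add := +%R; sa_mul := *%R;
     sa_scale := *:%R; sa_adj := adj; sa_one := 1 |}.

Definition matrix_staralg (R : realType) (d : nat) : staralg R :=
  {| sa_car := 'M[R[i]]_d; sa_dom := setT; sa_add := +%R; sa_mul := mulmx;
     sa_scale := *:%R; sa_adj := fun M => map_mx (fun z => z^*) M^T;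
     sa_one := 1%:M |}.

Definition corner (R : realType) (A : cstarType R) (e : A) : staralg R :=
  {| sa_car := A; sa_dom := [set x * e | x in setT]; sa_add := +%R;
     sa_mul := *%R; sa_scale := *:%R; sa_adj := adj; sa_one := e |}.

Definition has_dim (R : realType) (A : cstarType R) (d : nat) :=
  exists b : 'I_d -> A,
    bijective (fun z : {ffun 'I_d -> R[i]} => \sum_i z i *: b i).

Definition finite_dim (R : realType) (A : cstarType R) :=
  exists d, has_dim A d.

Definition central_projection (R : realType) (A : cstarType R) (e : A) :=
  [/\ e * e = e, adj e = e & forall x, e * x = x * e].

Definition minimal_central (R : realType) (A : cstarType R) : set A :=
  [set e | [/\ central_projection e, e != 0 &
     forall p, central_projection p -> p != 0 -> p * e = p -> p = e]].

Definition has_block_dim (R : realType) (A : cstarType R) (e : A) (d : nat) :=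
  exists f : matrix_staralg R d -> corner e, star_isomorphism f.

Definition block_dim (R : realType) (A : cstarType R) (e : A) : nat :=
  the 0%N (has_block_dim e).

(* [L], with the embeddings [phi k], is the closure of the union of the
   sequence [A 0 -> A 1 -> ...] with inclusions [h k]. *)
Definition closure_of_union (R : realType) (A : nat -> cstarType R)
    (h : forall k, A k -> A k.+1) (L : cstarType R) (phi : forall k, A k -> L) :=
  [/\ forall k, @star_monomorphism R (staralg_of (A k)) (staralg_of L) (phi k),
      forall k x, phi k.+1 (h k x) = phi k x &
      forall (x : L) (r : R), 0 < r -> exists k a, cnorm (x - phi k a) < r].

Fixpoint level_of (G U : Type) (atom : G -> U) (setof : set U -> U) (n : nat) :
    set U :=
  if n is m.+1 then
    level_of atom setof m `|` setof @` [set A | A `<=` level_of atom setof m]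
  else range atom.

(* The superstructure V(G), up to isomorphism: [setof A] is the element of V(G)
   that represents [A]; it is only meaningful when [A] lies in some V_n(G). *)
Record superstructure (G : Type) := Superstructure {
  ss_car :> Type;
  atom : G -> ss_car;
  elem : ss_car -> ss_car -> Prop;
  setof : set ss_car -> ss_car;
  atom_inj : injective atom;
  elem_atom : forall x g, ~ elem x (atom g);
  atom_setof : forall n A g, A `<=` level_of atom setof n -> atom g <> setof A;
  elem_setof : forall n A x, A `<=` level_of atom setof n ->
    elem x (setof A) <-> A x;
  ss_exhaust : forall x, exists n, level_of atom setof n x
}.
Arguments atom {G s}.
Arguments elem {G s}.
Arguments setof {G s}.

Definition level (G : Type) (V : superstructure G) : nat -> set V :=
  level_of (@atom G V) (@setof G V).

Section Coding.
Variables (G : Type) (V : superstructure G).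
Implicit Types (x y z : V).

Definition opair x y : V :=
  setof [set setof [set x]; setof [set x; y]].

Definition triple x y z : V := opair x (opair y z).

Definition is_function (D E : set V) (F : V) :=
  (forall p, elem p F -> exists x y, [/\ D x, E y & p = opair x y]) /\
  (forall x, D x -> exists! y, elem (opair x y) F).

(* A *-algebra with norm as an object of the superstructure: its carrier, the
   graphs of its operations and norm, and its unit. *)
Record algcode := AlgCode {
  c_dom : V; c_add : V; c_mul : V; c_scale : V; c_adj : V; c_one : V; c_norm : V
}.

Definition tuple_of_code (t : algcode) : V :=
  opair (c_dom t) (opair (c_add t) (opair (c_mul t) (opair (c_scale t)
    (opair (c_adj t) (opair (c_one t) (c_norm t)))))).

End Coding.

(* Bounded formulas of the language of set theory.  Variables are de Bruijn
   indices; [FEx j p] is "there is x in v_j with p". *)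
Inductive formula : Type :=
  | FElem of nat & nat
  | FEq of nat & nat
  | FNot of formula
  | FAnd of formula & formula
  | FEx of nat & formula.

Fixpoint holds (G : Type) (V : superstructure G) (v : nat -> V) (p : formula) :
    Prop :=
  match p with
  | FElem i j => elem (v i) (v j)
  | FEq i j => v i = v j
  | FNot q => ~ holds v q
  | FAnd q r => holds v q /\ holds v r
  | FEx j q => exists x, elem x (v j) /\
      holds (fun n => if n is m.+1 then v m else x) q
  end.

Definition natset (R : realType) (V : superstructure R) : V :=
  setof (range (fun n : nat => atom n%:R)).

Definition internal_in (R : realType) (G : Type) (V : superstructure R)
    (W : superstructure G) (star : V -> W) (x : W) :=
  exists n, elem x (star (setof (level n : set V))).

(* [hreal] is the set of hyperreals, and [std] the inclusion of R in it. *)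
Record nonstandard_extension (R : realType) := NonstandardExtension {
  hreal : Type;
  stdV : superstructure R;
  hypV : superstructure hreal;
  star : stdV -> hypV;
  std : R -> hreal;
  star_atom : forall r, star (atom r) = atom (std r);
  star_reals : star (setof (range atom)) = setof (range atom);
  transfer : forall (p : formula) (v : nat -> stdV),
    holds v p <-> holds (star \o v) p;
  nontrivial : exists u, forall r, std r <> u;
  saturation : forall (X : hypV) (x : nat -> hypV),
    internal_in star X -> (forall n, elem (x n) X) ->
    exists F, [/\ internal_in star F,
      is_function (elem^~ (star (natset stdV))) (elem^~ X) F &
      forall n, elem (opair (atom (std n%:R)) (x n)) F]
}.
Arguments star {R n}.
Arguments std {R n}.

Section Hyperreals.
Variables (R : realType) (E : nonstandard_extension R).
Local Notation V := (stdV E).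
Local Notation W := (hypV E).
Implicit Types u v : hreal E.

Definition internal (x : W) := internal_in (@star R E) x.

Definition hnat : set W := elem^~ (star (natset V)).

Definition hrel (P : R -> R -> Prop) u v :=
  elem (opair (atom u) (atom v))
    (star (setof ((fun x : R * R => opair (atom x.1) (atom x.2) : V) @`
                  [set x | P x.1 x.2]))).

Definition hop (f : R -> R -> R) u v : hreal E :=
  the (std 0) [set w | elem (triple (atom u) (atom v) (atom w))
    (star (setof (range (fun x : R * R =>
       triple (atom x.1) (atom x.2) (atom (f x.1 x.2)) : V))))].

Definition hle := hrel (fun x y => x <= y).
Definition hlt := hrel (fun x y => x < y).
Definition hadd := hop +%R.
Definition hmul := hop *%R.

Definition limited u := exists r : R, hle (std (- r)) u /\ hle u (std r).

Definition infinitesimal u :=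
  forall r : R, 0 < r -> hle (std (- r)) u /\ hle u (std r).

End Hyperreals.

Section StandardAlgebras.
Variables (R : realType) (V : superstructure R).

(* A C*-algebra in V(R) is the tuple [tuple_of_code (code c)], for a C*-algebra
   [A] copied into V(R) along an injection [c].  The complex number a + ib is represented by the pair (a, b). *)
Definition code (A : cstarType R) (c : A -> V) : algcode V := {|
  c_dom := setof (range c);
  c_add := setof (range (fun x : A * A => triple (c x.1) (c x.2) (c (x.1 + x.2))));
  c_mul := setof (range (fun x : A * A => triple (c x.1) (c x.2) (c (x.1 * x.2))));
  c_scale := setof (range (fun x : R[i] * A =>
    triple (opair (atom (complex.Re x.1)) (atom (complex.Im x.1)))
      (c x.2) (c (x.1 *: x.2))));
  c_adj := setof (range (fun x : A => opair (c x) (c (adj x))));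
  c_one := c 1;
  c_norm := setof (range (fun x : A => opair (c x) (atom (cnorm x))))
|}.

Definition coding (n : nat) (A : cstarType R) (c : A -> V) :=
  injective c /\ forall x, level n (c x).

Definition cstar_codes (n : nat) : V :=
  setof [set t | exists (A : cstarType R) (c : A -> V),
    coding n c /\ t = tuple_of_code (code c)].

Definition dim_graph (n : nat) : V :=
  setof [set t | exists (A : cstarType R) (c : A -> V) (d : nat),
    [/\ coding n c, has_dim A d &
        t = opair (tuple_of_code (code c)) (atom d%:R)]].

Definition minimal_central_graph (n : nat) : V :=
  setof [set t | exists (A : cstarType R) (c : A -> V) (e : A),
    [/\ coding n c, minimal_central e &
        t = opair (tuple_of_code (code c)) (c e)]].

Definition block_dim_graph (n : nat) : V :=
  setof [set t | exists (A : cstarType R) (c : A -> V) (e : A) (d : nat),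
    [/\ coding n c, minimal_central e, has_block_dim e d &
        t = triple (tuple_of_code (code c)) (c e) (atom d%:R)]].

End StandardAlgebras.

Record internal_cstar (R : realType) (E : nonstandard_extension R) :=
  InternalCStar {
    ic_code :> algcode (hypV E);
    ic_rank : nat;
    ic_cstar :
      elem (tuple_of_code ic_code) (star (cstar_codes (stdV E) ic_rank))
  }.

Section InternalAlgebra.
Variables (R : realType) (E : nonstandard_extension R) (B : internal_cstar E).
Local Notation W := (hypV E).
Implicit Types x y : W.

Definition hyperfinite_dim :=
  exists N : W, hnat N /\
    elem (opair (tuple_of_code B) N) (star (dim_graph (stdV E) (ic_rank B))).

Definition ic_minimal_central : set W :=
  [set e | elem (opair (tuple_of_code B) e)
             (star (minimal_central_graph (stdV E) (ic_rank B)))].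

Definition ic_block_dim (e : W) : hreal E :=
  the (std 0) [set N | elem (triple (tuple_of_code B) e (atom N))
                         (star (block_dim_graph (stdV E) (ic_rank B)))].

Definition ic_add x y : W := the x [set z | elem (triple x y z) (c_add B)].
Definition ic_mul x y : W := the x [set z | elem (triple x y z) (c_mul B)].
Definition ic_scale (z : R[i]) x : W :=
  the x [set y | elem (triple (opair (atom (std (complex.Re z)))
                                     (atom (std (complex.Im z)))) x y)
                   (c_scale B)].
Definition ic_adj x : W := the x [set y | elem (opair x y) (c_adj B)].
Definition ic_norm x : hreal E :=
  the (std 0) [set r | elem (opair x (atom r)) (c_norm B)].

(* The elements of the infinitesimal hull are the classes [hull_pi x], as subsets
    of Fin(B); the operations are those induced on classes. *)
Definition ic_fin : set W := [set x | elem x (c_dom B) /\ limited (ic_norm x)].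

Definition hull_pi x : set W :=
  [set y | ic_fin y /\ infinitesimal (ic_norm (ic_add x (ic_scale (-1) y)))].

Definition hull : staralg R := {|
  sa_car := set W;
  sa_dom := hull_pi @` ic_fin;
  sa_add := fun C D => \bigcup_(x in C) \bigcup_(y in D) hull_pi (ic_add x y);
  sa_mul := fun C D => \bigcup_(x in C) \bigcup_(y in D) hull_pi (ic_mul x y);
  sa_scale := fun z C => \bigcup_(x in C) hull_pi (ic_scale z x);
  sa_adj := fun C => \bigcup_(x in C) hull_pi (ic_adj x);
  sa_one := hull_pi (c_one B)
|}.

End InternalAlgebra.

Section Divisibility.
Variables (R : realType) (E : nonstandard_extension R).
Variables (T : choiceType) (I : set T) (J : set (hypV E)).

(* The index set [I] of the columns is finite, so that an internal family on
   J x I is the same as an I-tuple of internal families [Gam e] on J. *)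
Definition entry (Gam : T -> hypV E) (f : hypV E) (e : T) : hreal E :=
  the (std 0) [set N | elem (opair f (atom N)) (Gam e)].

Definition inclusion_matrix (Gam : T -> hypV E) :=
  [/\ forall e, I e -> internal (Gam e) /\ is_function J (@hnat R E) (Gam e),
      forall f, J f -> exists e, I e /\ hlt (std 0) (entry Gam f e) &
      forall e, I e -> exists f, J f /\ hlt (std 0) (entry Gam f e)].

Definition divides (m : T -> nat) (n : hypV E -> hreal E) :=
  exists Gam, inclusion_matrix Gam /\
    forall f, J f ->
      n f = \big[@hadd R E/std 0]_(e \in I) hmul (entry Gam f e) (std (m e)%:R).

End Divisibility.

Definition dimvec_divides (R : realType) (E : nonstandard_extension R)
    (A : cstarType R) (B : internal_cstar E) :=
  divides (@minimal_central R A) (ic_minimal_central B)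
    (@block_dim R A) (ic_block_dim B).

(* Main.v *)
(* An internal element w of *S induces an ultrafilter on S, and the transfer principle says that
   standard functions evaluated at w behave like an ultrapower along it.  Writing B and finitely many
   of its elements as one internal w thus reduces every statement about B to a statement that holds
   for almost every standard finite dimensional C*-algebra.

   If A_k embeds in the hull, lift its matrix units to B.  They satisfy the matrix unit relations up
   to every standard epsilon, so it suffices that, for a small epsilon, approximate matrix units in a
   finite dimensional algebra give a multiplicity matrix.  The element X = sum_a a x_a, where the x_a
   approximate the diagonal units, has its spectrum close to the integers a; its spectral projections
   P_a are orthogonal, have sum 1 and are close to the x_a, and the ranks of the P_a in a block are
   constant on each matrix summand of A_k because the off-diagonal units intertwine the P_a up to a
   small error.

   Conversely, divisibility says that A_k embeds in almost every standard algebra (with respect to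
   B), for each k.  As there is an infinite natural number, overspill gives an index N that exceeds
   every standard k such that *A_N embeds internally in B.  An element y of the closure of the union
   is sent to the class of the image of a best approximation of y in *A_N; this is a *-morphism
   because the approximation error is infinitesimal and because injective *-morphisms of finite
   dimensional C*-algebras are isometric. *)
Require Import Defs.
From mathcomp Require Import all_boot all_order all_algebra complex.
From mathcomp Require Import all_classical all_reals all_analysis.
From mathcomp Require Import ring lra.

Set Implicit Arguments.
Unset Strict Implicit.
Unset Printing Implicit Defensive.

Import Order.TTheory GRing.Theory Num.Theory.

Local Open Scope classical_set_scope.
Local Open Scope ring_scope.
Local Open Scope complex_scope.

Local Notation code := Defs.code.

(** * Superstructures and bounded formulas *)

(** Transfer speaks only of bounded formulas over V(R), whereas the algebras are Rocq types with
    operations. It is therefore applied only to sets and graphs of functions cut off at a level,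
    which yields the analogue of Los's theorem. All algebra then takes place at a standard point,
    and choice glues pointwise witnesses (elements, even morphisms between algebras that vary with
    the point) into families whose values at [w] are internal. The internal embedding of *A_N is
    never formed as an object; only the values of the pointwise embeddings on chosen families are.

    Two obstacles shape the rest. The standard algebras behind B may have unbounded dimension, so
    the tolerance allowed for approximate matrix units must depend on A_k and on norm bounds only.
    And the index k for which A_k is embedded varies with the standard point; all that is known, and
    all that the argument uses, is that every fixed k is reached almost everywhere. *)

Section Superstructure.
Variables (G : Type) (V : superstructure G).
Implicit Types (x y z a b : V) (S : set V).

Lemma level_mono m n x : (m <= n)%N -> level m x -> level n x.
Proof.
by move=> /subnK <-; elim: (n - m)%N => //= k IH /IH; left.
Qed.

Lemma level_setof n S : S `<=` level n -> level n.+1 (setof S).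
Proof. by move=> Sn; right; exists S. Qed.

Lemma level_common x y : exists n, level n x /\ level n y.
Proof.
have [n xn] := ss_exhaust x; have [m ym] := ss_exhaust y.
exists (maxn n m); split; [apply: level_mono xn|apply: level_mono ym].
  exact: leq_maxl.
exact: leq_maxr.
Qed.

Lemma elem_setofE n S x : S `<=` level n -> elem x (setof S) <-> S x.
Proof. exact: elem_setof. Qed.

Lemma elem_level n x : elem x (setof (level n)) <-> @level _ V n x.
Proof. exact: (@elem_setofE n). Qed.

Lemma elem_andlevel n S x : elem x (setof (S `&` level n)) <-> (S `&` level n) x.
Proof. by apply: (@elem_setofE n) => y []. Qed.

Lemma elem_set1 x z : elem z (setof [set x]) <-> z = x.
Proof. by have [n xn] := ss_exhaust x; apply: (@elem_setof _ _ n) => _ ->. Qed.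

Lemma elem_set2 x y z : elem z (setof [set x; y]) <-> z = x \/ z = y.
Proof.
have [n [xn yn]] := level_common x y.
by apply: (@elem_setof _ _ n) => _ [] ->.
Qed.

Lemma is_setof a x : elem x a -> exists n S, S `<=` level n /\ a = setof S.
Proof.
have [n] := ss_exhaust a; elim: n => [|n IH] /=.
  by move=> [g _ <-] xg; case: (elem_atom xg).
by case=> [an|[S Sn <-] _]; [exact: IH|exists n, S].
Qed.

(** Both objects must have an element: atoms and the empty set all have none, so extensionality
    fails for them. *)
Lemma ss_ext a b x y : elem x a -> elem y b ->
  (forall z, elem z a <-> elem z b) -> a = b.
Proof.
move=> /is_setof[n [S [Sn ->]]] /is_setof[m [S' [Sm ->]]] ab.
congr setof; apply/funext => z; apply/propext.
by rewrite -(elem_setofE _ Sn) -(elem_setofE _ Sm).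
Qed.

Lemma elem_opair x y z :
  elem z (opair x y) <-> z = setof [set x] \/ z = setof [set x; y].
Proof. exact: elem_set2. Qed.

Lemma opair_inj x y x' y' : opair x y = opair x' y' -> x = x' /\ y = y'.
Proof.
move=> e.
have xx' : x = x'.
  have : elem (setof [set x]) (opair x' y').
    by rewrite -e; apply/elem_opair; left.
  move=> /elem_opair[] e'.
    by apply/esym/elem_set1; rewrite e'; apply/elem_set1.
  by apply/esym/elem_set1; rewrite e'; apply/elem_set2; left.
subst x'; split=> //.
have : elem (setof [set x; y]) (opair x y').
  by rewrite -e; apply/elem_opair; right.
have : elem (setof [set x; y']) (opair x y).
  by rewrite e; apply/elem_opair; right.
move=> /elem_opair[] e1 /elem_opair[] e2.
- have : elem y' (setof [set x]) by rewrite -e1; apply/elem_set2; right.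
  have : elem y (setof [set x]) by rewrite -e2; apply/elem_set2; right.
  by move=> /elem_set1 -> /elem_set1 ->.
- have : elem y' (setof [set x]) by rewrite -e1; apply/elem_set2; right.
  have : elem y (setof [set x; y']) by rewrite -e2; apply/elem_set2; right.
  by move=> /elem_set2[] -> /elem_set1 ->.
- have : elem y (setof [set x]) by rewrite -e2; apply/elem_set2; right.
  have : elem y' (setof [set x; y]) by rewrite -e1; apply/elem_set2; right.
  by move=> /elem_set2[] -> /elem_set1 ->.
- have : elem y' (setof [set x; y]) by rewrite -e1; apply/elem_set2; right.
  have : elem y (setof [set x; y']) by rewrite -e2; apply/elem_set2; right.
  by move=> /elem_set2[] -> // /elem_set2[] ->.
Qed.

Lemma level_opair n x y : level n x -> level n y -> level n.+2 (opair x y).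
Proof.
move=> xn yn; apply: level_setof => _ [] ->.
  by apply: level_setof => _ ->.
by apply: level_setof => _ [] ->.
Qed.

Lemma level_elem n x y : level n y -> elem x y -> level n x.
Proof.
elim: n x y => [|n IH] x y /=.
  by move=> [g _ <-] xg; case: (elem_atom xg).
move=> [yn xy|[S Sn <-] /(elem_setofE _ Sn)]; left; first exact: IH xy.
exact: Sn.
Qed.

Lemma level_pair n x y : level n (opair x y) -> level n x /\ level n y.
Proof.
move=> p; split; apply: (@level_elem n _ (setof [set x; y])).
- by apply: level_elem p _; apply/elem_opair; right.
- by apply/elem_set2; left.
- by apply: level_elem p _; apply/elem_opair; right.
- by apply/elem_set2; right.
Qed.

Definition scons T (x : T) (v : nat -> T) n := if n is m.+1 then v m else x.

(* [XPair i j k] is v_i = (v_j, v_k), and [XPairIn i j k] is (v_i, v_j) in v_k. *)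
Inductive xformula : Type :=
  | XElem of nat & nat
  | XEq of nat & nat
  | XPair of nat & nat & nat
  | XPairIn of nat & nat & nat
  | XNot of xformula
  | XAnd of xformula & xformula
  | XImp of xformula & xformula
  | XAll of nat & xformula
  | XEx of nat & xformula.

Fixpoint xholds (v : nat -> V) (p : xformula) : Prop :=
  match p with
  | XElem i j => elem (v i) (v j)
  | XEq i j => v i = v j
  | XPair i j k => v i = opair (v j) (v k)
  | XPairIn i j k => elem (opair (v i) (v j)) (v k)
  | XNot q => ~ xholds v q
  | XAnd q r => xholds v q /\ xholds v r
  | XImp q r => xholds v q -> xholds v r
  | XAll j q => forall x, elem x (v j) -> xholds (scons x v) q
  | XEx j q => exists x, elem x (v j) /\ xholds (scons x v) q
  end.

Definition FImp p q := FNot (FAnd p (FNot q)).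
Definition FAll j p := FNot (FEx j (FNot p)).
Definition FOr p q := FNot (FAnd (FNot p) (FNot q)).

(** Kuratowski's pair needs no unbounded quantifier, because the singleton (index 1 under the two
    binders) and the unordered pair (index 0) are elements of v_i itself. *)
Definition FPair i j k :=
  FEx i (FEx i.+1
    (FAnd (FAnd (FElem j.+2 1) (FAll 1 (FEq 0 j.+3)))
    (FAnd (FAnd (FAnd (FElem j.+2 0) (FElem k.+2 0))
                (FAll 0 (FOr (FEq 0 j.+3) (FEq 0 k.+3))))
          (FAll i.+2 (FOr (FEq 0 2) (FEq 0 1)))))).

(** For [XPairIn] the pair is quantified over the set to which it belongs, so the result is again a
    bounded formula. *)
Fixpoint compile (p : xformula) : formula :=
  match p with
  | XElem i j => FElem i j
  | XEq i j => FEq i j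
  | XPair i j k => FPair i j k
  | XPairIn i j k => FEx k (FPair 0 i.+1 j.+1)
  | XNot q => FNot (compile q)
  | XAnd q r => FAnd (compile q) (compile r)
  | XImp q r => FImp (compile q) (compile r)
  | XAll j q => FAll j (compile q)
  | XEx j q => FEx j (compile q)
  end.

Lemma holds_imp v p q : holds (V := V) v (FImp p q) <-> (holds v p -> holds v q).
Proof.
split=> /= [H hp|H [hp]]; last by apply; exact: H.
by apply: contrapT => nq; apply: H.
Qed.

Lemma holds_ex v j p : holds (V := V) v (FEx j p) =
  exists x, elem x (v j) /\ holds (scons x v) p.
Proof. by []. Qed.

Lemma holds_all v j p : holds (V := V) v (FAll j p) <->
  (forall x, elem x (v j) -> holds (scons x v) p).
Proof.
split=> /= [H x xj|H [x [xj]]]; last by apply; exact: H.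
by apply: contrapT => np; apply: H; exists x.
Qed.

Lemma not_exists_not (P Q : V -> Prop) :
  ~ (exists x, P x /\ ~ Q x) <-> forall x, P x -> Q x.
Proof.
split=> [H x Px|H [x [/H]]//].
by apply: contrapT => nQ; apply: H; exists x.
Qed.

Lemma not_and_not (P Q : Prop) : ~ (~ P /\ ~ Q) <-> P \/ Q.
Proof.
split=> [H|[p []//|q []//]].
by have [|np] := pselect P; [left|right; apply: contrapT => nq; apply: H].
Qed.

Lemma holds_pair (v : nat -> V) i j k :
  holds v (FPair i j k) <-> v i = opair (v j) (v k).
Proof.
split=> /=.
  move=> [a [ai [b [bi]]]] [] [xa /not_exists_not a1] [] [] [] xb yb.
  move=> /not_exists_not b2 /not_exists_not i2.
  have ea : a = setof [set v j].
    apply: (@ss_ext _ _ (v j) (v j)) => //; first by apply/elem_set1.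
    by move=> z; split => [/a1 /elem_set1 //|/elem_set1 ->].
  have eb : b = setof [set v j; v k].
    apply: (@ss_ext _ _ (v j) (v j)) => //; first by apply/elem_set2; left.
    by move=> z; split => [/b2 /not_and_not /elem_set2 //|/elem_set2 [] ->].
  apply: (@ss_ext _ _ a a) => //; first by apply/elem_opair; left.
  move=> z; split => [/i2/not_and_not|/elem_opair []].
  - by rewrite ea eb => /elem_opair.
  - by rewrite -ea => ->.
  - by rewrite -eb => ->.
move=> e; exists (setof [set v j]); split.
  by rewrite e; apply/elem_opair; left.
exists (setof [set v j; v k]); split.
  by rewrite e; apply/elem_opair; right.
split; [split|split; [split; [split|]|]].
- exact/elem_set1.
- by apply/not_exists_not => z /elem_set1.
- by apply/elem_set2; left.
- by apply/elem_set2; right.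
- by apply/not_exists_not => z /elem_set2 ?; apply/not_and_not.
- by apply/not_exists_not => z zi; apply/not_and_not; move: zi; rewrite e => /elem_opair.
Qed.

Lemma compileP v p : holds v (compile p) <-> xholds v p.
Proof.
elim: p v => [i j|i j|i j k|i j k|p IH|p IHp q IHq|p IHp q IHq|j p IH|j p IH] v //.
- exact: holds_pair.
- rewrite [compile _]/= holds_ex; split=> [[x [xk]]|H].
    by move=> /holds_pair /= <-.
  by exists (opair (v i) (v j)); split => //; apply/holds_pair.
- by rewrite /= IH.
- by rewrite /= IHp IHq.
- by rewrite [compile _]/= holds_imp IHp IHq.
- rewrite [compile _]/= holds_all; split => H x xj; last by apply/IH/H.
  exact/IH/H.
- rewrite [compile _]/= holds_ex.
  by split=> -[x [xj H]]; exists x; split => //; apply/IH.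
Qed.

End Superstructure.

(** * Lifting standard functions along internal elements *)

Section Transfer.
Variables (R : realType) (E : nonstandard_extension R).
Local Notation V := (stdV E).
Local Notation W := (hypV E).
Local Notation st := (@star R E).
Implicit Types (w : W) (f g : V -> V).

(** The parameters in [l] are standard. Internal objects enter through quantifiers bounded by
    standard sets, usually a level: after transfer these range over the elements of the extended
    sets. *)
Lemma xtransfer (l : seq V) (p : xformula) :
  xholds (nth (atom 0) l) p -> xholds (fun n => st (nth (atom 0) l n)) p.
Proof. by move/compileP/transfer/compileP. Qed.

(** The nonstandard extension of [S], meaningful when [S] lies in one level; hence the level bounds
    in the lemmas that follow. *)
Definition star_set (S : set V) : set W := elem^~ (st (setof S)).

Lemma star_set_sub n (S S' : set V) w : S' `<=` level n -> S `<=` S' ->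
  star_set S w -> star_set S' w.
Proof.
move=> S'n SS'.
have SN : S `<=` level n by move=> x /SS' /S'n.
apply: (@xtransfer [:: setof S; setof S'] (XAll 0 (XElem 0 2))) => /= x.
by move=> /(elem_setofE _ SN)/SS' ?; apply/(elem_setofE _ S'n).
Qed.

Lemma star_set_and n (S S' : set V) w : S `<=` level n -> 
  star_set S w -> star_set S' w -> S' `<=` level n -> star_set (S `&` S') w.
Proof.
move=> Sn Sw S'w S'n; move: Sw S'w.
apply: (@xtransfer [:: setof S; setof S'; setof (S `&` S')]
  (XAll 0 (XImp (XElem 0 2) (XElem 0 3)))) => /= x.
move=> /(elem_setofE _ Sn) Sx /(elem_setofE _ S'n) S'x; apply/(@elem_setofE _ _ n); first by move=> y [/Sn].
by [].
Qed.

Lemma star_set_not n (S : set V) w : S `<=` level n -> 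
  star_set (level n) w -> (star_set (~` S `&` level n) w <-> ~ star_set S w).
Proof.
move=> Sn wn; split.
  move: wn; apply: (@xtransfer [:: setof (level n); setof S; setof (~` S `&` level n)]
  (XAll 0 (XImp (XElem 0 3) (XNot (XElem 0 2))))) => /= x.
  by rewrite (elem_setofE _ Sn) => _ /(@elem_setofE _ _ n) [|//] y [].
move: wn; apply: (@xtransfer [:: setof (level n); setof S; setof (~` S `&` level n)]
  (XAll 0 (XImp (XNot (XElem 0 2)) (XElem 0 3)))) => /= x.
rewrite (elem_setofE _ Sn) (@elem_setofE _ _ n (level n)) // => xn nS.
by apply/(@elem_setofE _ _ n) => [y []|].
Qed.

(* For an internal w, [ae w] is the ultrafilter of the standard sets P with w in *P; only the part of
   P in some level of V(R) is an object of V(R). *)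
Definition ae (w : W) (P : set V) := exists n, star_set (P `&` level n) w.

Lemma ae_ge w P n m : star_set (P `&` level n) w -> (n <= m)%N -> star_set (P `&` level m) w.
Proof.
move=> H nm; apply: (@star_set_sub m) H => [x []//|x [Px xn]]; split=> //.
exact: level_mono xn.
Qed.

Lemma star_set_level_ge w n m : star_set (level n) w -> (n <= m)%N -> star_set (level m) w.
Proof.
by move=> H nm; apply: (@star_set_sub m) H => // x xn; apply: level_mono xn.
Qed.

Lemma ae_internal w P : ae w P -> internal w.
Proof.
by move=> [n H]; exists n; apply: (@star_set_sub n) H => // x [].
Qed.

Lemma ae_sub w (P Q : set V) : P `<=` Q -> ae w P -> ae w Q.
Proof.
by move=> PQ [n H]; exists n; apply: (@star_set_sub n) H => [x []//|x [/PQ]].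
Qed.

Lemma ae_and w (P Q : set V) : ae w P -> ae w Q -> ae w (P `&` Q).
Proof.
move=> [n Hn] [m Hm]; exists (maxn n m).
have H1 := ae_ge Hn (leq_maxl n m).
have H2 := ae_ge Hm (leq_maxr n m).
apply: (@star_set_sub (maxn n m)) (star_set_and (n := maxn n m) _ H1 H2 _).
- by move=> x [].
- by move=> x [[Px xn] [Qx _]].
- by move=> x [].
- by move=> x [].
Qed.

(** Maximality of the ultrafilter: inside one level that contains [w], the extension of a complement
    is the complement of the extension. A [w] that lies in no extended level satisfies [ae w] for no
    set at all. *)
Lemma ae_not w (P : set V) : internal w -> (ae w (~` P) <-> ~ ae w P).
Proof.
move=> [n0 wn]; split => [aN aP|H].
  have [n Hn] := ae_and aN aP.
  have wi : star_set (level n) w by apply: (@star_set_sub n) Hn => // x [].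
  have [h _] := @star_set_not n (~` P `&` P `&` level n) w (fun x H => H.2) wi.
  apply: (h _) Hn; apply: (@star_set_sub n) wi => [x []//|x xn].
  by split => // -[[]].
exists n0.
have [_ h] := @star_set_not n0 (P `&` level n0) w (fun x H => H.2) wn.
have {h}: star_set (~` (P `&` level n0) `&` level n0) w.
  by apply: h => h; apply: H; exists n0.
apply: (@star_set_sub n0) => [x []//|x [nP xn]]; split => // Px; exact: nP.
Qed.

Lemma ae_all w (P : set V) : internal w -> (forall x, P x) -> ae w P.
Proof. by move=> [n wn] H; exists n; apply: (@star_set_sub n) wn => // x []. Qed.

Lemma ae_false w (P : set V) : ae w P -> (forall x, ~ P x) -> False.
Proof.
move=> aP nP; have wi := ae_internal aP.
by apply: (ae_not P wi).1 => //; apply: ae_all.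
Qed.

Lemma ae_exists w (P : set V) : ae w P -> exists x, P x.
Proof.
by move=> aP; apply: contrapT => /forallNP /(ae_false aP).
Qed.

(** Only finitely many conditions can be combined: [infinite_index] rests on a countable family of
    conditions, each true almost everywhere, whose conjunction is false almost everywhere. *)
Lemma ae_seq (T : eqType) w (s : seq T) (P : T -> set V) : internal w ->
  (forall i, i \in s -> ae w (P i)) -> ae w [set x | forall i, i \in s -> P i x].
Proof.
move=> wi; elim: s => [|i s IH] H; first exact: ae_all.
have /= H1 := IH (fun j js => H j (mem_behead (s := i :: s) js)).
have := ae_and (H i (mem_head _ _)) H1.
by apply: ae_sub => x [Pi Ps] j; rewrite inE => /orP[/eqP -> //|/Ps].
Qed.

Lemma ae_fin (I : finType) w (P : I -> set V) : internal w ->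
  (forall i, ae w (P i)) -> ae w [set x | forall i, P i x].
Proof.
move=> wi H; apply: ae_sub (@ae_seq I w (enum I) P wi _) => [x Hx i|i _//].
by apply: Hx; rewrite mem_enum.
Qed.

(** Arguments and values are cut off at level [n] because a function on all of [V] is not an object
    of the superstructure. *)
Definition graph (f : V -> V) n : set V :=
  [set p | exists x, [/\ level n x, level n (f x) & p = opair x (f x)]].

Lemma graph_level f n : graph f n `<=` level n.+2.
Proof. by move=> _ [x [xn fn ->]]; exact: level_opair. Qed.

Lemma graph_in f n x y : elem (opair x y) (setof (graph f n)) <->
  [/\ level n x, level n y & y = f x].
Proof.
rewrite (elem_setofE _ (@graph_level f n)); split.
  by move=> [x' [xn fn]] /opair_inj [-> ->].
by move=> [xn yn yf]; exists x; rewrite -yf.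
Qed.

(* w' is the value at w of the extension of the standard function f, which is only required to map
   ae w-almost every point into one level. *)
Definition lifts (f : V -> V) (w w' : W) := exists n, star_set (graph f n) (opair w w').

Lemma lifts_ge f w w' n m : star_set (graph f n) (opair w w') -> (n <= m)%N ->
  star_set (graph f m) (opair w w').
Proof.
move=> H nm; apply: star_set_sub H; first exact: graph_level.
move=> _ [x [xn fn ->]]; exists x; split => //; exact: level_mono nm _.
Qed.

Lemma lifts_level f w w' n : star_set (graph f n) (opair w w') ->
  star_set (level n) w /\ star_set (level n) w'.
Proof.
move=> H.
have [x [xn [y [yn /opair_inj[-> ->]]]]] : 
    exists x, star_set (level n) x /\ exists y, star_set (level n) y /\ opair w w' = opair x y.
  move: (opair w w') H.
  apply: (@xtransfer [:: setof (graph f n); setof (level n)]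
    (XAll 0 (XEx 2 (XEx 3 (XPair 2 1 0))))) => /= p.
  move=> /(elem_setofE _ (@graph_level f n))[x [xn fn ->]].
  by exists x; split; [exact/elem_level|exists (f x); split => //; exact/elem_level].
by [].
Qed.

Lemma lifts_internal f w w' : lifts f w w' -> internal w /\ internal w'.
Proof. by move=> [n /lifts_level[]]; split; exists n. Qed.

Lemma lifts_common f g w w1 w2 : lifts f w w1 -> lifts g w w2 ->
  exists n, [/\ star_set (graph f n) (opair w w1), star_set (graph g n) (opair w w2),
   star_set (level n) w, star_set (level n) w1 & star_set (level n) w2].
Proof.
move=> [n Hn] [m Hm]; exists (maxn n m).
have H1 := lifts_ge Hn (leq_maxl n m).
have H2 := lifts_ge Hm (leq_maxr n m).
by have [? ?] := lifts_level H1; have [? ?] := lifts_level H2.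
Qed.

Lemma lifts_ex f w m : ae w [set x | level m (f x)] -> exists w', lifts f w w'.
Proof.
move=> [n H0]; pose k := maxn n m.
have {H0}: star_set ([set x | level k (f x)] `&` level k) w.
  apply: (@star_set_sub k) H0 => [x []//|x [/= xm xn]]; split.
    by apply: level_mono xm; exact: leq_maxr.
  by apply: level_mono xn; exact: leq_maxl.
move=> H; have [w' [_ H']] : exists w', star_set (level k) w' /\ star_set (graph f k) (opair w w').
  move: w H; apply: (@xtransfer [:: setof ([set x | level k (f x)] `&` level k);
    setof (level k); setof (graph f k)] (XAll 0 (XEx 2 (XPairIn 1 0 4)))) => /= x.
  move=> /elem_andlevel [xk kx].
  by exists (f x); split; [exact/elem_level|exact/graph_in].
by exists w', k.
Qed.

(** The ultrafilter of [w'] is the image of that of [w] under [f]. Transfer gives one inclusion; the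
    other is the same inclusion applied to the complement, since both are ultrafilters. *)
Lemma lifts_ae f w w' P : lifts f w w' -> ae w' P <-> ae w [set x | P (f x)].
Proof.
move=> [n0 H0].
have main Q : ae w' Q -> ae w [set x | Q (f x)].
  move=> [m Hm]; pose k := maxn n0 m.
  have H1 := lifts_ge H0 (leq_maxl n0 m).
  have H2 := ae_ge Hm (leq_maxr n0 m).
  have [wk w'k] := lifts_level H1.
  exists k; move: w wk w' w'k {H0 Hm} H1 H2.
  apply: (@xtransfer [:: setof (level k); setof (graph f k); setof (Q `&` level k);
    setof ([set x | Q (f x)] `&` level k)]
    (XAll 0 (XAll 1 (XImp (XPairIn 1 0 3) (XImp (XElem 0 4) (XElem 1 5)))))) => /=.
  move=> x _ y _ /graph_in[xk + e]; rewrite {}e {y} => yk.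
  by move=> /elem_andlevel [Qfx _]; apply/elem_andlevel.
split; first exact: main.
move=> aP; have [[n1 h1] [n2 h2]] := lifts_internal (ex_intro _ n0 H0).
apply: contrapT => /(ae_not _ (ex_intro _ n2 h2)).2 /main.
by move=> /(ae_not _ (ex_intro _ n1 h1)).1.
Qed.

Lemma lifts_bdd f w w' : lifts f w w' -> exists m, ae w [set x | level m (f x)].
Proof.
by move=> vf; have [_ [m H]] := lifts_internal vf; exists m;
  apply/(lifts_ae _ vf); exists m; apply: star_set_sub H.
Qed.

(** Los's theorem for equality. For [f = g] it says that the value of a function at [w] is
    unique. *)
Lemma lifts_eq f g w w1 w2 : lifts f w w1 -> lifts g w w2 ->
  w1 = w2 <-> ae w [set x | f x = g x].
Proof.
move=> vf vg; have [n [h1 h2 wn w1n w2n]] := lifts_common vf vg.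
split.
  move=> e; exists n; move: w wn w1 w1n w2 w2n {vf vg} h1 h2 e.
  apply: (@xtransfer [:: setof (level n); setof (graph f n); setof (graph g n);
    setof ([set x | f x = g x] `&` level n)]
    (XAll 0 (XAll 1 (XAll 2 (XImp (XPairIn 2 1 4) (XImp (XPairIn 2 0 5) 
    (XImp (XEq 1 0) (XElem 2 6)))))))) => /=.
  move=> x xn y yn z zn /graph_in[{}xn _ ->] /graph_in[_ _ ->] e.
  by apply/elem_andlevel.
move=> [m Hm]; pose k := maxn n m.
have H1 := lifts_ge h1 (leq_maxl n m).
have H2 := lifts_ge h2 (leq_maxl n m).
have H3 := ae_ge Hm (leq_maxr n m).
have wk := star_set_level_ge wn (leq_maxl n m).
have w1k := star_set_level_ge w1n (leq_maxl n m).
have w2k := star_set_level_ge w2n (leq_maxl n m).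
move: w wk w1 w1k w2 w2k H1 H2 H3 {vf vg h1 h2 wn w1n w2n Hm}.
apply: (@xtransfer [:: setof (level k); setof (graph f k); setof (graph g k);
  setof ([set x | f x = g x] `&` level k)]
  (XAll 0 (XAll 1 (XAll 2 (XImp (XPairIn 2 1 4) (XImp (XPairIn 2 0 5) 
  (XImp (XElem 2 6) (XEq 1 0)))))))) => /=.
move=> x xn y yn z zn /graph_in[{}xn _ ->] /graph_in[_ _ ->].
by move=> /elem_andlevel [].
Qed.

(** Los's theorem for membership, the other atomic case. Connectives and quantifiers are handled by
    [ae_and], [ae_not] and pointwise choice. *)
Lemma lifts_elem f g w w1 w2 : lifts f w w1 -> lifts g w w2 ->
  elem w1 w2 <-> ae w [set x | elem (f x) (g x)].
Proof.
move=> vf vg; have [n [h1 h2 wn w1n w2n]] := lifts_common vf vg.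
split.
  move=> e; exists n; move: w wn w1 w1n w2 w2n {vf vg} h1 h2 e.
  apply: (@xtransfer [:: setof (level n); setof (graph f n); setof (graph g n);
    setof ([set x | elem (f x) (g x)] `&` level n)]
    (XAll 0 (XAll 1 (XAll 2 (XImp (XPairIn 2 1 4) (XImp (XPairIn 2 0 5) 
    (XImp (XElem 1 0) (XElem 2 6)))))))) => /=.
  move=> x xn y yn z zn /graph_in[{}xn _ ->] /graph_in[_ _ ->] e.
  by apply/elem_andlevel.
move=> [m Hm]; pose k := maxn n m.
have H1 := lifts_ge h1 (leq_maxl n m).
have H2 := lifts_ge h2 (leq_maxl n m).
have H3 := ae_ge Hm (leq_maxr n m).
have wk := star_set_level_ge wn (leq_maxl n m).
have w1k := star_set_level_ge w1n (leq_maxl n m).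
have w2k := star_set_level_ge w2n (leq_maxl n m).
move: w wk w1 w1k w2 w2k H1 H2 H3 {vf vg h1 h2 wn w1n w2n Hm}.
apply: (@xtransfer [:: setof (level k); setof (graph f k); setof (graph g k);
  setof ([set x | elem (f x) (g x)] `&` level k)]
  (XAll 0 (XAll 1 (XAll 2 (XImp (XPairIn 2 1 4) (XImp (XPairIn 2 0 5) 
  (XImp (XElem 2 6) (XElem 1 0)))))))) => /=.
move=> x xn y yn z zn /graph_in[{}xn _ ->] /graph_in[_ _ ->].
by move=> /elem_andlevel [].
Qed.

Lemma lifts_ext f g w w' : lifts f w w' -> ae w [set x | f x = g x] -> lifts g w w'.
Proof.
move=> vf e; have [m bm] := lifts_bdd vf.
have [w'' vg] : exists w'', lifts g w w''.
  apply: (@lifts_ex _ _ m); apply: ae_sub (ae_and bm e) => x [/=].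
  by move=> ? <-.
by rewrite ((lifts_eq vf vg).2 e).
Qed.

(** The pointwise pairing has some value at [w] by boundedness; transfer of the definition of pairs
    identifies this value with the pair formed in [W]. *)
Lemma lifts_pair f g w w1 w2 : lifts f w w1 -> lifts g w w2 ->
  lifts (fun x => opair (f x) (g x)) w (opair w1 w2).
Proof.
move=> vf vg; have [n [h1 h2 wn w1n w2n]] := lifts_common vf vg.
have [n1 f1] := lifts_bdd vf; have [n2 f2] := lifts_bdd vg.
pose k := maxn n1 n2.
have [w3 vp] : exists w', lifts (fun x => opair (f x) (g x)) w w'.
  apply: (@lifts_ex _ _ k.+2); apply: ae_sub (ae_and f1 f2) => x [h h'] /=.
  apply: level_opair; first by apply: level_mono h; exact: leq_maxl.
  by apply: level_mono h'; exact: leq_maxr.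
suff <- : w3 = opair w1 w2 by [].
have [m hm] := vp.
pose q := maxn n m.
have H1 := lifts_ge h1 (leq_maxl n m).
have H2 := lifts_ge h2 (leq_maxl n m).
have H3 := lifts_ge hm (leq_maxr n m).
have wk := star_set_level_ge wn (leq_maxl n m).
have w1k := star_set_level_ge w1n (leq_maxl n m).
have w2k := star_set_level_ge w2n (leq_maxl n m).
have [_ w3k] := lifts_level H3.
move: w wk w1 w1k w2 w2k w3 w3k H1 H2 H3 {vf vg h1 h2 wn w1n w2n vp hm f1 f2}.
apply: (@xtransfer [:: setof (level q); setof (graph f q); setof (graph g q);
  setof (graph (fun x => opair (f x) (g x)) q)]
  (XAll 0 (XAll 1 (XAll 2 (XAll 3 (XImp (XPairIn 3 2 5) (XImp (XPairIn 3 1 6) 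
  (XImp (XPairIn 3 0 7) (XPair 0 2 1))))))))) => /=.
by move=> x _ y _ z _ u _ /graph_in[_ _ ->] /graph_in[_ _ ->] /graph_in[_ _ ->].
Qed.

Lemma lifts_comp f g w w1 w2 : lifts f w w1 -> lifts g w1 w2 ->
  lifts (fun x => g (f x)) w w2.
Proof.
move=> [n h1] [m h2]; pose k := maxn n m; exists k.
have {h1} H1 := lifts_ge h1 (leq_maxl n m).
have {h2} H2 := lifts_ge h2 (leq_maxr n m).
have [wk w1k] := lifts_level H1.
have [_ w2k] := lifts_level H2.
move: w wk w1 w1k w2 w2k H1 H2.
apply: (@xtransfer [:: setof (level k); setof (graph f k); setof (graph g k);
  setof (graph (fun x => g (f x)) k)]
  (XAll 0 (XAll 1 (XAll 2 (XImp (XPairIn 2 1 4) (XImp (XPairIn 1 0 5) 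
  (XPairIn 2 0 6))))))) => /=.
move=> x _ y _ z _ /graph_in[xk _ ->] /graph_in[_ zk ze]; apply/graph_in.
by split.
Qed.

Lemma lifts_id w : internal w -> lifts id w w.
Proof.
move=> [n wn]; exists n; move: w wn.
apply: (@xtransfer [:: setof (level n); setof (graph id n)]
  (XAll 0 (XPairIn 0 0 2))) => /= x /elem_level xn.
exact/graph_in.
Qed.

Lemma lifts_const s w : internal w -> lifts (fun=> s) w (st s).
Proof.
move=> [n wn]; have [m sm] := ss_exhaust s; pose k := maxn n m; exists k.
have wk : star_set (level k) w := star_set_level_ge wn (leq_maxl n m).
have sk : level k s by apply: level_mono sm; exact: leq_maxr.
move: w wk {wn}.
apply: (@xtransfer [:: setof (level k); setof (graph (fun=> s) k); s]
  (XAll 0 (XPairIn 0 3 2))) => /= x /elem_level xn.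
by apply/graph_in; split.
Qed.

Lemma internal_elem (x y : W) : internal y -> elem x y -> internal x.
Proof.
move=> [n yn] xy; exists n; move: y yn x xy.
apply: (@xtransfer [:: setof (level n)] (XAll 0 (XAll 0 (XElem 0 2)))) => /=.
move=> y /elem_level yn x xy; apply/elem_level.
exact: level_elem xy.
Qed.

Lemma internal_star (s : V) : internal (st s).
Proof.
have [n sn] := ss_exhaust s; exists n.
apply: (@xtransfer [:: s; setof (level n)] (XElem 0 1)) => /=.
exact/elem_level.
Qed.

Lemma opair_pairs (w w' : W) : internal w -> internal w' ->
  ae (opair w w') [set p | exists x y, p = opair x y].
Proof.
move=> [n wn] [m wm]; pose k := maxn n m; exists k.+2.
have {wn} wn : star_set (level k) w := star_set_level_ge wn (leq_maxl n m).
have {wm} wm : star_set (level k) w' := star_set_level_ge wm (leq_maxr n m).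
set S : set V := _ `&` _.
have Sk : S `<=` level k.+2 by move=> x [].
move: w wn w' wm.
apply: (@xtransfer [:: setof (level k); setof S] (XAll 0 (XAll 1 (XPairIn 1 0 3)))).
move=> /= x /elem_level xk.
move=> y /elem_level yk.
apply/(elem_setofE _ Sk); split; first by exists x, y.
exact: level_opair.
Qed.

Lemma internal_opair (w w' : W) : internal w -> internal w' -> internal (opair w w').
Proof. by move=> wi w'i; apply: ae_internal (opair_pairs wi w'i). Qed.

Definition pr1 (p : V) : V := the p [set x | exists y, p = opair x y].
Definition pr2 (p : V) : V := the p [set y | exists x, p = opair x y].

Lemma the_eq (T : Type) (x0 y : T) (P : set T) :
  P y -> (forall z, P z -> z = y) -> the x0 P = y.
Proof. by move=> Py U; apply/U; apply: (@xgetPex {classic T}); exists y. Qed.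

Lemma pr1E x y : pr1 (opair x y) = x.
Proof. by apply: the_eq => [|z [y' /opair_inj []]//]; exists y. Qed.

Lemma pr2E x y : pr2 (opair x y) = y.
Proof. by apply: the_eq => [|z [y' /opair_inj []]//]; exists x. Qed.

(** Replacing [w] by [opair w w'] adjoins one more internal object: whatever is a value at [w]
    remains a value at the pair through [pr1], and [w'] becomes the value of [pr2]. *)
Lemma lifts_pr (w w' : W) : internal w -> internal w' ->
  lifts pr1 (opair w w') w /\ lifts pr2 (opair w w') w'.
Proof.
move=> wi w'i; have pi := internal_opair wi w'i.
have pp := opair_pairs wi w'i.
have [n pn] := pi.
have ln : ae (opair w w') (level n) by exists n; apply: star_set_sub pn.
have [w1 v1] : exists w1, lifts pr1 (opair w w') w1.
  apply: (@lifts_ex _ _ n); apply: ae_sub (ae_and pp ln) => _ /= [[x [y ->]]].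
  by rewrite pr1E => /level_pair[].
have [w2 v2] : exists w2, lifts pr2 (opair w w') w2.
  apply: (@lifts_ex _ _ n); apply: ae_sub (ae_and pp ln) => _ /= [[x [y ->]]].
  by rewrite pr2E => /level_pair[].
have vi := lifts_id pi.
have : opair w1 w2 = opair w w'.
  apply/(lifts_eq (lifts_pair v1 v2) vi); apply: ae_sub pp => _ [x [y ->]] /=.
  by rewrite pr1E pr2E.
by move=> /opair_inj [e1 e2]; move: v1 v2; rewrite e1 e2.
Qed.

Lemma opair_internal (a b : W) : internal (opair a b) -> internal a /\ internal b.
Proof.
move=> qi; split; apply: (@internal_elem _ (setof [set a; b])).
- by apply: internal_elem qi _; apply/elem_opair; right.
- by apply/elem_set2; left.
- by apply: internal_elem qi _; apply/elem_opair; right.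
- by apply/elem_set2; right.
Qed.

Lemma lifts_unpair f w a b : lifts f w (opair a b) ->
  lifts (fun x => pr1 (f x)) w a /\ lifts (fun x => pr2 (f x)) w b.
Proof.
move=> vf; have [ai bi] := opair_internal (lifts_internal vf).2.
by have [v1 v2] := lifts_pr ai bi; split; apply: lifts_comp vf _.
Qed.

(** Finitely many internal objects are packed in one nested pair, so that a single ultrafilter
    governs all of them. *)
Lemma lifts_family (T : eqType) (l : seq T) (F : T -> W) :
  (forall t, t \in l -> internal (F t)) ->
  exists w (f : T -> V -> V), internal w /\ forall t, t \in l -> lifts (f t) w (F t).
Proof.
elim: l => [|t l IH] H.
  by exists (st (atom 0)), (fun=> id); split => //; exact: internal_star.
have [u ul|w [f [wi vf]]] := IH; first by apply: H; rewrite inE ul orbT.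
have ti : internal (F t) by apply: H; rewrite mem_head.
have [v1 v2] := lifts_pr ti wi.
exists (opair (F t) w), (fun u => if u == t then pr1 else fun x => f u (pr2 x)).
split; first exact: internal_opair.
move=> u; rewrite inE; case: eqP => [-> //|_ /= ul].
exact: lifts_comp v2 (vf u ul).
Qed.

End Transfer.

(** * Finite dimensional C*-algebras *)

Section CStarBasics.
Variables (R : realType) (A : cstarType R).
Implicit Types (x y : A) (z : R[i]).

Lemma conjcM z w : conjc (z * w) = conjc z * conjc w.
Proof. exact: rmorphM. Qed.

Lemma conjcN z : conjc (- z) = - conjc z.
Proof. exact: rmorphN. Qed.

Lemma conjcD z w : conjc (z + w) = conjc z + conjc w.
Proof. exact: rmorphD. Qed.

Lemma star_scale z x : adj (z *: x) = conjc z *: adj x.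
Proof. exact: Defs.adjZ. Qed.

Lemma star0 : adj (0 : A) = 0.
Proof. by rewrite -(scale0r (0 : A)) star_scale conjc0 !scale0r. Qed.

Lemma starN x : adj (- x) = - adj x.
Proof. by apply/eqP; rewrite -addr_eq0 -Defs.adjD addNr star0. Qed.

Lemma starB x y : adj (x - y) = adj x - adj y.
Proof. by rewrite Defs.adjD starN. Qed.

Lemma star1 : adj (1 : A) = 1.
Proof. by rewrite -[LHS]mulr1 -{2}(adjK 1) -Defs.adjM mulr1 adjK. Qed.

Lemma star_sum (I : Type) (s : seq I) (P : pred I) (F : I -> A) :
  adj (\sum_(i <- s | P i) F i) = \sum_(i <- s | P i) adj (F i).
Proof. exact: (big_morph _ Defs.adjD star0). Qed.

Lemma cnorm0 : cnorm (0 : A) = 0.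
Proof. by rewrite -(scale0r (0 : A)) cnormZ normr0 mul0r. Qed.

Lemma cnormZE z x : cnorm (z *: x) = complex.Re `|z| * cnorm x.
Proof. exact: cnormZ. Qed.

Lemma Re_norm_ge0 z : 0 <= complex.Re `|z|.
Proof. by rewrite normc_def /= sqrtr_ge0. Qed.

Lemma Re_normR (r : R) : complex.Re `|r%:C| = `|r|.
Proof. by rewrite normc_def /= expr0n addr0 sqrtr_sqr. Qed.

Lemma cnormN x : cnorm (- x) = cnorm x.
Proof. by rewrite -scaleN1r cnormZE normrN1 mul1r. Qed.

Lemma cnorm_ge0 x : 0 <= cnorm x.
Proof.
have := cnormD_le x (- x); rewrite addrN cnorm0 cnormN -mulr2n.
by rewrite pmulrn_lge0.
Qed.

Lemma cnormB_le x y : cnorm (x - y) <= cnorm x + cnorm y.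
Proof. by apply: le_trans (cnormD_le _ _) _; rewrite cnormN. Qed.

Lemma cnormBC x y : cnorm (x - y) = cnorm (y - x).
Proof. by rewrite -opprB cnormN. Qed.

Lemma cnorm_tri y x w : cnorm (x - w) <= cnorm (x - y) + cnorm (y - w).
Proof. by rewrite -(subrKA y); apply: cnormD_le. Qed.

Lemma cnorm_sum (I : Type) (s : seq I) (P : pred I) (F : I -> A) :
  cnorm (\sum_(i <- s | P i) F i) <= \sum_(i <- s | P i) cnorm (F i).
Proof.
elim/big_rec2: _ => [|i r x _ H]; first by rewrite cnorm0.
by apply: le_trans (cnormD_le _ _) _; rewrite lerD2l.
Qed.

Lemma cnorm_adj x : cnorm (adj x) = cnorm x.
Proof.
suff H y : cnorm y <= cnorm (adj y).
  by apply/eqP; rewrite eq_le (H x) andbT; have := H (adj x); rewrite adjK.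
have [/eqP->|y0] := boolP (cnorm y == 0); first exact: cnorm_ge0.
have yp : 0 < cnorm y by rewrite lt_def y0 cnorm_ge0.
rewrite -(ler_pM2r yp) -expr2 -cnorm_adjM; exact: cnormM_le.
Qed.

Lemma cnorm_gt0 x : x != 0 -> 0 < cnorm x.
Proof.
move=> x0; rewrite lt_def cnorm_ge0 andbT.
by apply: contra x0 => /eqP /cnorm_eq0 ->.
Qed.

Lemma star_mul_eq0 x : adj x * x = 0 -> x = 0.
Proof.
move=> H; apply: cnorm_eq0; apply/eqP.
by rewrite -sqrf_eq0 -cnorm_adjM H cnorm0.
Qed.

Lemma selfadj_sq_eq0 x : adj x = x -> x * x = 0 -> x = 0.
Proof. by move=> e H; apply: star_mul_eq0; rewrite e. Qed.

Definition is_proj (p : A) := p * p = p /\ adj p = p.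

Lemma is_proj1 : is_proj 1. Proof. by split; [rewrite mulr1|exact: star1]. Qed.

Lemma cnorm_proj p : is_proj p -> p != 0 -> cnorm p = 1.
Proof.
move=> [pp ap] p0; have n0 := cnorm_gt0 p0.
by apply: (mulfI (lt0r_neq0 n0)); rewrite mulr1 -expr2 -cnorm_adjM ap pp.
Qed.

Lemma cnorm_proj_le1 p : is_proj p -> cnorm p <= 1.
Proof.
by move=> pp; have [->|/(cnorm_proj pp)->//] := eqVneq p 0; rewrite cnorm0.
Qed.

Lemma cnorm1 : cnorm (1 : A) = 1.
Proof. by apply: cnorm_proj; [exact: is_proj1|exact: oner_neq0]. Qed.

Lemma is_projB p q : is_proj p -> is_proj q -> p * q = q -> q * p = q ->
  is_proj (p - q).
Proof.
move=> [pp ap] [qq aq] pq qp; split; last by rewrite starB ap aq.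
by rewrite mulrBl !mulrBr pp pq qp qq subrr subr0.
Qed.

Lemma proj_swapr p q : is_proj p -> is_proj q -> q * p = q -> p * q = q.
Proof. by move=> [_ ap] [_ aq] e; rewrite -{2}aq -{2}e Defs.adjM ap aq. Qed.

Lemma proj_orth_swap p q : is_proj p -> is_proj q -> p * q = 0 -> q * p = 0.
Proof. by move=> [_ ap] [_ aq] e; rewrite -aq -ap -Defs.adjM e star0. Qed.

(** The decomposition into real and imaginary part. The last clause says that both parts stay in
    every corner that contains [x]; [minimal_scalar] needs this to reduce to selfadjoint
    elements. *)
Lemma selfadj_decomp x : exists a b, [/\ adj a = a, adj b = b,
  x = a + (0 +i* 1) *: b & forall q, q * x = x -> x * q = x -> adj q = q ->
     [/\ q * a = a, a * q = a, q * b = b & b * q = b]].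
Proof.
pose h : R[i] := 2^-1; have h2 : h + h = 1.
  by rewrite /h -mulr2n -[LHS]mulr_natr mulVf // pnatr_eq0.
have hc : h^* = h by rewrite /h conjc_inv conjc_nat.
pose I : R[i] := 0 +i* 1; have ii : I * I = -1 by rewrite -expr2; exact: sqr_i.
have ic : conjc I = - I by apply/eqP; rewrite eq_complex /= oppr0 !eqxx.
exists (h *: (x + adj x)), ((- (I * h)) *: (x - adj x)); split.
- by rewrite star_scale Defs.adjD adjK hc addrC.
- rewrite star_scale starB adjK conjcN conjcM ic hc.
  by rewrite -[adj x - x]opprB scalerN -scaleNr; congr (_ *: _); rewrite mulNr opprK.
- rewrite scalerA mulrN mulrA ii mulN1r opprK -scalerDr addrACA subrr addr0.
  by rewrite -mulr2n -scaler_nat scalerA mulr_natr mulr2n h2 scale1r.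
move=> q qx xq aq.
have qax : q * adj x = adj x by rewrite -{1}aq -Defs.adjM xq.
have axq : adj x * q = adj x by rewrite -{1}aq -Defs.adjM qx.
by split; rewrite -?scalerAl -?scalerAr ?mulrDr ?mulrDl ?mulrBr ?mulrBl ?mulrN ?mulNr ?qx ?xq ?qax ?axq.
Qed.

End CStarBasics.

Section FiniteDim.
Variables (R : realType) (A : cstarType R) (d : nat).
Hypothesis dA : has_dim A d.
Implicit Types (x y p q e : A).

Lemma has_dim_dependent n (v : 'I_n -> A) : (d < n)%N ->
  exists c : 'I_n -> R[i], (exists i, c i != 0) /\ \sum_i c i *: v i = 0.
Proof.
move=> dn; have [b [g _ gK]] := dA.
pose M := \matrix_(i < n, j < d) g (v i) j.
have /rowV0Pn[u /sub_kermxP uM u0] : kermx M != 0.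
  rewrite -mxrank_eq0 mxrank_ker subn_eq0 -ltnNge.
  exact: leq_ltn_trans (rank_leq_col _) dn.
exists (fun i => u 0 i); split.
  apply: contrapT => /forallNP H; case/eqP: u0; apply/rowP => i.
  by rewrite mxE; apply/eqP; apply: contrapT => /negP/H.
transitivity (\sum_i \sum_j (u 0 i * g (v i) j) *: b j).
  apply: eq_bigr => i _; rewrite -{1}[v i]gK scaler_sumr.
  by apply: eq_bigr => j _; rewrite scalerA.
rewrite exchange_big /= big1 // => j _; rewrite -scaler_suml.
suff -> : \sum_i u 0 i * g (v i) j = 0 by rewrite scale0r.
move/rowP/(_ j): uM; rewrite !mxE => uM; rewrite -[RHS]uM.
by apply: eq_bigr => i _; rewrite mxE.
Qed.

Definition orth_family n (p : 'I_n -> A) :=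
  [/\ forall i, is_proj (p i), forall i, p i != 0,
     forall i j, i != j -> p i * p j = 0 & \sum_i p i = 1].

(** Nonzero orthogonal idempotents are linearly independent. *)
Lemma orth_bound n (p : 'I_n -> A) : (forall i, p i * p i = p i) ->
  (forall i, p i != 0) -> (forall i j, i != j -> p i * p j = 0) -> (n <= d)%N.
Proof.
move=> pp p0 po; rewrite leqNgt; apply/negP => /(has_dim_dependent p).
move=> [c [[i ci] /(congr1 (fun y => p i * y))]].
rewrite mulr0 mulr_sumr (bigD1 i) //= big1 ?addr0; last first.
  by move=> j ji; rewrite -scalerAr po 1?eq_sym // scaler0.
by rewrite -scalerAr pp => /eqP; rewrite scaler_eq0 (negPf ci) (negPf (p0 i)).
Qed.

(** A partition of 1 with the largest number of members works: splitting [p i] into [q] and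
    [p i - q] within [Q] would give a larger one. The property [Q] will be commutation with an
    element, centrality, or no condition. *)
Lemma max_family (Q : A -> Prop) : Q 1 ->
  exists n (p : 'I_n -> A), [/\ orth_family p, forall i, Q (p i) &
    forall i q, is_proj q -> q != 0 -> q * p i = q -> Q q -> Q (p i - q) ->
      q = p i].
Proof.
move=> Q1.
pose P n := `[< exists p : 'I_n -> A, orth_family p /\ forall i, Q (p i) >].
have exP : exists n, P n.
  exists 1%N; apply/asboolP; exists (fun=> 1); split => //; split.
  - by move=> _; exact: is_proj1.
  - by move=> _; exact: oner_neq0.
  - by move=> i j; rewrite !ord1.
  - by rewrite big_ord1.
have bP n : P n -> (n <= d)%N.
  move=> /asboolP[p [[pp p0 po _] _]]; apply: orth_bound p0 po => i.
  by have [] := pp i.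
case: (ex_maxnP exP bP) => n /asboolP[p [fp Qp]] nmax.
exists n, p; split => // i q pq q0 qpi Qq Qpq; apply: contrapT => qNp.
have [pp p0 po p1] := fp.
have piq : p i * q = q by apply: proj_swapr.
suff /nmax : P n.+1 by rewrite ltnn.
(* The family after the split: [p i] shrinks to [p i - q], and [q] is put in front. *)
pose p' j := if j == i then p i - q else p j.
have q_p' j : q * p' j = 0.
  rewrite /p'; case: eqVneq => [_|ji].
    by rewrite mulrBr qpi (proj1 pq) subrr.
  by rewrite -qpi -mulrA po 1?eq_sym // mulr0.
have pp' j : is_proj (p' j).
  by rewrite /p'; case: eqP => // _; apply: is_projB.
apply/asboolP; exists (fun j => if unlift ord0 j is Some k then p' k else q).
split; last first.
  by move=> j; case: unliftP => [k|] _ //; rewrite /p'; case: eqP.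
split.
- by move=> j; case: unliftP => [k|] _.
- move=> j; case: unliftP => [k|] _ //; rewrite /p'; case: (eqVneq k i) => // _.
  by rewrite subr_eq0; apply/eqP => /esym.
- move=> j1 j2; case: (unliftP ord0 j1) => [k1|] ->;
    case: (unliftP ord0 j2) => [k2|] -> //=.
  + rewrite (inj_eq (@lift_inj _ _)) /p'.
    case: (k1 =P i) => [->|/eqP k1i]; case: (k2 =P i) => [->|/eqP k2i] k12.
    * by rewrite eqxx in k12.
    * by rewrite mulrBl po 1?eq_sym // -qpi -mulrA po 1?eq_sym // mulr0 subr0.
    * by rewrite mulrBr po // -piq mulrA po // mul0r subr0.
    * exact: po.
  by move=> _; apply: proj_orth_swap.
- rewrite big_ord_recl unlift_none.
  under eq_bigr => j _ do rewrite liftK.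
  rewrite (bigD1 i) //= /p' eqxx.
  under eq_bigr => j /negPf ji do rewrite ji.
  by rewrite addrA subrKC -p1 [RHS](bigD1 i).
Qed.

End FiniteDim.

(** * Polynomials in an element and the spectral theorem *)

Section PolyEval.
Variables (R : realType) (A : cstarType R).
Implicit Types (x y p q e : A) (s : {poly R[i]}).

Lemma horner_alg_sum x s : horner_alg x s = \sum_(i < size s) s`_i *: x ^+ i.
Proof.
rewrite -{1}[s]coefK poly_def linear_sum; apply: eq_bigr => i _.
by rewrite linearZ /= mulr_algl rmorphXn /= horner_algX.
Qed.

Lemma horner_alg_comm x y s : y * x = x * y ->
  y * horner_alg x s = horner_alg x s * y.
Proof.
move=> yx; rewrite horner_alg_sum mulr_sumr mulr_suml; apply: eq_bigr => i _.
rewrite -scalerAr -scalerAl; congr (_ *: _).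
by apply: commrX.
Qed.

Lemma horner_alg_eigen x y (l : R[i]) s : x * y = l *: y ->
  horner_alg x s * y = s.[l] *: y.
Proof.
move=> xy; rewrite horner_alg_sum mulr_suml horner_coef scaler_suml.
apply: eq_bigr => i _; rewrite -scalerAl -scalerA; congr (_ *: _).
elim: (nat_of_ord i) => [|k IH]; first by rewrite !expr0 mul1r scale1r.
by rewrite exprSr -mulrA xy -scalerAr IH scalerA -exprS.
Qed.

End PolyEval.

Section Spectral.
Variables (R : realType) (A : cstarType R) (d : nat).
Hypothesis dA : has_dim A d.
Implicit Types (x y p q e : A).

Lemma annihilating_poly x e : exists s : {poly R[i]}, s != 0 /\ horner_alg x s * e = 0.
Proof.
have [c [[i ci] H]] := has_dim_dependent dA (fun i : 'I_d.+1 => x ^+ i * e) (ltnSn d).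
exists (\poly_(j < d.+1) c (inord j)); split.
  apply/eqP => /polyP/(_ i); rewrite coef_poly ltn_ord coef0 inord_val.
  by apply/eqP.
rewrite poly_def linear_sum mulr_suml -[RHS]H; apply: eq_bigr => j _.
by rewrite linearZ /= mulr_algl rmorphXn /= horner_algX inord_val -scalerAl.
Qed.

(** Let [s] be a polynomial of least degree with s(x) e = 0. It has a root [l], and for s = r (X -
    l) the element y = r(x) e is a nonzero eigenvector of [x]. Then z = adj y * y is a selfadjoint
    eigenvector whose square is a multiple of [z], and the normalized [z] is the projection. It
    commutes with whatever commutes with [x] and [e], being built from these two. *)
Lemma spectral_projection x e : adj x = x -> is_proj e -> e != 0 -> x * e = e * x ->
  exists p (l : R), [/\ is_proj p, p != 0, p * e = p, x * p = l%:C *: p &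
    forall y, y * x = x * y -> y * e = e * y -> y * p = p * y].
Proof.
move=> ax [ee ae] e0 xe.
pose P n := `[< exists s : {poly R[i]}, [/\ s != 0, size s = n & horner_alg x s * e = 0] >].
have exP : exists n, P n.
  have [s [s0 star_set]] := annihilating_poly x e.
  by exists (size s); apply/asboolP; exists s.
case: (ex_minnP exP) => n /asboolP[s [s0 sn star_set]] nmin.
have /closed_rootP[l /factor_theorem[r sr]] : size s != 1.
  apply/eqP => s1; have sC := size1_polyC (eq_leq s1).
  move: star_set; rewrite sC horner_algC -scalerAl mul1r => /eqP.
  by rewrite scaler_eq0 (negPf e0) orbF => /eqP c0; rewrite sC c0 eqxx in s0.
have r0 : r != 0 by apply: contra s0 => /eqP r0; rewrite sr r0 mul0r.
(* Nonzero by minimality of the degree, since [r] has smaller degree than [s]. *)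
have [y yE] : exists y, y = horner_alg x r * e by exists (horner_alg x r * e).
have y0 : y != 0.
  apply/eqP => y0; have /nmin : P (size r) by apply/asboolP; exists r; rewrite -yE.
  by rewrite -sn sr size_Mmonic ?monicXsubC // size_XsubC addn2 /= ltnn.
have xx : x * x = x * x by [].
have xy : x * y = l *: y.
  apply/eqP; rewrite -subr_eq0 -star_set yE sr mulrC rmorphM rmorphB /= horner_algX horner_algC.
  by rewrite -[_ * _ * e]mulrA mulrBl -scalerAl mul1r.
have comm_y v : v * x = x * v -> v * e = e * v -> v * y = y * v.
  move=> vx ve; rewrite yE mulrA (horner_alg_comm _ vx) -!mulrA; congr (_ * _).
  exact: ve.
have ye : y * e = y by rewrite yE -mulrA ee.
have ey : e * y = y by rewrite comm_y.
have [w wE] : exists w, w = adj y by exists (adj y).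
have xw : x * w = w * x.
  by rewrite wE -ax -!Defs.adjM comm_y.
have we : w * e = w by rewrite wE -ae -Defs.adjM ey.
have ew : e * w = w by rewrite wE -ae -Defs.adjM ye.
have wy : w * y = y * w by apply: comm_y; rewrite ?xw // we ew.
(* The square of [z] is |r(l)|^2 times [z]. The factor cannot vanish, because a selfadjoint element
   with square 0 is 0. *)
pose z := w * y.
have z0 : z != 0 by apply: contra y0 => /eqP; rewrite /z wE => /star_mul_eq0 ->.
have az : adj z = z by rewrite /z wE Defs.adjM adjK.
have xz : x * z = l *: z by rewrite /z wy mulrA xy -scalerAl.
have ez : e * z = z by rewrite mulrA ew.
have yz : y * z = r.[l] *: z by rewrite yE -mulrA ez (horner_alg_eigen _ xz).
have zz_y : z * y = y * z by rewrite /z mulrA -wy.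
have wz : w * z = (r.[l])^* *: z.
  by rewrite wE -{1}az -Defs.adjM zz_y yz star_scale az.
pose g := r.[l] * (r.[l])^*.
have zz : z * z = g *: z by rewrite {1}/z -mulrA yz -scalerAr wz scalerA.
have g0 : g != 0.
  apply: contra z0 => /eqP g0; apply/eqP/selfadj_sq_eq0 => //.
  by rewrite zz g0 scale0r.
have gr : conjc g = g by rewrite conjcM conjcK mulrC.
have xz2 : z * x = x * z by rewrite /z -mulrA -comm_y // !mulrA xw.
have ze : z * e = z by rewrite /z -mulrA ye.
(* The eigenvalue is real: the adjoint of [x * z] is [z * x], which equals [x * z]. *)
have lr : conjc l = l.
  have : conjc l *: z = l *: z by rewrite -xz -{1}az -star_scale -xz Defs.adjM az ax xz2.
  move=> /eqP; rewrite -subr_eq0 -scalerBl scaler_eq0 (negPf z0) orbF subr_eq0.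
  by move/eqP.
have lR : l = (complex.Re l)%:C.
  move: lr; case: l {xz xy yz wz g zz g0 gr sr comm_y} => a b /= [/eqP].
  by rewrite eq_sym -addr_eq0 -mulr2n mulrn_eq0 /= => /eqP ->.
exists (g^-1 *: z), (complex.Re l); split.
- split; last by rewrite star_scale conjc_inv gr az.
  by rewrite -scalerAl -scalerAr zz !scalerA -mulrA mulVf // mulr1.
- by rewrite scaler_eq0 invr_eq0 (negPf g0).
- by rewrite -scalerAl ze.
- by rewrite -lR -scalerAr xz !scalerA mulrC.
- move=> v vx ve; rewrite -scalerAr -scalerAl; congr (_ *: _).
  have vy := comm_y _ vx ve.
  have avx : adj v * x = x * adj v by rewrite -[in LHS]ax -[in RHS]ax -!Defs.adjM vx.
  have ave : adj v * e = e * adj v by rewrite -[in LHS]ae -[in RHS]ae -!Defs.adjM ve.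
  have vw : v * w = w * v by rewrite wE -[v]adjK -!Defs.adjM (comm_y _ avx ave).
  by rewrite /z mulrA vw -mulrA vy mulrA.
Qed.

Definition spectral_resolution n (l : 'I_n -> R) (p : 'I_n -> A) x :=
  orth_family p /\ x = \sum_i (l i)%:C *: p i.

(** Take a maximal partition of 1 into projections that commute with [x]. Below each member there is
    an eigenprojection of [x] that could be split off, so by maximality the member is that
    eigenprojection. *)
Lemma spectral_theorem x : adj x = x -> exists n (l : 'I_n -> R) (p : 'I_n -> A),
  spectral_resolution l p x.
Proof.
move=> ax; have [] := max_family dA (Q := fun p => p * x = x * p).
  by rewrite mul1r mulr1.
move=> n [p [fp px pmin]]; have [pp p0 po p1] := fp.
have H i : exists l : R, x * p i = l%:C *: p i.
  have [q [l [qq q0 qpi xq qc]]] := spectral_projection ax (pp i) (p0 i) (esym (px i)).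
  exists l; suff <- : q = p i by [].
  have qx := qc x erefl (esym (px i)).
  apply: pmin => //; by rewrite mulrBl mulrBr px qx.
have [l lP] := choice H.
exists n, l, p; split => //.
rewrite -[LHS]mulr1 -p1 mulr_sumr; apply: eq_bigr => i _; exact: lP.
Qed.

(* A projection with no proper subprojection is minimal in the sense that its corner is scalar. *)
Lemma minimal_scalar e : is_proj e -> e != 0 ->
  (forall q, is_proj q -> q != 0 -> q * e = q -> q = e) ->
  forall x, exists l : R[i], e * x * e = l *: e.
Proof.
move=> pe e0 emin.
have [ee ae] := pe.
have self x : adj x = x -> e * x = x -> x * e = x -> exists l : R[i], x = l *: e.
  move=> ax ex xe; have [p [l [pp p0 ppe xp _]]] :=
    spectral_projection ax pe e0 (etrans xe (esym ex)).
  by exists l%:C; rewrite -{1}xe -(emin p) // xp.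
move=> x; have [a [b [aa ab xab H]]] := selfadj_decomp (e * x * e).
have [||//|ea ae' eb be] := H e; try by rewrite ?mulrA ?ee -?mulrA ?ee.
have [l la] := self _ aa ea ae'.
have [m mb] := self _ ab eb be.
by exists (l + (0 +i* 1) * m); rewrite xab la mb scalerA scalerDl.
Qed.

End Spectral.

(** * Norms of combinations of orthogonal projections, and isometry of monomorphisms *)

Section NormOrth.
Variables (R : realType) (A : cstarType R) (n : nat) (p : 'I_n -> A).
Hypotheses (pp : forall i, is_proj (p i))
  (po : forall i j, i != j -> p i * p j = 0).
Implicit Types (l : 'I_n -> R).

Lemma orth_comb_mul l l' :
  (\sum_i (l i)%:C *: p i) * (\sum_i (l' i)%:C *: p i) =
  \sum_i (l i * l' i)%:C *: p i.
Proof.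
rewrite mulr_suml; apply: eq_bigr => i _; rewrite mulr_sumr (bigD1 i) //=.
rewrite big1 ?addr0 => [|j ji]; last first.
  by rewrite -scalerAl -scalerAr po 1?eq_sym // !scaler0.
by rewrite -scalerAl -scalerAr (proj1 (pp i)) scalerA -rmorphM.
Qed.

Lemma orth_comb_adj l :
  adj (\sum_i (l i)%:C *: p i) = \sum_i (l i)%:C *: p i.
Proof.
rewrite star_sum; apply: eq_bigr => i _.
by rewrite star_scale conjc_real (proj2 (pp i)).
Qed.

Lemma bernoulli_ineq (t : R) m : 0 <= t -> 1 + m%:R * t <= (1 + t) ^+ m.
Proof.
move=> t0; elim: m => [|m IH]; first by rewrite mul0r addr0 expr0.
rewrite exprS; apply: (@le_trans _ _ ((1 + t) * (1 + m%:R * t))); last first.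
  by rewrite ler_pM2l //; lra.
rewrite -natr1; have : 0 <= m%:R * (t * t) by rewrite !mulr_ge0.
nra.
Qed.

Lemma exp2_bounded_le1 (t c : R) : (forall k, t ^+ (2 ^ k) <= c) -> t <= 1.
Proof.
move=> H; rewrite leNgt; apply/negP => t1.
have s0 : 0 < t - 1 by rewrite subr_gt0.
pose k := Num.truncn (c / (t - 1)).
have : c < (2 ^ k.+1)%:R * (t - 1).
  rewrite -ltr_pdivrMr //; apply: lt_le_trans (truncnS_gt _) _.
  by rewrite ler_nat -/k; apply: ltnW; apply: ltn_expl.
have := H k.+1; have := bernoulli_ineq (2 ^ k.+1) (ltW s0).
rewrite [1 + (t - 1)]addrC subrK; lra.
Qed.

(** For coefficients of modulus at most 1, the C*-identity turns the 2^k-th power of the norm into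
    the norm of the combination with coefficients raised to the power 2^k. The triangle inequality
    bounds this by [n] for every [k], so the norm is at most 1. Scaling gives the general case. *)
Lemma cnorm_orth_le l M : 0 <= M -> (forall i, `|l i| <= M) ->
  cnorm (\sum_i (l i)%:C *: p i) <= M.
Proof.
have main l' : (forall i, `|l' i| <= 1) -> cnorm (\sum_i (l' i)%:C *: p i) <= 1.
  move=> H; apply: (@exp2_bounded_le1 _ n%:R) => k.
  elim: k l' H => [|k IH] l' H.
    rewrite expr1; apply: le_trans (cnorm_sum _ _ _) _.
    rewrite -[n in n%:R]card_ord -sum1_card natr_sum; apply: ler_sum => i _.
    rewrite cnormZE Re_normR -[1%:R]mulr1; apply: ler_pM => //.
      exact: cnorm_ge0.
    exact: cnorm_proj_le1.
  rewrite expnS exprM -cnorm_adjM orth_comb_adj orth_comb_mul; apply: IH => i.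
  by rewrite normrM mulr_ile1.
rewrite le_eqVlt => /orP[/eqP <-|M0] H.
  rewrite big1 ?cnorm0 // => i _; move: (H i); rewrite normr_le0 => /eqP ->.
  by rewrite scale0r.
have -> : \sum_i (l i)%:C *: p i = M%:C *: \sum_i (l i / M)%:C *: p i.
  rewrite scaler_sumr; apply: eq_bigr => i _; rewrite scalerA -rmorphM /=.
  by rewrite mulrC divfK // gt_eqF.
rewrite cnormZE Re_normR gtr0_norm // -[leRHS]mulr1 ler_pM2l //; apply: main => i.
by rewrite normrM normfV (gtr0_norm M0) ler_pdivrMr // mul1r.
Qed.

Lemma cnorm_orth_ge l i : p i != 0 -> `|l i| <= cnorm (\sum_i (l i)%:C *: p i).
Proof.
move=> p0; have : (\sum_i (l i)%:C *: p i) * p i = (l i)%:C *: p i.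
  rewrite mulr_suml (bigD1 i) //= big1 ?addr0 => [|j ji].
    by rewrite -scalerAl (proj1 (pp i)).
  by rewrite -scalerAl po // scaler0.
move=> /(congr1 (@cnorm R A)); rewrite cnormZE Re_normR (cnorm_proj (pp i) p0) mulr1 => <-.
by apply: le_trans (cnormM_le _ _) _; rewrite (cnorm_proj (pp i) p0) mulr1.
Qed.

End NormOrth.

Section Morphism.
Variables (R : realType) (A B : cstarType R) (f : A -> B).
Hypothesis fm : @star_morphism R (staralg_of A) (staralg_of B) f.

Lemma star_morphD x y : f (x + y) = f x + f y.
Proof. by apply: (star_morphismD fm); rewrite in_setT. Qed.
Lemma star_morphM x y : f (x * y) = f x * f y.
Proof. by apply: (star_morphismM fm); rewrite in_setT. Qed.
Lemma star_morphZ z x : f (z *: x) = z *: f x.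
Proof. by apply: (star_morphismZ fm); rewrite in_setT. Qed.
Lemma star_morph_adj x : f (adj x) = adj (f x).
Proof. by apply: (star_morphism_adj fm); rewrite in_setT. Qed.
Lemma star_morph1 : f 1 = 1.
Proof. exact: (star_morphism1 fm). Qed.
Lemma star_morph0 : f 0 = 0.
Proof. by rewrite -(scale0r (0 : A)) star_morphZ scale0r. Qed.
Lemma star_morphB x y : f (x - y) = f x - f y.
Proof. by rewrite -scaleN1r star_morphD star_morphZ scaleN1r. Qed.
Lemma star_morph_sum (I : Type) (s : seq I) (P : pred I) (F : I -> A) :
  f (\sum_(i <- s | P i) F i) = \sum_(i <- s | P i) f (F i).
Proof. exact: (big_morph _ star_morphD star_morph0). Qed.

End Morphism.

(** By the C*-identity it suffices to treat [adj x * x]. An injective morphism carries its spectral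
    resolution to a combination of nonzero orthogonal projections with the same coefficients, and on
    both sides the norm is the largest modulus of a coefficient. Only the source has to be finite
    dimensional, so the lemma also applies to the maps [phi k] into [L]. *)
Lemma star_monomorphism_isometry (R : realType) (A B : cstarType R) (f : A -> B) d :
  has_dim A d -> @star_monomorphism R (staralg_of A) (staralg_of B) f ->
  forall x, cnorm (f x) = cnorm x.
Proof.
move=> dA [fm finj] x; apply/eqP; rewrite -(eqrXn2 (n := 2)) ?cnorm_ge0 //.
rewrite -!cnorm_adjM -(star_morph_adj fm) -(star_morphM fm).
have ax : adj (adj x * x) = adj x * x by rewrite Defs.adjM adjK.
have [n [l [p [[pp p0 po p1] ->]]]] := spectral_theorem dA ax.
have fp i : is_proj (f (p i)).
  by have [h1 h2] := pp i; split; rewrite -?(star_morphM fm) -?(star_morph_adj fm) ?h1 ?h2.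
have f0 i : f (p i) != 0.
  apply: contra (p0 i) => /eqP; rewrite -(star_morph0 fm) => /finj -> //; exact: in_setT.
have fo i j : i != j -> f (p i) * f (p j) = 0.
  by move=> ij; rewrite -(star_morphM fm) po // (star_morph0 fm).
rewrite (star_morph_sum fm); under eq_bigr => i _ do rewrite (star_morphZ fm).
apply/eqP; apply: le_anti; apply/andP; split.
  apply: (cnorm_orth_le fp fo) => [|i]; first exact: cnorm_ge0.
  exact: (cnorm_orth_ge pp po l (p0 i)).
apply: (cnorm_orth_le pp po) => [|i]; first exact: cnorm_ge0.
exact: (cnorm_orth_ge fp fo l (f0 i)).
Qed.

Lemma orth_family_inj (R : realType) (A : cstarType R) n (e : 'I_n -> A) :
  orth_family e -> injective e.
Proof.
move=> [pe e0 eo _] i j eij; apply/eqP; apply: contrapT => /negP /eo.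
by rewrite eij (proj1 (pe j)); apply/eqP.
Qed.

(** * Minimal central projections and minimal projections *)

Section Central.
Variables (R : realType) (A : cstarType R) (d : nat).
Hypothesis dA : has_dim A d.
Implicit Types (x y p q e f : A).

(** A maximal partition of 1 into central projections has minimal members. Any minimal central [f]
    has a nonzero product with some [e i], and this product equals both by minimality. *)
Lemma central_decomposition : exists n (e : 'I_n -> A),
  [/\ orth_family e, forall i, minimal_central (e i) &
     forall f, minimal_central f -> exists i, f = e i].
Proof.
have [] := max_family dA (Q := fun p => forall x, p * x = x * p).
  by move=> x; rewrite mul1r mulr1.
move=> n [e [fe ce emin]]; have [pe e0 eo e1] := fe.
have cp f : central_projection f -> is_proj f by move=> [].
have mine i : minimal_central (e i).
  split => //; first by have [? ?] := pe i.
  move=> p /[dup] pc [pp ap cp'] p0 pei; apply: emin => // x.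
  by rewrite mulrBl mulrBr cp' ce.
exists n, e; split => // f [fc f0 fmin].
have [i fi] : exists i, f * e i != 0.
  apply: contrapT => /forallNP H; case/eqP: f0; rewrite -[f]mulr1 -e1 mulr_sumr.
  by rewrite big1 // => i _; apply/eqP; apply: contrapT => /negP/H.
exists i; have [ff af cf] := fc; have [ee ae] := pe i.
have cfe : central_projection (f * e i).
  split; first by rewrite mulrA -[f * _ * f]mulrA -(cf (e i)) mulrA ff -mulrA ee.
    by rewrite Defs.adjM af ae cf.
  by move=> x; rewrite -mulrA ce mulrA cf -mulrA.
have [_ _ H] := mine i.
rewrite -[LHS](fmin _ cfe fi); last by rewrite -mulrA ce mulrA ff.
by apply: H => //; rewrite -mulrA ee.
Qed.

(** The members of a maximal partition of 1 into projections are minimal. One of them has a nonzero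
    product with the central [f]; this product is a subprojection of it, hence all of it. *)
Lemma minimal_projection f : is_proj f -> f != 0 -> (forall x, f * x = x * f) ->
  exists e, [/\ is_proj e, e != 0, e * f = e &
    forall x, exists l : R[i], e * x * e = l *: e].
Proof.
move=> pf f0 cf; have [] := max_family dA (Q := fun=> True) I.
move=> n [e [fe _ emin]]; have [pe e0 eo e1] := fe.
have [i fi] : exists i, e i * f != 0.
  apply: contrapT => /forallNP H; case/eqP: f0; rewrite -[f]mul1r -e1 mulr_suml.
  by rewrite big1 // => i _; apply/eqP; apply: contrapT => /negP/H.
have [ee ae] := pe i; have [ff af] := pf.
exists (e i); split => //; last first.
  by apply: (minimal_scalar dA) => // q pq q0 qe; apply: emin.
apply: emin => //; last by rewrite -mulrA cf mulrA ee.
split; last by rewrite Defs.adjM ae af cf.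
by rewrite mulrA -[_ * _ * e i]mulrA cf mulrA ee -mulrA ff.
Qed.

End Central.

Section ComplexAux.
Variable R : realType.
Implicit Types z w : R[i].

Definition sqnorm z : R := complex.Re z ^+ 2 + complex.Im z ^+ 2.

Lemma sqnorm_ge0 z : 0 <= sqnorm z.
Proof. by rewrite addr_ge0 // sqr_ge0. Qed.

Lemma mul_conjc z : z * conjc z = (sqnorm z)%:C.
Proof.
case: z => a b; apply/eqP; rewrite eq_complex /sqnorm /=; apply/andP.
by split; apply/eqP; ring.
Qed.

Lemma real_of_conjc z : conjc z = z -> z = (complex.Re z)%:C.
Proof.
case: z => a b /= [/eqP].
by rewrite eq_sym -addr_eq0 -mulr2n mulrn_eq0 /= => /eqP ->.
Qed.

Lemma real_complexM (a b : R) : (a * b)%:C = a%:C * b%:C.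
Proof. exact: rmorphM. Qed.
Lemma real_complexB (a b : R) : (a - b)%:C = a%:C - b%:C.
Proof. exact: rmorphB. Qed.

End ComplexAux.

(** * The Hilbert space A e of a minimal projection, and Wedderburn's theorem *)

Section Column.
Variables (R : realType) (A : cstarType R) (d : nat).
Hypothesis dA : has_dim A d.
Variables (e : A).
Hypotheses (pe : is_proj e) (e0 : e != 0)
  (es : forall x, exists l : R[i], e * x * e = l *: e).
Implicit Types (u v x : A).

Lemma column_coef u v : u * e = u -> v * e = v ->
  exists l : R[i], adj u * v = l *: e.
Proof.
move=> ue ve; have [l H] := es (adj u * v); exists l.
by rewrite -H mulrA -{1}(proj2 pe) -Defs.adjM ue -mulrA ve.
Qed.

Lemma scale_e_inj (l m : R[i]) : l *: e = m *: e -> l = m.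
Proof.
move/eqP; rewrite -subr_eq0 -scalerBl scaler_eq0 (negPf e0) orbF subr_eq0.
by move/eqP.
Qed.

(* The Hermitian form (u, v) |-> adj u * v on the left ideal A e is anisotropic and takes the value 1
   at e, hence it is positive definite: a vector of negative square would give an isotropic one. *)
Lemma column_pos v : v * e = v ->
  exists2 c : R, 0 <= c & adj v * v = c%:C *: e.
Proof.
move=> ve; have [ee ae] := pe; have [l vl] := column_coef ve ve.
have lr : conjc l = l.
  apply: scale_e_inj; rewrite -vl -{1}ae -star_scale -vl.
  by rewrite Defs.adjM adjK.
pose c := complex.Re l; have lc : l = c%:C := real_of_conjc lr.
exists c; last by rewrite vl lc.
rewrite leNgt; apply/negP => c0.
have [mu evmu] := column_coef ee ve; rewrite ae in evmu.
(* The form takes the value |a + mu|^2 - |mu|^2 + c at [a *: e + v], which vanishes for a + mu = s.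
   Then v = - a e, and its square |a|^2 contradicts c < 0. *)
pose s := Num.sqrt (sqnorm mu - c).
have ss : s%:C * s%:C = mu * conjc mu - c%:C.
  rewrite mul_conjc -real_complexM -real_complexB -expr2 sqr_sqrtr //.
  by rewrite subr_ge0 (le_trans (ltW c0)) ?sqnorm_ge0.
pose a : R[i] := s%:C - mu.
have ac : conjc a = s%:C - conjc mu.
  by rewrite /a conjcD conjcN conjc_real.
have vae : adj v * e = conjc mu *: e.
  by rewrite -{1}ae -Defs.adjM evmu star_scale ae.
have y0 : a *: e + v = 0.
  apply: star_mul_eq0; rewrite Defs.adjD star_scale ae mulrDl !mulrDr.
  rewrite -!scalerAl -!scalerAr ee evmu vae vl lc !scalerA -!scalerDl.
  suff -> : conjc a * a + conjc a * mu + (a * conjc mu + c%:C) = 0.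
    by rewrite scale0r.
  have -> : c%:C = mu * conjc mu - s%:C * s%:C by rewrite ss; ring.
  by rewrite ac /a; ring.
have va : v = - a *: e by rewrite scaleNr; apply/eqP; rewrite -addr_eq0 addrC y0.
have : c%:C = (sqnorm a)%:C.
  apply: scale_e_inj; rewrite -lc -vl va star_scale ae -scalerAl -scalerAr ee scalerA.
  by rewrite conjcN mulrNN mulrC mul_conjc.
move=> /complexI ca; have := sqnorm_ge0 a; rewrite -ca; lra.
Qed.

Definition orthonormal n (u : 'I_n -> A) :=
  (forall i, u i * e = u i) /\ forall i j, adj (u i) * u j = (i == j)%:R *: e.

Lemma orthonormal_bound n (u : 'I_n -> A) : orthonormal u -> (n <= d)%N.
Proof.
move=> [ue uo]; rewrite leqNgt; apply/negP => /(has_dim_dependent dA u).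
move=> [c [[i ci] /(congr1 (fun y => adj (u i) * y))]].
rewrite mulr0 mulr_sumr (bigD1 i) //= big1 ?addr0 => [|j ji]; last first.
  by rewrite -scalerAr uo eq_sym (negPf ji) scale0r scaler0.
rewrite -scalerAr uo eqxx scale1r => /eqP.
by rewrite scaler_eq0 (negPf ci) (negPf e0).
Qed.

(** A largest orthonormal family spans: the component [w] of [v] orthogonal to it, if nonzero, could
    be normalized and added. *)
Lemma orthonormal_basis : exists n (u : 'I_n -> A),
  orthonormal u /\ forall v, v * e = v -> v = \sum_i u i * (adj (u i) * v).
Proof.
have [ee ae] := pe.
pose P n := `[< exists u : 'I_n -> A, orthonormal u >].
have exP : exists n, P n.
  exists 0%N; apply/asboolP; exists (fun=> 0); split; by case.
have bP n : P n -> (n <= d)%N by move=> /asboolP[u /orthonormal_bound].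
case: (ex_maxnP exP bP) => n /asboolP[u [ue uo]] nmax.
exists n, u; split => // v ve.
pose w := v - \sum_i u i * (adj (u i) * v).
have we : w * e = w.
  rewrite mulrBl ve mulr_suml; congr (_ - _); apply: eq_bigr => i _.
  by rewrite -!mulrA ve.
have uw i : adj (u i) * w = 0.
  rewrite mulrBr mulr_sumr (bigD1 i) //= big1 ?addr0 => [|j ji]; last first.
    by rewrite (mulrA (adj (u i)) (u j)) uo eq_sym (negPf ji) scale0r mul0r.
  by rewrite (mulrA (adj (u i)) (u i)) uo eqxx scale1r mulrA -{1}ae -Defs.adjM ue subrr.
have [c c0 wc] := column_pos we.
have [c00|cn0] := eqVneq c 0.
  have : w = 0 by apply: star_mul_eq0; rewrite wc c00 scale0r.
  by move/eqP; rewrite subr_eq0 => /eqP.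
suff /nmax : P n.+1 by rewrite ltnn.
have wu i : adj w * u i = 0 by rewrite -[LHS]adjK Defs.adjM adjK uw star0.
pose r := (Num.sqrt c)^-1.
have rr : r * r * c = 1.
  by rewrite -invfM -expr2 sqr_sqrtr // mulVf.
apply/asboolP; exists (fun j => if unlift ord0 j is Some k then u k else r%:C *: w).
split.
  by move=> j; case: unliftP => [k|] _ //; rewrite -scalerAl we.
move=> j1 j2; case: (unliftP ord0 j1) => [k1|] ->;
  case: (unliftP ord0 j2) => [k2|] ->.
- by rewrite uo (inj_eq (@lift_inj _ _)).
- by rewrite /= -scalerAr uw scaler0 scale0r.
- by rewrite /= star_scale -scalerAl wu scaler0 scale0r.
- by rewrite /= star_scale conjc_real -scalerAl -scalerAr wc !scalerA -!real_complexM rr.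
Qed.

End Column.

Section Wedderburn.
Variables (R : realType) (A : cstarType R) (d : nat).
Hypothesis dA : has_dim A d.

(** For a minimal projection [e] below [f] and an orthonormal basis [u] of A e, the sum [p] of the
    [u i * adj (u i)] is a nonzero central projection below [f], hence equal to [f]. The elements
    [u i * adj (u j)] are then matrix units of A f. *)
Lemma wedderburn (f : A) : minimal_central f -> exists m, has_block_dim f m.
Proof.
move=> [[ff af cf] f0 fmin].
have pf : is_proj f by [].
have [e [pe e0 ef es]] := minimal_projection dA pf f0 cf.
have [ee ae] := pe.
have [n [u [[ue uo] ub]]] := orthonormal_basis dA pe e0 es.
pose p := \sum_i u i * adj (u i).
have eu i : e * adj (u i) = adj (u i) by rewrite -{1}ae -Defs.adjM ue.
have ap : adj p = p.
  by rewrite star_sum; apply: eq_bigr => i _; rewrite Defs.adjM adjK.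
have pv v : v * e = v -> p * v = v.
  move=> /ub {2}->; rewrite mulr_suml; apply: eq_bigr => i _.
  by rewrite mulrA.
(* Left multiplication by [x] preserves A e, on which [p] acts as the identity. Taking adjoints
   gives that [p] is central. *)
have xp x : p * x * p = x * p.
  have xpE : x * p = \sum_i x * u i * adj (u i).
    by rewrite mulr_sumr; apply: eq_bigr => i _; rewrite mulrA.
  rewrite -mulrA xpE mulr_sumr; apply: eq_bigr => i _.
  by rewrite mulrA pv // -mulrA ue.
have px x : p * x = x * p.
  have := congr1 adj (xp (adj x)); rewrite !Defs.adjM ap adjK => <-.
  by rewrite mulrA xp.
have pp : p * p = p by have := xp 1; rewrite mulr1 mul1r.
have fe : e = f * e by rewrite cf.
have uf i : u i * f = u i by rewrite -{1}ue -mulrA ef ue.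
have auf i : adj (u i) * f = adj (u i) by rewrite -{1}af -Defs.adjM cf uf.
have pfE : p * f = p.
  rewrite mulr_suml; apply: eq_bigr => i _.
  by rewrite -mulrA auf.
have pE : p = f.
  apply: fmin => //; apply: contra e0 => /eqP p0.
  by rewrite -(pv e ee) p0 mul0r.
pose g (M : 'M[R[i]]_n) := \sum_i \sum_j M i j *: (u i * adj (u j)).
have ug j N : adj (u j) * g N = \sum_l N j l *: adj (u l).
  pose h k := \sum_l N k l *: (u k * adj (u l)).
  have uh k : adj (u j) * h k = (j == k)%:R *: \sum_l N k l *: adj (u l).
    rewrite mulr_sumr scaler_sumr; apply: eq_bigr => l _.
    by rewrite -scalerAr mulrA uo -scalerAl eu !scalerA mulrC.
  rewrite -[g N]/(\sum_k h k) mulr_sumr (bigD1 j) //= big1 ?addr0 => [|k kj].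
    by rewrite uh eqxx scale1r.
  by rewrite uh eq_sym (negPf kj) scale0r.
exists n, g; split; last first.
  split.
  - move=> M _; exists (g M) => //; rewrite mulr_suml; apply: eq_bigr => i _.
    rewrite mulr_suml; apply: eq_bigr => j _.
    by rewrite -scalerAl -mulrA auf.
  - move=> M N _ _ gMN; apply/matrixP => k l.
    apply: (scale_e_inj e0).
    have H M' : adj (u k) * g M' * u l = M' k l *: e.
      rewrite ug mulr_suml (bigD1 l) //= big1 ?addr0 => [|j jl].
        by rewrite -scalerAl uo eqxx scale1r.
      by rewrite -scalerAl uo (negPf jl) scale0r scaler0.
    by rewrite -!H gMN.
  - move=> _ [x _ <-].
    (* The matrix coefficients of x f = p x p in the basis [u]. *)
    have H i : exists c : 'I_n -> R[i], forall j, adj (u i) * (x * u j) = c j *: e.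
      have H j : exists l, adj (u i) * (x * u j) = l *: e.
        by apply: (column_coef pe es (ue i)); rewrite -mulrA ue.
      by have [c cP] := choice H; exists c.
    have [c cP] := choice H.
    exists (\matrix_(i, j) c i j) => //.
    rewrite -pE -xp {2}/p /p mulr_suml mulr_suml; apply: eq_bigr => i _.
    rewrite mulr_sumr; apply: eq_bigr => j _; rewrite mxE.
    by rewrite [RHS]mulrA -[_ * x * _]mulrA -[_ * (x * _)]mulrA cP -scalerAr ue -scalerAl.
split => /=.
- move=> M _; exists (g M) => //; rewrite mulr_suml; apply: eq_bigr => i _.
  rewrite mulr_suml; apply: eq_bigr => j _.
  by rewrite -scalerAl -mulrA auf.
- move=> M N _ _; rewrite /g -big_split; apply: eq_bigr => i _ /=.
  by rewrite -big_split; apply: eq_bigr => j _; rewrite mxE scalerDl.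
- move=> M N _ _; rewrite {2}/g mulr_suml; apply: eq_bigr => i _.
  rewrite mulr_suml.
  under [RHS]eq_bigr => j _ do rewrite -scalerAl -mulrA ug mulr_sumr scaler_sumr.
  rewrite exchange_big /=; apply: eq_bigr => l _.
  rewrite mxE scaler_suml; apply: eq_bigr => j _.
  by rewrite -scalerAr scalerA.
- move=> z M _; rewrite /g scaler_sumr; apply: eq_bigr => i _.
  by rewrite scaler_sumr; apply: eq_bigr => j _; rewrite mxE scalerA.
- move=> M _; rewrite /g star_sum exchange_big /=; apply: eq_bigr => i _.
  rewrite star_sum; apply: eq_bigr => j _.
  by rewrite !mxE star_scale Defs.adjM adjK.
- rewrite -pE /g; apply: eq_bigr => i _.
  rewrite (bigD1 i) //= big1 ?addr0 => [|j ji].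
    by rewrite mxE eqxx scale1r.
  by rewrite mxE eq_sym (negPf ji) scale0r.
Qed.

End Wedderburn.

(** * Ranks of idempotents and matrix blocks *)

Section IdempotentRank.
Variable F : numFieldType.

(** Cancelling in the full rank factorization P = C R shows that idempotence means R C = 1, and the
    trace of C R is that of R C. *)
Lemma mxtrace_idem n (P : 'M[F]_n) : P *m P = P -> \tr P = (\rank P)%:R.
Proof.
move=> PP; have rc : row_base P *m col_base P = 1%:M.
  have := PP; rewrite -{1 2 3}[P]mulmx_base => H.
  have H1 : col_base P *m (row_base P *m col_base P) = col_base P *m 1%:M.
    apply: (row_free_inj (row_base_free P)).
    by rewrite mulmx1 -[RHS]H !mulmxA.
  have cf : row_free (col_base P)^T by rewrite /row_free mxrank_tr; exact: col_base_full.
  apply: trmx_inj; apply: (row_free_inj cf).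
  by rewrite -!trmx_mul H1.
by rewrite -{1}[P]mulmx_base mxtrace_mulC rc mxtrace1.
Qed.

Lemma idem_rank_sum n (I : finType) (P : I -> 'M[F]_n) :
  (forall i, P i *m P i = P i) -> \sum_i P i = 1%:M ->
  (\sum_i \rank (P i))%N = n.
Proof.
move=> PP P1; apply/eqP; rewrite -(eqr_nat F) natr_sum -(mxtrace1 F n) -P1.
rewrite raddf_sum /=; apply/eqP; apply: eq_bigr => i _; rewrite mxtrace_idem //.
Qed.

End IdempotentRank.

Section Block.
Variables (R : realType) (A : cstarType R).
Local Notation C := R[i].

Definition conjT n (M : 'M[C]_n) := map_mx (fun z => conjc z) M^T.

(** [g] identifies the matrices with the block A f, and [r] compresses to the block and reads off
    the matrix. When [f] is central, [r] is a unital *-morphism on all of [A]; it serves to take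
    ranks in a block. *)
Record is_block (f : A) m (g : 'M[C]_m -> A) (r : A -> 'M[C]_m) : Prop := IsBlock {
  blockD : forall M N, g (M + N) = g M + g N;
  blockZ : forall z M, g (z *: M) = z *: g M;
  blockM : forall M N, g (M *m N) = g M * g N;
  blockA : forall M, g (conjT M) = adj (g M);
  block1 : g 1%:M = f;
  blockK : cancel g r;
  blockVK : forall x, g (r x) = x * f
}.

Lemma has_block_dimP f m : has_block_dim f m -> exists g r, @is_block f m g r.
Proof.
move=> [g [gm [_ ginj gsurj]]].
have H x : exists M, g M = x * f.
  have [|M _ <-] := gsurj (x * f); first by exists x.
  by exists M.
have [r rP] := choice H.
exists g, r; split => //.
- by move=> M N; apply: (star_morphismD gm); rewrite in_setT.
- by move=> z M; apply: (star_morphismZ gm); rewrite in_setT.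
- by move=> M N; apply: (star_morphismM gm); rewrite in_setT.
- by move=> M; apply: (star_morphism_adj gm); rewrite in_setT.
- exact: (star_morphism1 gm).
- move=> M; apply: ginj; rewrite ?in_setT // rP.
  by have [x _ <-] := star_morphism_fun gm I (x := M); rewrite -mulrA;
     have := star_morphismM gm (x := 1%:M) (y := 1%:M); rewrite !in_setT;
     move=> /(_ isT isT) /=; rewrite mulmx1 (star_morphism1 gm) /= => <-.
Qed.

Variables (f : A) (m : nat) (g : 'M[C]_m -> A) (r : A -> 'M[C]_m).
Hypotheses (cf : central_projection f) (b : is_block f g r).

Lemma block_inj M N : g M = g N -> M = N.
Proof. exact: can_inj (blockK b) M N. Qed.

Lemma block_f M : g M * f = g M.
Proof. by rewrite -(blockVK b) (blockK b). Qed.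

Lemma rblockD x y : r (x + y) = r x + r y.
Proof. by apply: block_inj; rewrite (blockD b) !(blockVK b) mulrDl. Qed.

Lemma rblockZ z x : r (z *: x) = z *: r x.
Proof. by apply: block_inj; rewrite (blockZ b) !(blockVK b) scalerAl. Qed.

Lemma rblockM x y : r (x * y) = r x *m r y.
Proof.
have [ff _ cc] := cf.
by apply: block_inj; rewrite (blockM b) !(blockVK b) -[RHS]mulrA (mulrA f) cc -(mulrA y) ff mulrA.
Qed.

Lemma rblockA x : r (adj x) = conjT (r x).
Proof.
have [_ af cc] := cf.
by apply: block_inj; rewrite (blockA b) !(blockVK b) Defs.adjM af cc.
Qed.

Lemma rblock1 : r 1 = 1%:M.
Proof. by apply: block_inj; rewrite (blockVK b) (block1 b) mul1r. Qed.

Lemma rblock0 : r 0 = 0.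
Proof. by rewrite -(scale0r (0 : A)) rblockZ scale0r. Qed.

Lemma block0 : g 0 = 0.
Proof. by rewrite -(scale0r (0 : 'M[C]_m)) (blockZ b) scale0r. Qed.

Lemma rblock_f : r f = 1%:M.
Proof. by rewrite -(block1 b) (blockK b). Qed.

Lemma rblock_sum (I : Type) (s : seq I) (P : pred I) (F : I -> A) :
  r (\sum_(i <- s | P i) F i) = \sum_(i <- s | P i) r (F i).
Proof. exact: (big_morph _ rblockD rblock0). Qed.

End Block.

Section BlockDim.
Variables (R : realType) (A : cstarType R).
Local Notation C := R[i].

(** The [m] diagonal matrix units of the first isomorphism, read as matrices of size m' through the
    second, are nonzero idempotents with sum 1: [m] ranks, each at least 1, add up to m'. *)
Lemma has_block_dim_le f m m' : @central_projection R A f ->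
  has_block_dim f m -> has_block_dim f m' -> (m <= m')%N.
Proof.
move=> cf /has_block_dimP[g [r b]] /has_block_dimP[g' [r' b']].
pose q (i : 'I_m) := r' (g (delta_mx i i)).
have qq i : q i *m q i = q i.
  by rewrite /q -(rblockM cf b') -(blockM b) mul_delta_mx.
have q1 : \sum_i q i = 1%:M.
  rewrite /q -(rblock_sum b') -(rblock_f b') -(block1 b); congr r'.
  rewrite -(big_morph _ (blockD b) (block0 b)); congr g.
  by rewrite -(mx1_sum_delta).
rewrite -[leqRHS](idem_rank_sum qq q1) -[leqLHS]card_ord -sum1_card.
apply: leq_sum => i _; rewrite lt0n mxrank_eq0; apply/eqP => q0.
have : delta_mx i i = 0 :> 'M[C]_m.
  by apply: (block_inj b); rewrite (block0 b) -(block_f b) -(blockVK b') [r' _]q0 (block0 b').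
by move=> /matrixP/(_ i i); rewrite !mxE !eqxx => /eqP; rewrite oner_eq0.
Qed.

End BlockDim.

Section BlockDims.
Variables (R : realType) (A : cstarType R) (d : nat).
Hypothesis dA : has_dim A d.
Local Notation C := R[i].

Lemma block_dimP (f : A) : minimal_central f -> has_block_dim f (block_dim f).
Proof. by move=> /(wedderburn dA) H; apply: (@xgetPex {classic nat}). Qed.

Lemma block_dimE (f : A) m : central_projection f -> has_block_dim f m -> block_dim f = m.
Proof.
move=> cf H; have H' : has_block_dim f (block_dim f).
  by apply: (@xgetPex {classic nat}); exists m.
by apply/eqP; rewrite eqn_leq !(has_block_dim_le cf).
Qed.

Lemma minimal_central_neq0 (f : A) : minimal_central f -> f != 0.
Proof. by case. Qed.

Lemma minimal_central_proj (f : A) : minimal_central f -> central_projection f.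
Proof. by case. Qed.

Lemma block_dim_gt0 (f : A) m : f != 0 -> has_block_dim f m -> (0 < m)%N.
Proof.
move=> f0 /has_block_dimP[g [r b]]; rewrite lt0n; apply: contra f0 => /eqP m0.
by subst m; rewrite -(block1 b) (flatmx0 1%:M) (block0 b).
Qed.

End BlockDims.

(** * Embeddings built from a matrix of multiplicities *)

Section BlockDiagonal.
Variables (C : comNzRingType) (k n : nat) (m : 'I_n -> nat) (Gam : 'I_n -> nat).
Hypothesis kE : k = (\sum_i Gam i * m i)%N.
(** [S] lists the copies of the summands, summand i being repeated Gam i times, and [T] the
    coordinates of all copies. By [kE], [T] enumerates the k coordinates of the large block. *)
Let S := {i : 'I_n & 'I_(Gam i)}.
Let T := {s : S & 'I_(m (tag s))}.

Lemma card_block_index : #|{: T}| = k.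
Proof.
rewrite card_tagged sumnE big_map big_enum /= kE.
under eq_bigr => s _ do rewrite card_ord.
under [RHS]eq_bigr => i _ do rewrite -[X in (X * _)%N]card_ord -sum_nat_const.
by rewrite sig_big_dep /=.
Qed.

Definition block_index (j : 'I_k) : T := enum_val (cast_ord (esym card_block_index) j).

Lemma block_index_inj : injective block_index.
Proof. by move=> i j /enum_val_inj /cast_ord_inj. Qed.

Lemma block_index_surj t : exists j, block_index j = t.
Proof.
exists (cast_ord card_block_index (enum_rank t)).
by rewrite /block_index cast_ordK enum_rankK.
Qed.

(** The inclusion of the coordinates of the copy [s]. Its entries are 0 and 1, so its transpose is
    also its adjoint. *)
Definition block_iso (s : S) : 'M[C]_(k, m (tag s)) :=
  \matrix_(j, a) (block_index j == Tagged (fun s => 'I_(m (tag s))) a)%:R.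

Lemma block_iso_same s : (block_iso s)^T *m block_iso s = 1%:M.
Proof.
apply/matrixP => a b; rewrite !mxE.
have [j ja] := block_index_surj (Tagged (fun s => 'I_(m (tag s))) a).
rewrite (bigD1 j) //= !mxE ja eqxx mul1r big1 ?addr0 => [|j' jj'].
  by rewrite eq_Tagged.
rewrite !mxE -ja (inj_eq block_index_inj) (negPf jj') mul0r //.
Qed.

Lemma block_iso_diff s s' : s != s' -> (block_iso s)^T *m block_iso s' = 0.
Proof.
move=> ss'; apply/matrixP => a b; rewrite !mxE big1 // => j _; rewrite !mxE.
case: eqP => [->|_]; last by rewrite mul0r.
case: eqP => [/(congr1 tag)/= e|_]; last by rewrite mulr0.
by rewrite e eqxx in ss'.
Qed.

Lemma block_iso_sum : \sum_s block_iso s *m (block_iso s)^T = 1%:M.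
Proof.
apply/matrixP => i j; rewrite summxE.
transitivity (\sum_(t : T) (block_index i == t)%:R * (block_index j == t)%:R : C).
  under eq_bigr => s _ do rewrite mxE.
  rewrite (sig_big_dep _ (fun s => xpredT)) /=; apply: eq_bigr => -[s a] _.
  by rewrite !mxE.
rewrite (bigD1 (block_index i)) //= big1 ?addr0 => [|t ti].
  by rewrite eqxx mul1r (inj_eq block_index_inj) eq_sym mxE.
by rewrite eq_sym (negPf ti) mul0r.
Qed.

Lemma block_iso_conj (f : {rmorphism C -> C}) s : map_mx f (block_iso s) = block_iso s.
Proof. by apply/matrixP => i j; rewrite !mxE rmorph_nat. Qed.

End BlockDiagonal.

Section Embedding.
Variables (R : realType) (A B : cstarType R).
Variables (n n' : nat) (e : 'I_n -> A) (e' : 'I_n' -> B).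
Hypotheses (fe : orth_family e) (ce : forall i, central_projection (e i)).
Hypotheses (fe' : orth_family e') (ce' : forall i, central_projection (e' i)).
Local Notation C := R[i].
Variables (m : 'I_n -> nat) (m' : 'I_n' -> nat).
Variables (Gam : 'I_n' -> 'I_n -> nat).
Hypotheses (be : forall i, has_block_dim (e i) (m i)).
Hypotheses (be' : forall i, has_block_dim (e' i) (m' i)).
Hypothesis mE : forall j, m' j = (\sum_i Gam j i * m i)%N.
Hypothesis Gpos : forall i, exists j, (0 < Gam j i)%N.

(** In the block [e' j] the image of [x] is the block diagonal matrix [D j x] with Gam j i copies of
    the i-th component of [x]. By [Gpos] each component occurs in some block, which gives
    injectivity. *)
Lemma embedding_of_multiplicities : exists psi : A -> B,
  @star_monomorphism R (staralg_of A) (staralg_of B) psi.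
Proof.
have H i : exists gr : ('M[C]_(m i) -> A) * (A -> 'M[C]_(m i)), is_block (e i) gr.1 gr.2.
  by have [g [r b]] := has_block_dimP (be i); exists (g, r).
have H' i : exists gr : ('M[C]_(m' i) -> B) * (B -> 'M[C]_(m' i)), is_block (e' i) gr.1 gr.2.
  by have [g [r b]] := has_block_dimP (be' i); exists (g, r).
pose gr i := projT1 (cid (H i)); pose b i : is_block (e i) (gr i).1 (gr i).2 := projT2 (cid (H i)).
pose gr' i := projT1 (cid (H' i)); pose b' i : is_block (e' i) (gr' i).1 (gr' i).2 := projT2 (cid (H' i)).
pose r i := (gr i).2; pose g' j := (gr' j).1.
have rD i x y : r i (x + y) = r i x + r i y := rblockD (b i) x y.
have rZ i z x : r i (z *: x) = z *: r i x := rblockZ (b i) z x.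
have rM i x y : r i (x * y) = r i x *m r i y := rblockM (ce i) (b i) x y.
have rA i x : r i (adj x) = conjT (r i x) := rblockA (ce i) (b i) x.
have r1 i : r i 1 = 1%:M := rblock1 (b i).
have gD j M N : g' j (M + N) = g' j M + g' j N := blockD (b' j) M N.
have gZ j z M : g' j (z *: M) = z *: g' j M := blockZ (b' j) z M.
have gM j M N : g' j (M *m N) = g' j M * g' j N := blockM (b' j) M N.
have gA j M : g' j (conjT M) = adj (g' j M) := blockA (b' j) M.
have g1 j : g' j 1%:M = e' j := block1 (b' j).
have gf j M : g' j M * e' j = g' j M := block_f (b' j) M.
pose V j := @block_iso C (m' j) n m (Gam j) (mE j).
pose D j x := \sum_s V j s *m r (tag s) x *m (V j s)^T.
have conjV j s : map_mx (fun z => conjc z) (V j s) = V j s := block_iso_conj (mE j) (@conjc R) s.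
have conjVT j s : map_mx (fun z => conjc z) (V j s)^T = (V j s)^T.
  by rewrite -map_trmx conjV.
(* Compression to one copy recovers the component of [x]; this is the source of injectivity at the
   end. *)
have VDV j s x : (V j s)^T *m D j x *m V j s = r (tag s) x.
  rewrite /D mulmx_sumr mulmx_suml (bigD1 s) //= big1 ?addr0 => [|s' ss'].
    rewrite !mulmxA block_iso_same mul1mx -mulmxA block_iso_same mulmx1 //.
  by rewrite !mulmxA block_iso_diff 1?eq_sym // !mul0mx.
have DD j x y : D j (x + y) = D j x + D j y.
  rewrite /D -big_split; apply: eq_bigr => s _ /=.
  by rewrite rD mulmxDr mulmxDl.
have DZ j z x : D j (z *: x) = z *: D j x.
  rewrite /D scaler_sumr; apply: eq_bigr => s _.
  by rewrite rZ -scalemxAr -scalemxAl.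
have DM j x y : D j (x * y) = D j x *m D j y.
  rewrite {2}/D mulmx_suml; apply: eq_bigr => s _.
  rewrite {1}/D mulmx_sumr (bigD1 s) //= big1 ?addr0 => [|s' ss'].
    rewrite rM !mulmxA; congr (_ *m _).
    by rewrite -[_ *m (V j s)^T *m V j s]mulmxA block_iso_same mulmx1.
  by rewrite !mulmxA -[_ *m (V j s)^T *m V j s']mulmxA block_iso_diff 1?eq_sym // mulmx0 !mul0mx.
have DA j x : D j (adj x) = conjT (D j x).
  rewrite /D /conjT raddf_sum raddf_sum /=; apply: eq_bigr => s _.
  by rewrite rA !trmx_mul trmxK !map_mxM /= conjV conjVT mulmxA.
have D1 j : D j 1 = 1%:M.
  rewrite /D -(block_iso_sum C (mE j)); apply: eq_bigr => s _.
  by rewrite r1 mulmx1.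
pose psi x := \sum_j g' j (D j x).
have e'o i j : i != j -> e' i * e' j = 0 by case: fe' => _ _ + _; apply.
have gg j l M N : j != l -> g' j M * g' l N = 0.
  move=> jl; rewrite -[g' j M]gf -[g' l N]gf -mulrA.
  have [_ _ ->] := ce' j.
  by rewrite -(mulrA (g' l N)) e'o 1?eq_sym // !mulr0.
exists psi; split.
  split => /=.
  - by [].
  - move=> x y _ _; rewrite /psi -big_split; apply: eq_bigr => j _ /=.
    by rewrite DD gD.
  - move=> x y _ _; rewrite {2}/psi mulr_suml; apply: eq_bigr => j _.
    rewrite /psi mulr_sumr (bigD1 j) //= big1 ?addr0 => [|l lj].
      by rewrite DM gM.
    by apply: gg; rewrite eq_sym.
  - move=> z x _; rewrite /psi scaler_sumr; apply: eq_bigr => j _.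
    by rewrite DZ gZ.
  - move=> x _; rewrite /psi star_sum; apply: eq_bigr => j _.
    by rewrite DA gA.
  - rewrite /psi; case: fe' => _ _ _ <-; apply: eq_bigr => j _.
    by rewrite D1 g1.
move=> x y _ _ pxy.
have Dxy j : D j x = D j y.
  have He z : psi z * e' j = g' j (D j z).
    rewrite /psi mulr_suml (bigD1 j) //= big1 ?addr0 => [|l lj].
      exact: gf.
    by rewrite -g1; apply: gg.
  by apply: (block_inj (b' j)); rewrite -[LHS]/(g' j _) -[RHS]/(g' j _) -!He pxy.
case: fe => _ _ _ e1.
rewrite -[x]mulr1 -[y]mulr1 -e1 !mulr_sumr; apply: eq_bigr => i _.
rewrite -!(blockVK (b i)); congr ((gr i).1 _).
have [j Gji] := Gpos i.
have := VDV j (Tagged (fun i => 'I_(Gam j i)) (Ordinal Gji)); rewrite /= => VDVi.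
by rewrite -/(r i) -!VDVi Dxy.
Qed.

End Embedding.

(** * Approximate matrix units *)

Section NormAux.
Variables (R : realType) (A : cstarType R).
Implicit Types x y : A.

Lemma cnormM_le_of x y a b : cnorm x <= a -> cnorm y <= b -> cnorm (x * y) <= a * b.
Proof.
move=> xa yb; apply: le_trans (cnormM_le _ _) _.
by apply: ler_pM => //; exact: cnorm_ge0.
Qed.

Lemma cnorm_mulproj_le x p a : is_proj p -> cnorm x <= a -> cnorm (x * p) <= a.
Proof.
by move=> /cnorm_proj_le1 p1 xa; rewrite -[a]mulr1; apply: cnormM_le_of.
Qed.

Lemma cnorm_projmul_le x p a : is_proj p -> cnorm x <= a -> cnorm (p * x) <= a.
Proof.
by move=> /cnorm_proj_le1 p1 xa; rewrite -[a]mul1r; apply: cnormM_le_of.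
Qed.

Lemma cnormZR (r : R) x : cnorm (r%:C *: x) = `|r| * cnorm x.
Proof. by rewrite cnormZE Re_normR. Qed.

Lemma cnorm_sum_le (I : finType) (P : pred I) (F : I -> A) c : 0 <= c ->
  (forall i, P i -> cnorm (F i) <= c) -> cnorm (\sum_(i | P i) F i) <= #|I|%:R * c.
Proof.
move=> c0 H; apply: le_trans (cnorm_sum _ _ _) _.
apply: le_trans (ler_sum _ H) _.
rewrite sumr_const -[leLHS]mulr_natl; apply: ler_wpM2r => //.
rewrite ler_nat; exact: max_card.
Qed.

End NormAux.

(** * Orthogonal projections close to almost orthogonal elements *)

Section OrthLift.
Variables (R : realType) (A : cstarType R) (d : nat).
Hypothesis dA : has_dim A d.
Variables (T : finType) (x : T -> A) (ep et M : R).
Let N : R := #|T|%:R.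
Hypotheses (ep0 : 0 <= ep) (et0 : 0 < et) (et2 : et <= 2^-1) (M0 : 0 <= M).
Hypotheses (xa : forall a, adj (x a) = x a)
  (xx : forall a b, cnorm (x b * x a - (a == b)%:R *: x b) <= ep)
  (x1 : cnorm (\sum_a x a - 1) <= ep) (xM : forall a, cnorm (x a) <= M)
  (small : N ^+ 3 * ep + et * ep < et).

Let nu (a : T) : R := (enum_rank a)%:R.

Lemma nu_ge0 a : 0 <= nu a. Proof. exact: ler0n. Qed.
Lemma nu_leN a : nu a <= N.
Proof. by rewrite ler_nat ltnW // ltn_ord. Qed.

Lemma nu_sep a b : a != b -> 1 <= `|nu a - nu b|.
Proof.
move=> ab; have : (enum_rank a : nat) != enum_rank b.
  by apply: contra ab => /eqP /val_inj /enum_rank_inj ->.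
rewrite neq_ltn => /orP[] h.
  by rewrite distrC ger0_norm ?subr_ge0 ?ler_nat ?(ltnW h) // -natrB ?(ltnW h) // ler1n subn_gt0.
by rewrite ger0_norm ?subr_ge0 ?ler_nat ?(ltnW h) // -natrB ?(ltnW h) // ler1n subn_gt0.
Qed.

(* The spectrum of X = sum_a nu(a) x_a concentrates near the distinct numbers nu(a), and the
   corresponding spectral projections are close to the x_a. *)
Lemma orthogonal_lift : exists P : T -> A,
  [/\ forall a, is_proj (P a), forall a b, a != b -> P a * P b = 0, \sum_a P a = 1 &
     forall a, cnorm (x a - P a) <= 2 * N * (M * et + N ^+ 2 * ep) + ep].
Proof.
pose X := \sum_a (nu a)%:C *: x a.
have aX : adj X = X.
  by rewrite star_sum; apply: eq_bigr => a _; rewrite star_scale conjc_real xa.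
have [n [l [p [[pp p0 po p1] Xl]]]] := spectral_theorem dA aX.
have Xp j : X * p j = (l j)%:C *: p j.
  rewrite Xl mulr_suml (bigD1 j) //= big1 ?addr0 => [|i ij].
    by rewrite -scalerAl (proj1 (pp j)).
  by rewrite -scalerAl po // scaler0.
pose r b := x b * X - (nu b)%:C *: x b.
have N0 : 0 <= N by exact: ler0n.
have rb b : cnorm (r b) <= N ^+ 2 * ep.
  have -> : r b = \sum_a (nu a)%:C *: (x b * x a - (a == b)%:R *: x b).
    under eq_bigr => a _ do rewrite scalerBr.
    rewrite sumrB; congr (_ - _).
      by rewrite mulr_sumr; apply: eq_bigr => a _; rewrite -scalerAr.
    rewrite (bigD1 b) //= big1 ?addr0 => [|a /negPf ->]; last by rewrite scale0r scaler0.
    by rewrite eqxx scale1r.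
  rewrite expr2 -mulrA; apply: cnorm_sum_le => [|a _]; first by rewrite mulr_ge0.
  rewrite cnormZR ger0_norm ?nu_ge0 //; apply: ler_pM => //.
  - exact: cnorm_ge0.
  - exact: nu_leN.
have N2 : 0 <= N ^+ 2 * ep by rewrite mulr_ge0 // exprn_ge0.
(* Otherwise [r b * p j] = (l_j - nu b) x_b p_j bounds every x_b p_j by N^2 ep / et in norm. As the
   x_b nearly sum to 1, the norm 1 of [p j] would be at most N^3 ep / et + ep, contrary to
   [small]. *)
have near j : exists a, `|l j - nu a| < et.
  apply: contrapT => /forallNP far.
  have xp b : et * cnorm (x b * p j) <= N ^+ 2 * ep.
    apply: le_trans (cnorm_mulproj_le (pp j) (rb b)).
    have -> : r b * p j = (l j - nu b)%:C *: (x b * p j).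
      by rewrite mulrBl -mulrA Xp -scalerAr -scalerAl -scalerBl -real_complexB.
    rewrite cnormZR; apply: ler_wpM2r; first exact: cnorm_ge0.
    rewrite leNgt; apply/negP; exact: far.
  have : p j = \sum_b x b * p j - (\sum_b x b - 1) * p j.
    by rewrite -mulr_suml -mulrBl opprB addrC subrK mul1r.
  move=> /(congr1 (@cnorm R A)); rewrite cnorm_proj //.
  have h1 := cnormB_le (\sum_b x b * p j) ((\sum_b x b - 1) * p j).
  have h2 := cnorm_mulproj_le (pp j) x1.
  have h3 : cnorm (\sum_b x b * p j) <= N * (et^-1 * (N ^+ 2 * ep)).
    apply: cnorm_sum_le => [|b _]; first by rewrite mulr_ge0 // invr_ge0 ltW.
    by rewrite ler_pdivlMl.
  move=> e1.
  have : et * 1 <= et * (N * (et^-1 * (N ^+ 2 * ep)) + ep).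
    by rewrite ler_pM2l // {1}e1; apply: le_trans h1 _; exact: lerD.
  have -> : et * (N * (et^-1 * (N ^+ 2 * ep)) + ep) = N ^+ 3 * ep + et * ep.
    by field; rewrite gt_eqF.
  by rewrite mulr1 leNgt small.
pose P a := \sum_(j | `|l j - nu a| < et) p j.
(* The numbers nu(a) are at least 1 apart and [et] is at most 1/2. *)
have uniq_near a b j : `|l j - nu a| < et -> `|l j - nu b| < et -> a = b.
  move=> ja jb; apply/eqP; apply: contrapT => /negP /nu_sep.
  have : nu a - nu b = (l j - nu b) - (l j - nu a) by ring.
  move=> ->; rewrite leNgt => /negP; apply.
  apply: le_lt_trans (ler_normB _ _) _.
  have := et2; lra.
have pP a j : p j * P a = if `|l j - nu a| < et then p j else 0.
  rewrite /P mulr_sumr; case: ifPn => H.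
    rewrite (bigD1 j) //= big1 ?addr0 => [|i /andP[_ ij]]; first by case: (pp j).
    by rewrite po // eq_sym.
  by rewrite big1 // => i Hi; rewrite po //; apply: contraNneq H => ->.
have PP a b : P a * P b = if a == b then P a else 0.
  rewrite {1}/P mulr_suml; under eq_bigr => j _ do rewrite pP.
  case: eqP => [->|ab]; first by rewrite -big_mkcondr /=; apply: eq_bigl => j; rewrite andbb.
  by rewrite big1 // => j Ha; case: ifP => // Hb; case: ab; exact: uniq_near Ha Hb.
have aP a : adj (P a) = P a.
  by rewrite star_sum; apply: eq_bigr => j _; case: (pp j).
have projP a : is_proj (P a) by split; rewrite // PP eqxx.
have P1 : \sum_a P a = 1.
  rewrite /P; under eq_bigr => a _ do rewrite big_mkcond.
  rewrite exchange_big /= -p1; apply: eq_bigr => j _.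
  have [a ja] := near j.
  rewrite (bigD1 a) //= ja big1 ?addr0 // => b ba.
  by case: ifP => // jb; case/eqP: ba; exact: uniq_near jb ja.
have XP a : cnorm (X * P a - (nu a)%:C *: P a) <= et.
  have -> : X * P a - (nu a)%:C *: P a =
     \sum_j (if `|l j - nu a| < et then l j - nu a else 0)%:C *: p j.
    rewrite /P mulr_sumr scaler_sumr -sumrB big_mkcond /=; apply: eq_bigr => j _.
    case: ifP => _; last by rewrite scale0r.
    by rewrite Xp -scalerBl -real_complexB.
  apply: cnorm_orth_le => // [|j]; first exact: ltW.
  by case: ifP => [/ltW//|_]; rewrite normr0 ltW.
(* Evaluate x_b X P_a in two ways: X is nearly nu(a) on P_a, and x_b X is nearly nu(b) x_b. The
   difference nu(b) - nu(a) has modulus at least 1. *)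
have xbP a b : a != b -> cnorm (x b * P a) <= M * et + N ^+ 2 * ep.
  move=> ab; apply: (@le_trans _ _ (`|nu b - nu a| * cnorm (x b * P a))).
    by rewrite ler_peMl ?cnorm_ge0 // nu_sep // eq_sym.
  have -> : `|nu b - nu a| * cnorm (x b * P a) =
     cnorm (x b * (X * P a - (nu a)%:C *: P a) - r b * P a).
    rewrite -cnormZR; congr cnorm; rewrite mulrBr mulrBl mulrA real_complexB scalerBl.
    by rewrite -scalerAr -scalerAl opprB [RHS]addrC addrA subrK.
  apply: le_trans (cnormB_le _ _) _; apply: lerD; first exact: cnormM_le_of.
  exact: cnorm_mulproj_le.
exists P; split => // [a b ab|a]; first by rewrite PP (negPf ab).
pose th := M * et + N ^+ 2 * ep.
have th0 : 0 <= th by rewrite addr_ge0 // mulr_ge0 // ltW.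
(* Expand x_a by the partition of unity P_b, and P_a by the approximate one x_b. The common term x_a
   P_a cancels, and what remains are products with distinct indices and the error of the sum. *)
have -> : x a - P a = \sum_(b | b != a) x a * P b +
   ((\sum_b x b - 1) * P a - \sum_(b | b != a) x b * P a).
  set S1 := \sum_(b | b != a) x a * P b; set S2 := \sum_(b | b != a) x b * P a.
  have xaE : x a = x a * P a + S1.
    by rewrite -{1}[x a]mulr1 -P1 mulr_sumr (bigD1 a).
  have SE : (\sum_b x b) * P a = x a * P a + S2.
    by rewrite mulr_suml (bigD1 a).
  rewrite mulrBl mul1r SE {1}xaE.
  by rewrite [in RHS]addrAC addrK [S1 + _]addrCA addrA.
have h1 : cnorm (\sum_(b | b != a) x a * P b) <= N * th.
  by apply: cnorm_sum_le => // b ba; apply: xbP.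
have h2 : cnorm (\sum_(b | b != a) x b * P a) <= N * th.
  by apply: cnorm_sum_le => // b ba; apply: xbP; rewrite eq_sym.
have h3 := cnorm_mulproj_le (projP a) x1.
apply: le_trans (cnormD_le _ _) _.
have := cnormB_le ((\sum_b x b - 1) * P a) (\sum_(b | b != a) x b * P a).
rewrite -/th; lra.
Qed.

End OrthLift.

(** * Comparison of the ranks of projections in a block *)

Section RankComparison.
Variables (R : realType) (A : cstarType R).
Local Notation C := R[i].
Variables (f : A) (m : nat) (g : 'M[C]_m -> A) (r : A -> 'M[C]_m).
Hypotheses (cf : central_projection f) (b : is_block f g r).

(** An [x] with (1 - D) x = 0 satisfies x = D x, which forces x = 0. Applied to the image of the
    cokernel matrix, this gives full rank. *)
Lemma block_unit_near1 (D : A) : cnorm D < 1 -> row_free (r (1 - D)).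
Proof.
move=> D1; set K := r (1 - D).
suff : cokermx K = 0.
  move/eqP; rewrite -mxrank_eq0 mxrank_coker subn_eq0 => h.
  by rewrite /row_free eqn_leq rank_leq_row h.
pose x := g (cokermx K).
have : (1 - D) * x = 0.
  have xf : f * x = x by have [_ _ ->] := cf; exact: (block_f b).
  by rewrite -xf mulrA -(blockVK b) -(blockM b) mulmx_coker (block0 b).
rewrite mulrBl mul1r => /eqP; rewrite subr_eq0 => /eqP xD.
have x0 : x = 0.
  apply: cnorm_eq0; apply/eqP; apply: contraT => xn0.
  have xp : 0 < cnorm x by rewrite lt_def xn0 cnorm_ge0.
  have := cnormM_le D x; rewrite -xD -[X in X <= _]mul1r ler_pM2r //.
  by rewrite leNgt D1.
by apply: (block_inj b); rewrite (block0 b).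
Qed.

(* With z = Q y P, the element P - adj z * z is small, so 1 - (P - adj z * z) is invertible and
   P (1 - (P - adj z * z)) = adj z * z has the rank of P and factors through Q. *)
Lemma rank_le_of_near P Q y : is_proj P -> is_proj Q ->
  cnorm (P - P * (adj y * Q * y) * P) < 1 -> (\rank (r P) <= \rank (r Q))%N.
Proof.
move=> [PP aP] [QQ aQ]; set w := P * _ * P => H.
have /mxrankMfree E := block_unit_near1 H.
rewrite -(E _ (r P)) -(rblockM cf b).
have -> : P * (1 - (P - w)) = adj (y * P) * (Q * (y * P)).
  rewrite mulrBr mulr1 mulrBr PP opprB addrC subrK.
  by rewrite /w !mulrA PP Defs.adjM aP.
rewrite (rblockM cf b) (rblockM cf b Q).
exact: leq_trans (mxrankM_maxr _ _) (mxrankM_maxl _ _).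
Qed.

End RankComparison.

Section ApproximateMatrixUnits.
Variables (R : realType) (n : nat) (m : 'I_n -> nat).
Hypothesis mpos : forall i, (0 < m i)%N.

(** The lower bound [rho] excludes families that vanish on some of the summands, which would produce
    zero columns of multiplicities. *)
Definition approx_matrix_units (A : cstarType R)
    (E : forall i, 'I_(m i) -> 'I_(m i) -> A) (ep M rho : R) :=
  [/\ forall i a b, cnorm (adj (E i a b) - E i b a) <= ep,
      forall i a b c, cnorm (E i a b * E i b c - E i a c) <= ep,
      forall s t : {i : 'I_n & 'I_(m i)}, s != t ->
        cnorm (E (tag s) (tagged s) (tagged s) * E (tag t) (tagged t) (tagged t)) <= ep,
      cnorm (\sum_(s : {i : 'I_n & 'I_(m i)}) E (tag s) (tagged s) (tagged s) - 1) <= ep &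
      (forall i a b, cnorm (E i a b) <= M) /\ forall i a, rho <= cnorm (E i a a)].

(** The point is the order of quantifiers: [ep] is fixed before the algebra and its dimension [d],
    so that it serves almost all standard algebras behind B at once. The multiplicity of summand i
    in a block is the rank there of the projection near a diagonal unit. *)
Lemma approx_matrix_units_multiplicities (M rho : R) : 1 <= M -> 0 < rho ->
  exists2 ep : R, 0 < ep & forall (A : cstarType R) d (E : forall i, 'I_(m i) -> 'I_(m i) -> A),
    has_dim A d -> approx_matrix_units E ep M rho ->
    exists Gam : A -> 'I_n -> nat,
     (forall f, minimal_central f -> block_dim f = (\sum_i Gam f i * m i)%N) /\
     (forall i, exists2 f, minimal_central f & (0 < Gam f i)%N).
Proof.
move=> M1 rho0.
pose T : finType := {i : 'I_n & 'I_(m i)}.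
(* The extra 1 accounts for the error in the sum relation and keeps [K] at least 1. *)
pose K : R := #|T|%:R + 1.
have K1 : 1 <= K by rewrite lerDr ler0n.
have NK : #|T|%:R <= K by rewrite lerDl.
have M0 : 0 < M by apply: lt_le_trans M1.
have K0 : 0 < K by apply: lt_le_trans K1.
(* The admissible distance from diagonal units to projections: the first bound keeps the error in
   [near] below 1, the second makes the projections nonzero. *)
pose del := Num.min ((8 * M ^+ 2)^-1) (rho / 2).
have del0 : 0 < del by rewrite lt_min invr_gt0 divr_gt0 ?mulr_gt0 ?exprn_gt0.
have delM : 8 * M ^+ 2 * del <= 1.
  rewrite -ler_pdivlMl ?mulr_gt0 ?exprn_gt0 // mulr1.
  by rewrite ge_min lexx.
have delr : del <= rho / 2 by rewrite ge_min lexx orbT.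
have MM : 1 <= M ^+ 2 by rewrite exprn_ege1.
have del8 : 8 * del <= 1.
  apply: le_trans delM; rewrite ler_wpM2r ?(ltW del0) //; lra.
(* The width of the spectral windows in [orthogonal_lift], whose error term 2 N M et is then at most
   del / 4. *)
pose et := del / (8 * K * M).
have et0 : 0 < et by rewrite divr_gt0 // !mulr_gt0.
have KM : 1 <= K * M by rewrite mulr_ege1.
have etE : 8 * (K * M) * et = del by rewrite /et; field; rewrite !gt_eqF.
have et8 : 8 * et <= del.
  rewrite -etE ler_wpM2r ?(ltW et0) //; lra.
(* Symmetrizing the units enlarges the error [ep] to at most [ep'], and [c] is chosen such that 16
   K^3 ep' = et; this yields the smallness required by [orthogonal_lift]. *)
pose c := 16 * K ^+ 3 * (4 * M + K).
have K3 : 1 <= K ^+ 3 by rewrite exprn_ege1.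
have c0 : 0 < c by rewrite !mulr_gt0 ?exprn_gt0 // addr_gt0 // mulr_gt0.
pose ep := et / c.
have ep0 : 0 < ep by rewrite divr_gt0.
pose ep' := (4 * M + K) * ep.
have ep'E : 16 * (K ^+ 3 * ep') = et.
  rewrite /ep' /ep /c; field; rewrite !gt_eqF // addr_gt0 // mulr_gt0 //.
have ep'0 : 0 < ep' by rewrite mulr_gt0 // addr_gt0 // mulr_gt0.
have epep' : ep <= ep' by rewrite ler_peMl ?(ltW ep0) //; lra.
have ep'K : ep' <= K ^+ 3 * ep' by rewrite ler_peMl ?(ltW ep'0).
exists ep => // A d E dA [Ea Em Eo E1 [EM Er]].
pose be (t : T) := E (tag t) (tagged t) (tagged t).
pose h : R := 2^-1.
have hh : h + h = 1 by rewrite /h; lra.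
have h0 : 0 <= h by rewrite /h; lra.
(* The lifting lemma asks for selfadjoint elements, so the diagonal units are replaced by their real
   parts. *)
pose x t := h%:C *: (be t + adj (be t)).
have xa t : adj (x t) = x t.
  by rewrite star_scale conjc_real Defs.adjD adjK addrC.
have xbe t : cnorm (x t - be t) <= ep.
  have -> : x t - be t = h%:C *: (adj (be t) - be t).
    have e : be t = h%:C *: be t + h%:C *: be t.
      by rewrite -scalerDl -rmorphD /= hh scale1r.
    by apply/eqP; rewrite subr_eq {3}e /x scalerDr scalerBr addrA subrK addrC.
  have := Ea _ (tagged t) (tagged t); rewrite -/(be t) => e1.
  have := cnorm_ge0 (adj (be t) - be t).
  rewrite cnormZR ger0_norm // /h; lra.
have xM t : cnorm (x t) <= M.
  rewrite cnormZR ger0_norm //.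
  have := cnormD_le (be t) (adj (be t)); rewrite cnorm_adj.
  have := EM _ (tagged t) (tagged t); rewrite -/(be t) => H1 H2.
  rewrite /h; lra.
have xx a b : cnorm (x b * x a - (a == b)%:R *: x b) <= ep'.
  have h1 : cnorm (x b * x a - be b * be a) <= 2 * M * ep.
    have -> : x b * x a - be b * be a = (x b - be b) * x a + be b * (x a - be a).
      by rewrite mulrBl mulrBr addrA subrK.
    apply: le_trans (cnormD_le _ _) _.
    have e1 := cnormM_le_of (xbe b) (xM a).
    have e2 := cnormM_le_of (EM _ (tagged b) (tagged b)) (xbe a).
    rewrite -/(be b) in e2; lra.
  have h2 : cnorm (be b * be a - (a == b)%:R *: x b) <= 2 * ep.
    case: eqP => [->|/eqP ab].
      rewrite scale1r; apply: le_trans (cnorm_tri (be b) _ _) _.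
      have e1 := Em _ (tagged b) (tagged b) (tagged b).
      have e2 := xbe b; rewrite cnormBC in e2; rewrite -/(be b) in e1; lra.
    rewrite scale0r subr0; have := Eo b a; rewrite eq_sym => /(_ ab).
    rewrite -/(be a) -/(be b); lra.
  apply: le_trans (cnorm_tri (be b * be a) _ _) _.
  have : (2 * M + 2) * ep <= ep' by apply: ler_wpM2r; [exact: ltW|lra].
  lra.
have x1 : cnorm (\sum_a x a - 1) <= ep'.
  apply: le_trans (cnorm_tri (\sum_a be a) _ _) _; rewrite -sumrB.
  have e1 := cnorm_sum_le (P := xpredT) (ltW ep0) (fun t _ => xbe t).
  have : K * ep <= ep' by apply: ler_wpM2r; [exact: ltW|lra].
  rewrite /K mulrDl mul1r; rewrite -/T in E1; move: E1; rewrite -/be; lra.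
have N3 : #|T|%:R ^+ 3 * ep' <= K ^+ 3 * ep'.
  apply: ler_wpM2r; first exact: ltW.
  by rewrite lerXn2r ?nnegrE ?ler0n ?(ltW K0).
have et2 : et <= 2^-1 by lra.
have small : #|T|%:R ^+ 3 * ep' + et * ep' < et.
  have : et * ep' <= 2^-1 * ep' by apply: ler_wpM2r => //; exact: ltW.
  lra.
have [P [pP oP P1 xP]] :=
  orthogonal_lift dA (ltW ep'0) et0 et2 (ltW M0) xa xx x1 xM small.
have bP t : cnorm (be t - P t) <= del.
  apply: le_trans (cnorm_tri (x t) _ _) _.
  have e1 := xbe t; rewrite cnormBC in e1; have e2 := xP t.
  have e3 : 2 * #|T|%:R * (M * et + #|T|%:R ^+ 2 * ep') <= 2 * (K * M * et) + 2 * (K ^+ 3 * ep').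
    have -> : 2 * #|T|%:R * (M * et + #|T|%:R ^+ 2 * ep') = 2 * (#|T|%:R * (M * et)) + 2 * (#|T|%:R ^+ 3 * ep') by ring.
    have : #|T|%:R * (M * et) <= K * (M * et) by rewrite ler_wpM2r // mulr_ge0 // ltW.
    lra.
  lra.
have P0 t : P t != 0.
  apply/eqP => Pt; have := bP t; rewrite Pt subr0.
  have := Er _ (tagged t); rewrite -/(be t); lra.
(* The chain is P_a ~ E_aa ~ E_ab E_ba ~ E_ab E_bb E_ba ~ adj(E_ba) E_bb E_ba ~ adj(E_ba) P_b E_ba,
   with errors del, ep, ep M, ep M^2 and M^2 del. By the choice of [del] they add up to less than
   1. *)
have near i a b : cnorm (P (Tagged (fun i => 'I_(m i)) a) -
   P (Tagged (fun i => 'I_(m i)) a) * (adj (E i b a) * P (Tagged (fun i => 'I_(m i)) b) * E i b a) *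
   P (Tagged (fun i => 'I_(m i)) a)) < 1.
  set Pa := P (Tagged _ a); set Pb := P (Tagged _ b); set Z := adj _ * _ * _.
  have pPa : is_proj Pa by exact: pP.
  have [PPa _] := pPa.
  have -> : Pa - Pa * Z * Pa = Pa * (Pa - Z) * Pa by rewrite mulrBr mulrBl PPa PPa.
  apply: (@le_lt_trans _ _ (cnorm (Pa - Z))).
    exact: (cnorm_mulproj_le pPa (cnorm_projmul_le pPa (lexx _))).
  have e0 := bP (Tagged (fun i => 'I_(m i)) a); rewrite /be /= -/Pa cnormBC in e0.
  have e0' := bP (Tagged (fun i => 'I_(m i)) b); rewrite /be /= -/Pb in e0'.
  have e1 := Em i a b a; rewrite cnormBC in e1.
  have e2 : cnorm (E i a b * E i b a - E i a b * E i b b * E i b a) <= ep * M.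
    by rewrite -mulrBl; apply: cnormM_le_of => //; rewrite cnormBC.
  have e3 : cnorm (E i a b * E i b b * E i b a - adj (E i b a) * E i b b * E i b a) <= ep * M * M.
    rewrite -!mulrBl; apply: cnormM_le_of => //; apply: cnormM_le_of => //.
    by rewrite cnormBC.
  have e4 : cnorm (adj (E i b a) * E i b b * E i b a - Z) <= M * del * M.
    rewrite /Z -mulrBl -mulrBr; apply: cnormM_le_of => //; apply: cnormM_le_of => //.
    by rewrite cnorm_adj.
  apply: le_lt_trans (cnorm_tri (E i a a) _ _) _.
  have t1 := cnorm_tri (E i a b * E i b a) (E i a a) Z.
  have t2 := cnorm_tri (E i a b * E i b b * E i b a) (E i a b * E i b a) Z.
  have t3 := cnorm_tri (adj (E i b a) * E i b b * E i b a) (E i a b * E i b b * E i b a) Z.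
  have epd : 8 * ep <= del by lra.
  have MleM2 : M <= M ^+ 2 by rewrite expr2 ler_peMl // ltW.
  have q1 : M * del * M = M ^+ 2 * del by ring.
  have q2 : 8 * (ep * M * M) <= M ^+ 2 * del.
    have -> : 8 * (ep * M * M) = M ^+ 2 * (8 * ep) by ring.
    by rewrite ler_wpM2l // exprn_ge0 // ltW.
  have q3 : 8 * (ep * M) <= M ^+ 2 * del.
    have -> : 8 * (ep * M) = M * (8 * ep) by ring.
    by apply: ler_pM => //; rewrite ltW // mulr_gt0.
  have q4 : del <= M ^+ 2 * del by rewrite ler_peMl // ltW.
  lra.
pose a0 i : T := Tagged (fun i => 'I_(m i)) (Ordinal (mpos i)).
(* The ranks depend only on the summand by [near] in both directions, and the ranks of all P_t in a
   block sum to its size. The second clause keeps what is needed for the positivity of columns. *)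
have H f : exists ga : 'I_n -> nat, minimal_central f ->
    block_dim f = (\sum_i ga i * m i)%N /\ forall i, ga i = 0%N -> P (a0 i) * f = 0.
  have [mf|nf] := pselect (minimal_central f); last by exists (fun=> 0%N).
  have cf := minimal_central_proj mf.
  have [g [r b]] := has_block_dimP (block_dimP dA mf).
  exists (fun i => \rank (r (P (a0 i)))) => _; split; last first.
    by move=> i /eqP; rewrite mxrank_eq0 => /eqP r0; rewrite -(blockVK b) r0 (block0 b).
  have rk i (a : 'I_(m i)) : \rank (r (P (Tagged (fun i => 'I_(m i)) a))) = \rank (r (P (a0 i))).
    apply/eqP; rewrite eqn_leq; apply/andP.
    split; first exact: (rank_le_of_near cf b (pP _) (pP _) (near i a (Ordinal (mpos i)))).
    exact: (rank_le_of_near cf b (pP _) (pP _) (near i (Ordinal (mpos i)) a)).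
  have PP t : r (P t) *m r (P t) = r (P t).
    by rewrite -(rblockM cf b) (proj1 (pP t)).
  have S1 : \sum_t r (P t) = 1%:M by rewrite -(rblock_sum b) P1 (rblock1 b).
  rewrite -{1}(idem_rank_sum PP S1).
  under [RHS]eq_bigr => i _ do rewrite mulnC -[X in (X * _)%N]card_ord -sum_nat_const.
  by rewrite sig_big_dep /=; apply: eq_bigr => -[i a] _; rewrite rk.
have [Gam GamP] := choice H.
exists Gam; split=> [f /GamP[]//|i].
have [q [e [[_ _ _ e1] ce _]]] := central_decomposition dA.
(* If summand i had multiplicity 0 in every block, its projection would vanish in every block, hence
   altogether. *)
apply: contrapT => no; have := P0 (a0 i); rewrite -[P _]mulr1 -e1 mulr_sumr big1 ?eqxx // => j _.
have [_ Hj] := GamP _ (ce j); apply: Hj; apply/eqP; rewrite -leqn0 leqNgt.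
by apply/negP => G0; apply: no; exists (e j).
Qed.

End ApproximateMatrixUnits.

(** * Internal C*-algebras *)

Section Codes.
Variables (R : realType) (V : superstructure R) (n : nat).

Lemma level_triple (x y z : V) k : level k x -> level k y -> level k z ->
  level (k + 4) (triple x y z).
Proof.
move=> xk yk zk; rewrite addnC; apply: level_opair; last exact: level_opair.
by apply: level_mono xk; rewrite -addn2 leq_addr.
Qed.

Lemma triple_inj (G : Type) (U : superstructure G) (x y z x' y' z' : U) :
  triple x y z = triple x' y' z' -> [/\ x = x', y = y' & z = z'].
Proof. by move=> /opair_inj[-> /opair_inj[-> ->]]. Qed.

Lemma level_atom k (r : R) : level k (atom r : V).
Proof. by apply: (@level_mono _ _ 0); last by exists r. Qed.

Variables (A : cstarType R) (c : A -> V).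
Hypothesis cc : coding n c.

Let cl x : level n (c x) := cc.2 x.
Let cl' k x : level (n + k) (c x).
Proof. by apply: level_mono (cl x); exact: leq_addr. Qed.

Lemma code_dom y : elem y (c_dom (code c)) <-> exists x, y = c x.
Proof.
rewrite (@elem_setofE _ _ n) => [|_ [x _ <-]]; last exact: cl.
by split=> [[x _ <-]|[x ->]]; exists x.
Qed.

Lemma code_add_bdd : range (fun x : A * A => triple (c x.1) (c x.2) (c (x.1 + x.2)))
  `<=` level (n + 8).
Proof.
by move=> _ [x _ <-]; rewrite (addnA n 4 4); apply: level_triple.
Qed.

Lemma code_mul_bdd : range (fun x : A * A => triple (c x.1) (c x.2) (c (x.1 * x.2)))
  `<=` level (n + 8).
Proof.
by move=> _ [x _ <-]; rewrite (addnA n 4 4); apply: level_triple.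
Qed.

Lemma code_scale_bdd : range (fun x : R[i] * A =>
    triple (opair (atom (complex.Re x.1)) (atom (complex.Im x.1)))
      (c x.2) (c (x.1 *: x.2))) `<=` level (n + 8).
Proof.
move=> _ [x _ <-]; rewrite (addnA n 4 4); apply: level_triple => //.
by apply: (@level_mono _ _ 2); [rewrite addnC|apply: level_opair; exact: level_atom].
Qed.

Lemma code_adj_bdd : range (fun x : A => opair (c x) (c (adj x))) `<=` level (n + 8).
Proof.
move=> _ [x _ <-]; apply: (@level_mono _ _ n.+2); last exact: level_opair.
by rewrite -addn2 leq_add2l.
Qed.

Lemma code_norm_bdd : range (fun x : A => opair (c x) (atom (cnorm x))) `<=` level (n + 8).
Proof.
move=> _ [x _ <-]; apply: (@level_mono _ _ n.+2); last by apply: level_opair => //; exact: level_atom.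
by rewrite -addn2 leq_add2l.
Qed.

Lemma code_add x y z : elem (triple (c x) (c y) z) (c_add (code c)) <-> z = c (x + y).
Proof.
rewrite (elem_setofE _ code_add_bdd); split=> [[p _]|->]; last by exists (x, y).
by move=> /triple_inj[/cc.1 <- /cc.1 <- <-].
Qed.

Lemma code_mul x y z : elem (triple (c x) (c y) z) (c_mul (code c)) <-> z = c (x * y).
Proof.
rewrite (elem_setofE _ code_mul_bdd); split=> [[p _]|->]; last by exists (x, y).
by move=> /triple_inj[/cc.1 <- /cc.1 <- <-].
Qed.

Lemma code_scale a b x z :
  elem (triple (opair (atom a) (atom b)) (c x) z) (c_scale (code c)) <->
  z = c ((a +i* b)%C *: x).
Proof.
rewrite (elem_setofE _ code_scale_bdd); split=> [[[[a' b'] y] _]|->]; last first.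
  by exists ((a +i* b)%C, x).
move=> /triple_inj[/= h ex ez]; have [h1 h2] := opair_inj h.
by have := atom_inj h1; have := atom_inj h2; have := cc.1 _ _ ex; move=> ? ? ?; subst.
Qed.

Lemma code_adj x z : elem (opair (c x) z) (c_adj (code c)) <-> z = c (adj x).
Proof.
rewrite (elem_setofE _ code_adj_bdd); split=> [[p _]|->]; last by exists x.
by move=> /opair_inj[/cc.1 <- <-].
Qed.

Lemma code_norm x z : elem (opair (c x) z) (c_norm (code c)) <-> z = atom (cnorm x).
Proof.
rewrite (elem_setofE _ code_norm_bdd); split=> [[p _]|->]; last by exists x.
by move=> /opair_inj[/cc.1 <- <-].
Qed.

(** The graphs have elements in level n + 8, hence lie in level n + 9, and each of the six nested
    pairs adds 2. *)
Lemma level_code : level (n + 21) (tuple_of_code (code c)).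
Proof.
have h (S : set V) : S `<=` level (n + 8) -> level (n + 9) (setof S).
  by move=> H; rewrite addnS; apply: level_setof.
have h' k (S : set V) : S `<=` level (n + 8) -> (8 < k)%N -> level (n + k) (setof S).
  by move=> /h H k8; apply: level_mono H; rewrite leq_add2l.
have lop k x y : level (n + k) x -> level (n + k) y -> level (n + k.+2) (opair x y : V).
  by move=> xk yk; rewrite !addnS; apply: level_opair.
have cd : range c `<=` level (n + 8) by move=> _ [x _ <-]; exact: cl'.
apply: (lop 19); first exact: h'.
apply: (lop 17); first exact: (h' _ _ code_add_bdd).
apply: (lop 15); first exact: (h' _ _ code_mul_bdd).
apply: (lop 13); first exact: (h' _ _ code_scale_bdd).
apply: (lop 11); first exact: (h' _ _ code_adj_bdd).
by apply: (lop 9); [exact: cl'|exact: (h' _ _ code_norm_bdd)].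
Qed.

End Codes.

Section CodeIso.
Variables (R : realType) (V : superstructure R) (n : nat).
Variables (A A' : cstarType R) (c : A -> V) (c' : A' -> V).
Hypotheses (cc : coding n c) (cc' : coding n c').
Hypothesis e : tuple_of_code (code c) = tuple_of_code (code c').

(** A code determines its algebra only up to isomorphism, since different Rocq types may be copied
    onto the same set. Statements about codes must therefore be invariant under isomorphism. *)
Lemma code_iso : exists i : A -> A', [/\ bijective i,
   forall x, c' (i x) = c x & @star_morphism R (staralg_of A) (staralg_of A') i].
Proof.
move: e => /opair_inj[ed /opair_inj[ea /opair_inj[em /opair_inj[es
  /opair_inj[ej /opair_inj[e1 en]]]]]].
have H x : exists y, c' y = c x.
  have /(code_dom cc')[y ->] : elem (c x) (c_dom (code c')).
    by rewrite -ed; apply/(code_dom cc); exists x.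
  by exists y.
have H' y : exists x, c x = c' y.
  have /(code_dom cc)[x ->] : elem (c' y) (c_dom (code c)).
    by rewrite ed; apply/(code_dom cc'); exists y.
  by exists x.
have [i ci] := choice H; have [j cj] := choice H'.
exists i; split => //.
  by exists j => x; [apply: cc.1; rewrite cj ci|apply: cc'.1; rewrite ci cj].
split => /=.
- by [].
- move=> x y _ _; apply: cc'.1; rewrite ci.
  by apply/(code_add cc'); rewrite -ea !ci; apply/(code_add cc).
- move=> x y _ _; apply: cc'.1; rewrite ci.
  by apply/(code_mul cc'); rewrite -em !ci; apply/(code_mul cc).
- move=> [a b] x _; apply: cc'.1; rewrite ci.
  by apply/(code_scale cc'); rewrite -es !ci; apply/(code_scale cc).
- move=> x _; apply: cc'.1; rewrite ci.
  by apply/(code_adj cc'); rewrite -ej !ci; apply/(code_adj cc).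
- by apply: cc'.1; rewrite ci.
Qed.

End CodeIso.

(** * Hyperreals as values of real functions *)

Section Hyperreal.
Variables (R : realType) (E : nonstandard_extension R).
Local Notation V := (stdV E).
Local Notation W := (hypV E).
Local Notation st := (@star R E).
Implicit Types (w : W) (r s : V -> R) (f g h : V -> V).

Lemma star_set_ae n (S : set V) w : S `<=` level n -> star_set S w <-> ae w S.
Proof.
move=> Sn; split=> [H|[m]].
  by exists n; apply: (@star_set_sub _ _ n) H => [x []//|x Sx]; split => //; exact: Sn.
by apply: (@star_set_sub _ _ n) => // x [].
Qed.

Lemma star_set_lifts n (S : set V) f w w' : S `<=` level n -> lifts f w w' ->
  elem w' (st (setof S)) <-> ae w [set x | S (f x)].
Proof. by move=> Sn vf; rewrite -(lifts_ae _ vf); exact: (star_set_ae _ Sn). Qed.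

Definition lifts_real r w (u : hreal E) := lifts (fun x => atom (r x)) w (atom u).

(** The value lies in the extension of the set of reals, which consists of atoms by [star_reals]. *)
Lemma lifts_real_ex r w : internal w -> exists u, lifts_real r w u.
Proof.
move=> wi; have [|w' v] := @lifts_ex _ E (fun x => atom (r x)) w 0.
  by apply: ae_all => // x /=; exists (r x).
suff [u _ e] : range (atom (s := W)) w' by exists u; rewrite /lifts_real e.
apply/(@elem_setofE _ _ 0); first by [].
rewrite -star_reals; apply/(star_set_lifts (n := 0) _ v) => //.
by apply: ae_all => // x /=; exists (r x).
Qed.

Lemma lifts_real_std c w : internal w -> lifts_real (fun=> c) w (std c).
Proof. by move=> wi; rewrite /lifts_real -star_atom; exact: lifts_const. Qed.

Lemma lifts_real_eq r s w u u' : lifts_real r w u -> lifts_real s w u' -> u = u' <-> ae w [set x | r x = s x].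
Proof.
move=> hu hu'; split=> [e|H].
  have := (lifts_eq hu hu').1; rewrite e => /(_ erefl).
  by apply: ae_sub => x /= e'; exact: atom_inj e'.
apply: (@atom_inj _ W); apply/(lifts_eq hu hu'); apply: ae_sub H => x /= -> //.
Qed.

Lemma lifts_real_ext r s w u : lifts_real r w u -> ae w [set x | r x = s x] -> lifts_real s w u.
Proof. by move=> hu H; apply: lifts_ext hu _; apply: ae_sub H => x /= ->. Qed.

Lemma lifts_real_rel (P : R -> R -> Prop) r s w u u' : lifts_real r w u -> lifts_real s w u' ->
  hrel P u u' <-> ae w [set x | P (r x) (s x)].
Proof.
move=> hu hu'; rewrite /hrel (star_set_lifts (n := 2) _ (lifts_pair hu hu')); last first.
  by move=> _ [x _ <-]; apply: level_opair; exact: level_atom.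
split; apply: ae_sub => x /=.
  move=> [y Py] /opair_inj[e1 e2].
  by rewrite -(atom_inj e1) -(atom_inj e2).
by move=> H; exists (r x, s x).
Qed.

Lemma lifts_triple f g h w a b c : lifts f w a -> lifts g w b -> lifts h w c ->
  lifts (fun x => triple (f x) (g x) (h x)) w (triple a b c).
Proof. by move=> va vb vc; apply: lifts_pair va (lifts_pair vb vc). Qed.

Lemma lifts_pr1' f w w' z : lifts f w w' -> internal z ->
  lifts (fun x => f (pr1 x)) (opair w z) w'.
Proof.
move=> vf zi; have [wi _] := lifts_internal vf.
by have [v1 _] := lifts_pr wi zi; apply: lifts_comp v1 vf.
Qed.

Lemma lifts_pr2' w z : internal w -> internal z -> lifts (@pr2 _ E) (opair w z) z.
Proof. by move=> wi zi; have [_ v2] := lifts_pr wi zi. Qed.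

Lemma ae_pr1 w z P : internal w -> internal z -> ae w P ->
  ae (opair w z) [set x | P (pr1 x)].
Proof. by move=> wi zi H; have [v1 _] := lifts_pr wi zi; apply/(lifts_ae _ v1). Qed.

(* The values z with kW(z) in SB are exactly those that are represented by u, provided that this
   holds almost everywhere at the standard level. *)
Lemma lifts_unique (kV : V -> V -> V) (kW : W -> W) (s u : V -> V) w SB y :
  lifts s w SB -> lifts u w y -> (forall z, internal (kW z) -> internal z) ->
  (forall z, internal z -> lifts (fun x => kV (pr1 x) (pr2 x)) (opair w z) (kW z)) ->
  ae w [set x | forall z, elem (kV x z) (s x) <-> z = u x] ->
  forall z, elem (kW z) SB <-> z = y.
Proof.
move=> vs vu ki kv H z.
have [wi SBi] := lifts_internal vs; have [_ yi] := lifts_internal vu.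
have main : internal z -> elem (kW z) SB <-> z = y.
  move=> zi; have vs' := lifts_pr1' vs zi; have vu' := lifts_pr1' vu zi.
  have H' := ae_pr1 wi zi H.
  rewrite (lifts_elem (kv z zi) vs') (lifts_eq (lifts_pr2' wi zi) vu').
  by split=> h; apply: ae_sub (ae_and h H') => x /= [h1 h2]; apply/h2.
split=> [h|e]; last by apply/main => //; rewrite e.
by apply/main => //; apply: ki; apply: internal_elem SBi h.
Qed.

Lemma hop_hr (f : R -> R -> R) r s w u u' : lifts_real r w u -> lifts_real s w u' ->
  lifts_real (fun x => f (r x) (s x)) w (hop f u u').
Proof.
move=> hu hu'; have [wi _] := lifts_internal hu.
have [t ht] := lifts_real_ex (fun x => f (r x) (s x)) wi.
suff -> : hop f u u' = t by [].
pose S : set V := range (fun x : R * R => triple (atom x.1) (atom x.2) (atom (f x.1 x.2))).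
have Sb : S `<=` level 4 by move=> _ [x _ <-]; apply: (level_triple (k := 0)); exact: level_atom.
have vS : lifts (fun=> setof S) w (st (setof S)) by exact: lifts_const.
have U : forall z, elem (triple (atom u) (atom u') z) (st (setof S)) <-> z = atom t.
  apply: (lifts_unique (kV := fun x z => triple (atom (r x)) (atom (s x)) z) vS ht).
  - by move=> z /opair_internal[_ /opair_internal[]].
  - move=> z zi; apply: lifts_triple; [exact: (lifts_pr1' hu)|exact: (lifts_pr1' hu')|exact: lifts_pr2'].
  - apply: ae_all => // x z; rewrite (elem_setofE _ Sb); split=> [[[a b] _]|->].
      move=> /triple_inj[e1 e2 e3].
      by rewrite -e3 -(atom_inj e1) -(atom_inj e2).
    by exists (r x, s x).
apply: the_eq => [|z]; first exact/U.
by move=> /U e; exact: atom_inj e.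
Qed.

End Hyperreal.

(** * Elements of B as families of elements of standard algebras *)

Section Rep.
Variables (R : realType) (E : nonstandard_extension R) (B : internal_cstar E).
Variable dflt : cstarType R.
Local Notation V := (stdV E).
Local Notation W := (hypV E).
Local Notation st := (@star R E).
Implicit Types (w : W).
Let n := ic_rank B.

Definition is_code (t : V) := exists (A : cstarType R) (c : A -> V),
  coding n c /\ t = tuple_of_code (code c).

Lemma is_code_bdd : [set t | is_code t] `<=` level (n + 21).
Proof. by move=> _ [A [c [cc ->]]]; exact: level_code. Qed.

Lemma code_rep_ex t : exists p : {A : cstarType R & A -> V}, is_code t ->
  coding n (projT2 p) /\ t = tuple_of_code (code (projT2 p)).
Proof.
have [[A [c H]]|nt] := pselect (is_code t).
  by exists (existT _ A c).
by exists (existT _ dflt (fun=> setof set0)) => /nt.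
Qed.

(* A C*-algebra coded by t; it is the junk value [dflt] when t is not a code. *)
Definition code_rep (t : V) := projT1 (cid (code_rep_ex t)).
Definition code_algebra (t : V) : cstarType R := projT1 (code_rep t).
Definition code_emb (t : V) : code_algebra t -> V := projT2 (code_rep t).
Arguments code_emb : clear implicits.

Lemma code_repP t : is_code t -> coding n (code_emb t) /\ t = tuple_of_code (code (code_emb t)).
Proof. exact: projT2 (cid (code_rep_ex t)). Qed.

(** Typically [w] packs the code of B with finitely many further internal objects, and [T] reads off
    the code. *)
Definition master w (T : V -> V) := lifts T w (tuple_of_code B).

Lemma ae_B : ae (tuple_of_code B) [set t | is_code t].
Proof. by apply/(star_set_ae _ is_code_bdd); exact: ic_cstar. Qed.

Section MasterElement.
Variables (w : W) (T : V -> V).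
Hypothesis wT : master w T.

Lemma master_internal : internal w.
Proof. by have [] := lifts_internal wT. Qed.

Lemma ae_code : ae w [set x | is_code (T x)].
Proof. by apply/(lifts_ae [set t | is_code t] wT); exact: ae_B. Qed.

Let good : ae w [set x | coding n (code_emb (T x)) /\ T x = tuple_of_code (code (code_emb (T x)))].
Proof. by apply: ae_sub ae_code => x /code_repP. Qed.

Lemma master_fields :
  [/\ lifts (fun x => c_dom (code (code_emb (T x)))) w (c_dom B),
      lifts (fun x => c_add (code (code_emb (T x)))) w (c_add B),
      lifts (fun x => c_mul (code (code_emb (T x)))) w (c_mul B) &
      lifts (fun x => c_scale (code (code_emb (T x)))) w (c_scale B) /\
      [/\ lifts (fun x => c_adj (code (code_emb (T x)))) w (c_adj B),
      lifts (fun x => c_one (code (code_emb (T x)))) w (c_one B) &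
      lifts (fun x => c_norm (code (code_emb (T x)))) w (c_norm B)]].
Proof.
have v : lifts (fun x => tuple_of_code (code (code_emb (T x)))) w (tuple_of_code B).
  by apply: lifts_ext wT _; apply: ae_sub good => x [].
have ext f g a : lifts f w a -> f =1 g -> lifts g w a.
  by move=> vf /funext <-.
have [v1 {}v] := lifts_unpair v.
have [v2 v'] := lifts_unpair v.
have [v3 v''] := lifts_unpair v'.
have [v4 v3'] := lifts_unpair v''.
have [v5 v4'] := lifts_unpair v3'.
have [v6 v7] := lifts_unpair v4'.
by split; [|..|split; [|split]]; [apply: ext v1 _|apply: ext v2 _|apply: ext v3 _
  |apply: ext v4 _|apply: ext v5 _|apply: ext v6 _|apply: ext v7 _] => x;
  rewrite /tuple_of_code ?pr2E ?pr1E.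
Qed.

(* The element y of B is the value at w of a standard family of elements a x of the algebras coded by
   T x, where T represents the code of B itself. *)
Definition represents (a : forall x, code_algebra (T x)) (y : W) := lifts (fun x => code_emb (T x) (a x)) w y.

(** All elements of the coded algebras lie in one level, the rank of B, so any family whatever has a
    value. Thus elements of B are built by choosing them pointwise. *)
Lemma represents_ex a : exists y, represents a y.
Proof.
apply: (@lifts_ex _ _ _ _ n); apply: ae_sub good => x [[_ H] _]; exact: H.
Qed.

Lemma represents_dom a y : represents a y -> elem y (c_dom B).
Proof.
move=> ay; have [vd _ _ _] := master_fields.
apply/(lifts_elem ay vd); apply: ae_sub good => x [cc _] /=.
by apply/(code_dom cc); exists (a x).
Qed.

Lemma represents_of f y : elem y (c_dom B) -> lifts f w y -> exists a, represents a y.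
Proof.
move=> yB vf; have [vd _ _ _] := master_fields.
have H := (lifts_elem vf vd).1 yB.
have ex x : exists a : code_algebra (T x), (exists a, f x = code_emb (T x) a) -> f x = code_emb (T x) a.
  have [[a e]|ne] := pselect (exists a, f x = code_emb (T x) a); first by exists a.
  by exists 0 => /ne.
exists (fun x => projT1 (cid (ex x))); apply: lifts_ext vf _.
apply: ae_sub (ae_and H good) => x /= [h [cc _]].
by apply: (projT2 (cid (ex x))); apply/(code_dom cc).
Qed.

Lemma represents_ext a b y : represents a y -> ae w [set x | a x = b x] -> represents b y.
Proof. by move=> ay H; apply: lifts_ext ay _; apply: ae_sub H => x /= ->. Qed.

(** By [lifts_unique] the graph of addition in B has exactly one value at (y, z), the one
    represented by the pointwise sum; the definite description in [ic_add] must return it. The other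
    operations follow the same scheme. *)
Lemma represents_add a b y z : represents a y -> represents b z -> represents (fun x => a x + b x) (ic_add B y z).
Proof.
move=> ay bz; have [_ vS _ _] := master_fields.
have [t ht] := represents_ex (fun x => a x + b x).
suff -> : ic_add B y z = t by [].
have wi := master_internal.
have U : forall q, elem (triple y z q) (c_add B) <-> q = t.
  apply: (lifts_unique (kV := fun x q => triple (code_emb (T x) (a x)) (code_emb (T x) (b x)) q) vS ht).
  - by move=> q /opair_internal[_ /opair_internal[]].
  - move=> q qi; apply: lifts_triple; [exact: (lifts_pr1' ay)|exact: (lifts_pr1' bz)|exact: lifts_pr2'].
  - by apply: ae_sub good => x [cc _] q; exact: (code_add cc).
by apply: the_eq => [|q /U //]; exact/U.
Qed.

Lemma represents_mul a b y z : represents a y -> represents b z -> represents (fun x => a x * b x) (ic_mul B y z).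
Proof.
move=> ay bz; have [_ _ vS _] := master_fields.
have [t ht] := represents_ex (fun x => a x * b x).
suff -> : ic_mul B y z = t by [].
have wi := master_internal.
have U : forall q, elem (triple y z q) (c_mul B) <-> q = t.
  apply: (lifts_unique (kV := fun x q => triple (code_emb (T x) (a x)) (code_emb (T x) (b x)) q) vS ht).
  - by move=> q /opair_internal[_ /opair_internal[]].
  - move=> q qi; apply: lifts_triple; [exact: (lifts_pr1' ay)|exact: (lifts_pr1' bz)|exact: lifts_pr2'].
  - by apply: ae_sub good => x [cc _] q; exact: (code_mul cc).
by apply: the_eq => [|q /U //]; exact/U.
Qed.

Lemma represents_scale (l : R[i]) a y : represents a y -> represents (fun x => l *: a x) (ic_scale B l y).
Proof.
move=> ay; have [_ _ _ [vS _]] := master_fields.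
have [t ht] := represents_ex (fun x => l *: a x).
suff -> : ic_scale B l y = t by [].
have wi := master_internal.
have U : forall q, elem (triple (opair (atom (std (complex.Re l))) (atom (std (complex.Im l)))) y q) 
    (c_scale B) <-> q = t.
  apply: (lifts_unique (kV := fun x q => triple (opair (atom (complex.Re l)) (atom (complex.Im l)))
     (code_emb (T x) (a x)) q) vS ht).
  - by move=> q /opair_internal[_ /opair_internal[]].
  - move=> q qi; apply: lifts_triple; [|exact: (lifts_pr1' ay)|exact: lifts_pr2'].
    have wq := internal_opair wi qi.
    exact: lifts_pair (lifts_real_std _ wq) (lifts_real_std _ wq).
  - by apply: ae_sub good => x [cc _] q; rewrite (code_scale cc); case: (l).
by apply: the_eq => [|q /U //]; exact/U.
Qed.

Lemma represents_adj a y : represents a y -> represents (fun x => adj (a x)) (ic_adj B y).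
Proof.
move=> ay; have [_ _ _ [_ [vS _ _]]] := master_fields.
have [t ht] := represents_ex (fun x => adj (a x)).
suff -> : ic_adj B y = t by [].
have wi := master_internal.
have U : forall q, elem (opair y q) (c_adj B) <-> q = t.
  apply: (lifts_unique (kV := fun x q => opair (code_emb (T x) (a x)) q) vS ht).
  - by move=> q /opair_internal[].
  - move=> q qi; apply: lifts_pair; [exact: (lifts_pr1' ay)|exact: lifts_pr2'].
  - by apply: ae_sub good => x [cc _] q; exact: (code_adj cc).
by apply: the_eq => [|q /U //]; exact/U.
Qed.

Lemma represents_one : represents (fun x => 1) (c_one B).
Proof. by have [_ _ _ [_ [_ v _]]] := master_fields. Qed.

Lemma represents_norm a y : represents a y -> lifts_real (fun x => cnorm (a x)) w (ic_norm B y).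
Proof.
move=> ay; have [_ _ _ [_ [_ _ vS]]] := master_fields.
have wi := master_internal.
have [t ht] := lifts_real_ex (fun x => cnorm (a x)) wi.
suff -> : ic_norm B y = t by [].
have U : forall q, elem (opair y q) (c_norm B) <-> q = atom t.
  apply: (lifts_unique (kV := fun x q => opair (code_emb (T x) (a x)) q) vS ht).
  - by move=> q /opair_internal[].
  - move=> q qi; apply: lifts_pair; [exact: (lifts_pr1' ay)|exact: lifts_pr2'].
  - by apply: ae_sub good => x [cc _] q; exact: (code_norm cc).
by apply: the_eq => [|q /U e]; [exact/U|exact: atom_inj e].
Qed.

Lemma represents_limited a y : represents a y -> limited (ic_norm B y) <->
  exists M, ae w [set x | cnorm (a x) <= M].
Proof.
move=> /represents_norm h; have wi := master_internal; split=> [[r [_ H]]|[M H]].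
  by exists r; apply/(lifts_real_rel (fun x y : R => x <= y) h (lifts_real_std r wi)).
exists M; split.
  apply/(lifts_real_rel (fun x y : R => x <= y) (lifts_real_std (- M) wi) h); apply: ae_sub H => x /= H.
  apply: (@le_trans _ _ 0); last exact: cnorm_ge0.
  by rewrite oppr_le0; apply: le_trans H; exact: cnorm_ge0.
by apply/(lifts_real_rel (fun x y : R => x <= y) h (lifts_real_std M wi)).
Qed.

(** The set of points where the bound holds may depend on [r]; the norm need not vanish at any
    single point. *)
Lemma represents_infinitesimal a y : represents a y -> infinitesimal (ic_norm B y) <->
  forall r, 0 < r -> ae w [set x | cnorm (a x) <= r].
Proof.
move=> /represents_norm h; have wi := master_internal; split=> H r r0.
  by have [_ {}H] := H r r0; apply/(lifts_real_rel (fun x y : R => x <= y) h (lifts_real_std r wi)).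
have {}H := H r r0; split; last by apply/(lifts_real_rel (fun x y : R => x <= y) h (lifts_real_std r wi)).
apply/(lifts_real_rel (fun x y : R => x <= y) (lifts_real_std (- r) wi) h); apply: ae_sub H => x /= H.
apply: (@le_trans _ _ 0); last exact: cnorm_ge0.
by rewrite oppr_le0 ltW.
Qed.

End MasterElement.

Lemma internal_B : internal (tuple_of_code B).
Proof. exact: ae_internal ae_B. Qed.

Lemma master_family (I : eqType) (l : seq I) (F : I -> W) :
  (forall i, i \in l -> elem (F i) (c_dom B)) ->
  exists w T (a : I -> forall x, code_algebra (T x)), master w T /\
    forall i, i \in l -> represents w (a i) (F i).
Proof.
move=> H; have [Di _] := opair_internal internal_B.
(* [None] carries the code of B, so that it is packed together with the elements. *)
pose F' o := if o is Some i then F i else tuple_of_code B.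
have [|w [f [wi vf]]] := @lifts_family _ E _ (None :: map Some l) F'.
  move=> [i|] /=; last by move=> _; exact: internal_B.
  by rewrite inE /= mem_map; [move=> /H; exact: internal_elem|exact: Some_inj].
have wT : master w (f None) by apply: (vf None); rewrite mem_head.
have ex i : exists a : forall x, code_algebra (f None x), i \in l -> represents w a (F i).
  have [il|_] := boolP (i \in l); last by exists (fun=> 0).
  have vi : lifts (f (Some i)) w (F i).
    by apply: (vf (Some i)); rewrite inE /= mem_map //; exact: Some_inj.
  by have [a ha] := represents_of wT (H i il) vi; exists a.
have [a ha] := choice ex.
by exists w, (f None), a.
Qed.

Lemma master_common (l : seq W) :
  (forall i, (i < size l)%N -> elem (nth (st (atom 0)) l i) (c_dom B)) ->
  exists w T (a : nat -> forall x, code_algebra (T x)), master w T /\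
    forall i, (i < size l)%N -> represents w (a i) (nth (st (atom 0)) l i).
Proof.
move=> H; have [|w [T [a [wT ha]]]] := @master_family _ (iota 0 (size l)) (nth (st (atom 0)) l).
  by move=> i; rewrite mem_iota; exact: H.
by exists w, T, a; split => // i il; apply: ha; rewrite mem_iota.
Qed.

End Rep.

(** * The infinitesimal hull *)

Section Hull.
Variables (R : realType) (E : nonstandard_extension R) (B : internal_cstar E).
Variable dflt : cstarType R.
Local Notation W := (hypV E).
Implicit Types (w x y z : W).


Definition inf_close x y := infinitesimal (ic_norm B (ic_add B x (ic_scale B (-1) y))).

Lemma inf_closeE w T (a b : forall v, code_algebra B dflt (T v)) x y : master B w T -> represents w a x -> represents w b y ->
  inf_close x y <-> forall r, 0 < r -> ae w [set v | cnorm (a v - b v) <= r].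
Proof.
move=> wT ax by_; rewrite /inf_close (represents_infinitesimal wT (represents_add wT ax (represents_scale wT (-1) by_))).
by split=> H r r0; apply: ae_sub (H r r0) => v /=; rewrite scaleN1r.
Qed.

Lemma fin_dom x : ic_fin B x -> elem x (c_dom B). Proof. by case. Qed.

Lemma inf_close_refl x : ic_fin B x -> inf_close x x.
Proof.
move=> /fin_dom xB.
have [|w [T [a [wT H]]]] := @master_common _ _ B dflt [:: x]; first by case.
have ax := H 0%N isT; apply/(inf_closeE wT ax ax) => r r0.
by apply: ae_all => [|v]; [exact: master_internal wT|rewrite /= subrr cnorm0 ltW].
Qed.

Lemma inf_close_sym x y : ic_fin B x -> ic_fin B y -> inf_close x y -> inf_close y x.
Proof.
move=> /fin_dom xB /fin_dom yB.
have [|w [T [a [wT H]]]] := @master_common _ _ B dflt [:: x; y]; first by case=> [|[]].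
have ax := H 0%N isT; have ay := H 1%N isT.
move=> /(inf_closeE wT ax ay) h; apply/(inf_closeE wT ay ax) => r /h.
by apply: ae_sub => v /=; rewrite cnormBC.
Qed.

Lemma divr2_gt0 (r : R) : 0 < r -> 0 < r / 2. Proof. by move=> ?; rewrite divr_gt0. Qed.

Lemma inf_close_trans x y z : ic_fin B x -> ic_fin B y -> ic_fin B z ->
  inf_close x y -> inf_close y z -> inf_close x z.
Proof.
move=> /fin_dom xB /fin_dom yB /fin_dom zB.
have [|w [T [a [wT H]]]] := @master_common _ _ B dflt [:: x; y; z]; first by case=> [|[|[]]].
have ax := H 0%N isT; have ay := H 1%N isT; have az := H 2%N isT.
move=> /(inf_closeE wT ax ay) h1 /(inf_closeE wT ay az) h2; apply/(inf_closeE wT ax az) => r /divr2_gt0 r0.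
apply: ae_sub (ae_and (h1 _ r0) (h2 _ r0)) => v /= [e1 e2].
apply: le_trans (cnorm_tri (a 1%N v) _ _) _; lra.
Qed.

Lemma inf_close_add x y x' y' : ic_fin B x -> ic_fin B y -> ic_fin B x' -> ic_fin B y' ->
  inf_close x x' -> inf_close y y' -> inf_close (ic_add B x y) (ic_add B x' y').
Proof.
move=> /fin_dom xB /fin_dom yB /fin_dom x'B /fin_dom y'B.
have [|w [T [a [wT H]]]] := @master_common _ _ B dflt [:: x; y; x'; y']; first by case=> [|[|[|[]]]].
have ax := H 0%N isT; have ay := H 1%N isT; have ax' := H 2%N isT; have ay' := H 3%N isT.
move=> /(inf_closeE wT ax ax') h1 /(inf_closeE wT ay ay') h2.
apply/(inf_closeE wT (represents_add wT ax ay) (represents_add wT ax' ay')) => r /divr2_gt0 r0.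
apply: ae_sub (ae_and (h1 _ r0) (h2 _ r0)) => v /= [e1 e2].
rewrite opprD addrACA; apply: le_trans (cnormD_le _ _) _; lra.
Qed.

Lemma inf_close_mul x y x' y' : ic_fin B x -> ic_fin B y -> ic_fin B x' -> ic_fin B y' ->
  inf_close x x' -> inf_close y y' -> inf_close (ic_mul B x y) (ic_mul B x' y').
Proof.
move=> [xB xl] [yB yl] [x'B x'l] [y'B y'l].
have [|w [T [a [wT H]]]] := @master_common _ _ B dflt [:: x; y; x'; y']; first by case=> [|[|[|[]]]].
have ax := H 0%N isT; have ay := H 1%N isT; have ax' := H 2%N isT; have ay' := H 3%N isT.
have [M1 m1] := (represents_limited wT ax').1 x'l.
have [M2 m2] := (represents_limited wT ay).1 yl.
move=> /(inf_closeE wT ax ax') h1 /(inf_closeE wT ay ay') h2.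
apply/(inf_closeE wT (represents_mul wT ax ay) (represents_mul wT ax' ay')) => r r0.
(* A bound for one factor of each of the two error products; the 1 makes it positive. Limitedness of
   the factors is what makes multiplication respect infinitesimal differences. *)
pose M := `|M1| + `|M2| + 1.
have M0 : 0 < M by rewrite ltr_wpDl // addr_ge0.
have q0 : 0 < r / (2 * M) by rewrite divr_gt0 // mulr_gt0.
apply: ae_sub (ae_and (ae_and (h1 _ q0) (h2 _ q0)) (ae_and m1 m2)) => v /= [[e1 e2] [e3 e4]].
have -> : a 0%N v * a 1%N v - a 2%N v * a 3%N v =
   (a 0%N v - a 2%N v) * a 1%N v + a 2%N v * (a 1%N v - a 3%N v).
  by rewrite mulrBl mulrBr addrA subrK.
apply: le_trans (cnormD_le _ _) _.
have b1 : cnorm (a 1%N v) <= M.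
  by apply: le_trans e4 _; have := ler_norm M2; have := normr_ge0 M1; rewrite /M; lra.
have b2 : cnorm (a 2%N v) <= M.
  by apply: le_trans e3 _; have := ler_norm M1; have := normr_ge0 M2; rewrite /M; lra.
have c1 := cnormM_le_of e1 b1.
have c2 := cnormM_le_of b2 e2.
apply: le_trans (lerD c1 c2) _.
have -> : r / (2 * M) * M + M * (r / (2 * M)) = r.
  by field; rewrite gt_eqF.
by [].
Qed.

Lemma inf_close_scale l x x' : ic_fin B x -> ic_fin B x' ->
  inf_close x x' -> inf_close (ic_scale B l x) (ic_scale B l x').
Proof.
move=> /fin_dom xB /fin_dom x'B.
have [|w [T [a [wT H]]]] := @master_common _ _ B dflt [:: x; x']; first by case=> [|[]].
have ax := H 0%N isT; have ax' := H 1%N isT.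
move=> /(inf_closeE wT ax ax') h.
apply/(inf_closeE wT (represents_scale wT l ax) (represents_scale wT l ax')) => r r0.
pose M := complex.Re `|l| + 1; have L0 := Re_norm_ge0 l.
have M0 : 0 < M by rewrite ltr_wpDl.
have q0 : 0 < r / M by rewrite divr_gt0.
apply: ae_sub (h _ q0) => v /= e; rewrite -scalerBr cnormZE.
apply: (@le_trans _ _ (M * (r / M))); last by rewrite mulrC divfK // gt_eqF.
by apply: ler_pM => //; [exact: cnorm_ge0|rewrite lerDl].
Qed.

Lemma inf_close_adj x x' : ic_fin B x -> ic_fin B x' ->
  inf_close x x' -> inf_close (ic_adj B x) (ic_adj B x').
Proof.
move=> /fin_dom xB /fin_dom x'B.
have [|w [T [a [wT H]]]] := @master_common _ _ B dflt [:: x; x']; first by case=> [|[]].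
have ax := H 0%N isT; have ax' := H 1%N isT.
move=> /(inf_closeE wT ax ax') h.
apply/(inf_closeE wT (represents_adj wT ax) (represents_adj wT ax')) => r /h.
by apply: ae_sub => v /=; rewrite -starB cnorm_adj.
Qed.

Lemma fin_add x y : ic_fin B x -> ic_fin B y -> ic_fin B (ic_add B x y).
Proof.
move=> [xB xl] [yB yl].
have [|w [T [a [wT H]]]] := @master_common _ _ B dflt [:: x; y]; first by case=> [|[]].
have ax := H 0%N isT; have ay := H 1%N isT; have az := represents_add wT ax ay.
split; first exact: (represents_dom wT az).
have [M1 m1] := (represents_limited wT ax).1 xl; have [M2 m2] := (represents_limited wT ay).1 yl.
apply/(represents_limited wT az); exists (M1 + M2).
apply: ae_sub (ae_and m1 m2) => v /= [e1 e2].
by apply: le_trans (cnormD_le _ _) _; exact: lerD.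
Qed.

Lemma fin_mul x y : ic_fin B x -> ic_fin B y -> ic_fin B (ic_mul B x y).
Proof.
move=> [xB xl] [yB yl].
have [|w [T [a [wT H]]]] := @master_common _ _ B dflt [:: x; y]; first by case=> [|[]].
have ax := H 0%N isT; have ay := H 1%N isT; have az := represents_mul wT ax ay.
split; first exact: (represents_dom wT az).
have [M1 m1] := (represents_limited wT ax).1 xl; have [M2 m2] := (represents_limited wT ay).1 yl.
apply/(represents_limited wT az); exists (M1 * M2).
by apply: ae_sub (ae_and m1 m2) => v /= [e1 e2]; exact: cnormM_le_of.
Qed.

Lemma fin_scale l x : ic_fin B x -> ic_fin B (ic_scale B l x).
Proof.
move=> [xB xl].
have [|w [T [a [wT H]]]] := @master_common _ _ B dflt [:: x]; first by case.
have ax := H 0%N isT; have az := represents_scale wT l ax.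
split; first exact: (represents_dom wT az).
have [M m] := (represents_limited wT ax).1 xl.
apply/(represents_limited wT az); exists (complex.Re `|l| * M).
apply: ae_sub m => v /= e; rewrite cnormZE ler_wpM2l //; exact: Re_norm_ge0.
Qed.

Lemma fin_adj x : ic_fin B x -> ic_fin B (ic_adj B x).
Proof.
move=> [xB xl].
have [|w [T [a [wT H]]]] := @master_common _ _ B dflt [:: x]; first by case.
have ax := H 0%N isT; have az := represents_adj wT ax.
split; first exact: (represents_dom wT az).
have [M m] := (represents_limited wT ax).1 xl.
apply/(represents_limited wT az); exists M.
by apply: ae_sub m => v /= e; rewrite cnorm_adj.
Qed.

Lemma fin_one : ic_fin B (c_one B).
Proof.
have [|w [T [a [wT H]]]] := @master_common _ _ B dflt [::]; first by [].
have a1 := represents_one dflt wT.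
split; first exact: (represents_dom wT a1).
apply/(represents_limited wT a1); exists 1; apply: ae_all; first exact: master_internal wT.
by move=> v /=; rewrite cnorm1.
Qed.

Lemma hull_piE x y : ic_fin B x -> ic_fin B y -> hull_pi B x = hull_pi B y <-> inf_close x y.
Proof.
move=> fx fy; split=> [e|xy].
  have : hull_pi B y y by split => //; exact: inf_close_refl.
  by rewrite -e => -[].
apply/seteqP; split => z [fz nz]; split => //.
  by apply: (inf_close_trans fy fx fz) => //; exact: inf_close_sym.
exact: (inf_close_trans fx fy fz).
Qed.

Lemma hull_pi_refl x : ic_fin B x -> hull_pi B x x.
Proof. by move=> fx; split => //; exact: inf_close_refl. Qed.

(** All sets in the union that defines the sum of two classes coincide, because sums of infinitely
    close elements are infinitely close. The same holds for the other operations. *)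
Lemma hull_add x y : ic_fin B x -> ic_fin B y ->
  sa_add (hull_pi B x : hull B) (hull_pi B y) = hull_pi B (ic_add B x y).
Proof.
move=> fx fy; apply/seteqP; split=> z.
  move=> [x' [fx' nx] [y' [fy' ny]]].
  rewrite (_ : hull_pi B (ic_add B x' y') = hull_pi B (ic_add B x y)) //.
  by apply/esym/hull_piE; [exact: fin_add|exact: fin_add|exact: inf_close_add].
by move=> h; exists x; [exact: hull_pi_refl|exists y => //; exact: hull_pi_refl].
Qed.

Lemma hull_mul x y : ic_fin B x -> ic_fin B y ->
  sa_mul (hull_pi B x : hull B) (hull_pi B y) = hull_pi B (ic_mul B x y).
Proof.
move=> fx fy; apply/seteqP; split=> z.
  move=> [x' [fx' nx] [y' [fy' ny]]].
  rewrite (_ : hull_pi B (ic_mul B x' y') = hull_pi B (ic_mul B x y)) //.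
  by apply/esym/hull_piE; [exact: fin_mul|exact: fin_mul|exact: inf_close_mul].
by move=> h; exists x; [exact: hull_pi_refl|exists y => //; exact: hull_pi_refl].
Qed.

Lemma hull_scale l x : ic_fin B x ->
  sa_scale l (hull_pi B x : hull B) = hull_pi B (ic_scale B l x).
Proof.
move=> fx; apply/seteqP; split=> z.
  move=> [x' [fx' nx]].
  rewrite (_ : hull_pi B (ic_scale B l x') = hull_pi B (ic_scale B l x)) //.
  by apply/esym/hull_piE; [exact: fin_scale|exact: fin_scale|exact: inf_close_scale].
by move=> h; exists x => //; exact: hull_pi_refl.
Qed.

Lemma hull_adj x : ic_fin B x ->
  sa_adj (hull_pi B x : hull B) = hull_pi B (ic_adj B x).
Proof.
move=> fx; apply/seteqP; split=> z.
  move=> [x' [fx' nx]].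
  rewrite (_ : hull_pi B (ic_adj B x') = hull_pi B (ic_adj B x)) //.
  by apply/esym/hull_piE; [exact: fin_adj|exact: fin_adj|exact: inf_close_adj].
by move=> h; exists x => //; exact: hull_pi_refl.
Qed.

End Hull.

(** * An infinite natural number from a nonstandard real *)

Section InfiniteIndex.
Variables (R : realType) (E : nonstandard_extension R).
Local Notation V := (stdV E).
Local Notation W := (hypV E).

(* If the type of a nonstandard real decides every rational cut by D i, then x is determined by
   D (up to one real), so the index of the first cut that x violates is an infinite natural. *)
Lemma infinite_index : exists (U : W) (k0 : V -> nat), internal U /\
  forall j, ae U [set x | (j <= k0 x)%N].
Proof.
have [u nu] := nontrivial E; pose U : W := atom u.
have UR : star_set (range (atom (s := V))) U.
  rewrite /star_set star_reals.
  by apply: (@elem_setofE _ W 0 (range atom) U (fun _ H => H)).2; exists u.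
have aR : ae U (range (atom (s := V))) by apply/(star_set_ae (n := 0) _).
have Ui : internal U by exists 0%N.
pose rho (x : V) : R := the 0 [set r | x = atom r].
have rhoE r : rho (atom r) = r by apply: the_eq => // z e; exact: esym (atom_inj e).
(* An enumeration of the rationals; [D i] is the side of the cut at [q i] on which the nonstandard
   real lies. *)
pose q (i : nat) : R := if @unpickle rat i is Some p then ratr p else 0.
pose D i : set V := if pselect (ae U [set x | rho x < q i]) then [set x | rho x < q i]
  else [set x | q i <= rho x].
have aD i : ae U (D i).
  rewrite /D; case: pselect => // nA; have := (ae_not _ Ui).2 nA.
  by apply: ae_sub => x /= /negP; rewrite -leNgt.
pose all_D := [set x : V | forall i, D i x].
(* Two reals on the same side of all rational cuts are equal. If almost every point satisfied all
   cuts, almost every point would be one fixed real, and [u] would be standard. *)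
have nall : ae U (~` all_D).
  apply/(ae_not _ Ui) => aA.
  have [x0 [Dx0 [r0 _ e0]]] := ae_exists (ae_and aA aR).
  apply: (nu r0); apply: (@atom_inj _ W); rewrite -star_atom.
  apply/(lifts_eq (lifts_const (atom r0) Ui) (lifts_id Ui)).
  apply: ae_sub (ae_and aA aR) => x [Dx [r _ e1]] /=.
  rewrite -e1; suff -> : r = r0 by [].
  rewrite -e0 in Dx0; rewrite -e1 in Dx => {x0 x e0 e1}.
  have sep (a b : R) : all_D (atom a) -> all_D (atom b) -> a < b -> False.
    move=> Da Db /rat_in_itvoo[p /itvP pab].
    have := Da (pickle p); have := Db (pickle p); rewrite /D /q pickleK.
    case: pselect => _ /=; rewrite !rhoE => h1 h2.
      by move: h1; rewrite ltNge ltW // pab.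
    by move: h2; rewrite leNgt pab.
  by case: (ltgtP r r0) => // l; [case: (sep _ _ Dx Dx0 l)|case: (sep _ _ Dx0 Dx l)].
have ex x : exists k, ~ all_D x -> ~ D k x /\ forall i, (i < k)%N -> D i x.
  have [|nx] := pselect (all_D x); first by exists 0%N.
  have exP : exists k, `[< ~ D k x >].
    by apply: contrapT => /forallNP H; apply: nx => i;
      apply: contrapT => nD; apply: (H i); apply/asboolP.
  case: (ex_minnP exP) => k /asboolP nk kmin; exists k => _; split => // i ik.
  apply: contrapT => ni; have : (k <= i)%N by apply: kmin; apply/asboolP.
  by rewrite leqNgt ik.
have [k0 k0P] := choice ex.
exists U, k0; split => // j.
have aDj : ae U [set x | forall i, i \in iota 0 j -> D i x] by apply: ae_seq.
apply: ae_sub (ae_and nall aDj) => x [nx Dx] /=; rewrite leqNgt; apply/negP => kj.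
by have [+ _] := k0P _ nx; apply; apply: Dx; rewrite mem_iota.
Qed.

End InfiniteIndex.

(** * From embeddings into standard algebras to an embedding into the hull *)

Section Embeddings.
Variable R : realType.

Definition embeds (A D : cstarType R) := exists psi : A -> D,
  @star_monomorphism R (staralg_of A) (staralg_of D) psi.

Lemma star_monomorphism_comp (A B C : staralg R) (f : A -> B) (g : B -> C) :
  star_monomorphism f -> star_monomorphism g -> star_monomorphism (g \o f).
Proof.
move=> [fm fi] [gm gi].
have fd x : x \in sa_dom A -> f x \in sa_dom B.
  by rewrite !inE => /(star_morphism_fun fm).
split.
  split.
  - by move=> x /(star_morphism_fun fm)/(star_morphism_fun gm).
  - by move=> x y xA yA /=; rewrite (star_morphismD fm) // (star_morphismD gm) // fd.
  - by move=> x y xA yA /=; rewrite (star_morphismM fm) // (star_morphismM gm) // fd.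
  - by move=> z x xA /=; rewrite (star_morphismZ fm) // (star_morphismZ gm) // fd.
  - by move=> x xA /=; rewrite (star_morphism_adj fm) // (star_morphism_adj gm) // fd.
  - by rewrite /= (star_morphism1 fm) (star_morphism1 gm).
by move=> x y xA yA /gi e; apply: fi => //; apply: e; exact: fd.
Qed.

Lemma star_monomorphism_id (A : staralg R) : star_monomorphism (@id A).
Proof. by split; [split|move=> x y]. Qed.

Variables (A : nat -> cstarType R) (h : forall k, A k -> A k.+1).
Variables (L : cstarType R) (phi : forall k, A k -> L).
Hypothesis fdA : forall k, finite_dim (A k).
Hypothesis hm : forall k, @star_monomorphism R (staralg_of (A k)) (staralg_of (A k.+1)) (@h k).
Hypothesis cl : closure_of_union h phi.

Lemma transition j n : exists t : A j -> A (n + j)%N,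
  @star_monomorphism R (staralg_of (A j)) (staralg_of (A (n + j)%N)) t /\
  forall x, phi (t x) = phi x.
Proof.
elim: n => [|n [t [tm tp]]]; first by exists id; split => //; exact: star_monomorphism_id.
exists (fun x => h (t x)); split => [|x]; first exact: (star_monomorphism_comp tm (hm _)).
by case: cl => _ + _; move=> ->.
Qed.

Lemma phi_isometry k (x : A k) : cnorm (phi x) = cnorm x.
Proof.
have [d dA] := fdA k; case: cl => pm _ _.
exact: star_monomorphism_isometry dA (pm k) x.
Qed.

(** A best approximation is replaced by one that attains every accuracy 1/(m+1), m <= k, which is
    attainable in A_k at all. Density gives each accuracy at some stage, and the inclusions carry it
    to all later stages. *)
Lemma approximants : exists z : forall k, L -> A k, forall x r, 0 < r ->
  exists K, forall k, (K <= k)%N -> cnorm (x - phi (z k x)) < r.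
Proof.
have H k (x : L) : exists z : A k, forall m, (m <= k)%N ->
    (exists a : A k, cnorm (x - phi a) < m.+1%:R^-1) -> cnorm (x - phi z) < m.+1%:R^-1.
  suff S n : exists z : A k, forall m, (m <= n)%N ->
    (exists a : A k, cnorm (x - phi a) < m.+1%:R^-1) -> cnorm (x - phi z) < m.+1%:R^-1 by exact: S.
  elim: n => [|n [z zP]].
    have [[a ha]|na] := pselect (exists a : A k, cnorm (x - phi a) < 1%:R^-1).
      by exists a => m; rewrite leqn0 => /eqP ->.
    by exists 0 => m; rewrite leqn0 => /eqP -> /na.
  have [[a ha]|na] := pselect (exists a : A k, cnorm (x - phi a) < n.+2%:R^-1).
    exists a => m mn _; apply: lt_le_trans ha _.
    by rewrite lef_pV2 ?posrE // ler_nat ltnS.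
  exists z => m; rewrite leq_eqVlt => /orP[/eqP -> /na//|]; exact: zP.
pose z k x := projT1 (cid (H k x)).
exists z => x r r0.
pose m := Num.truncn r^-1.
have mr : m.+1%:R^-1 < r.
  rewrite -[ltRHS]invrK ltf_pV2 ?posrE ?invr_gt0 //.
  exact: truncnS_gt.
have [_ _ dense] := cl.
have m0 : 0 < m.+1%:R^-1 :> R by rewrite invr_gt0.
have [k0 [a ha]] := dense x _ m0.
exists (maxn k0 m) => k; rewrite geq_max => /andP[k0k mk].
apply: lt_trans mr; apply: (projT2 (cid (H k x))) => //.
have [t [_ tp]] := transition k0 (k - k0).
move: t tp; rewrite subnK // => t tp.
by exists (t a); rewrite tp.
Qed.

Variables (E : nonstandard_extension R) (B : internal_cstar E).
Local Notation V := (stdV E).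
Local Notation W := (hypV E).

Lemma embedding_of_embeds :
  (forall k, ae (tuple_of_code B) [set t | embeds (A k) (code_algebra B L t)]) ->
  exists f : staralg_of L -> hull B, star_monomorphism f.
Proof.
move=> emb.
have [U [k0 [Ui k0inf]]] := infinite_index E.
have Bi := ae_internal (emb 0%N).
have [v1 v2] := lifts_pr Bi Ui.
set w := opair (tuple_of_code B) U in v1 v2.
have wT : master B w (@pr1 _ E) := v1.
have wi : internal w := master_internal wT.
(* Overspill by hand: [k] is the largest index up to the infinite [k0] for which the embedding
   exists. Each fixed index is admissible almost everywhere, so [kk] is infinite as well. *)
have exk (x : V) : exists k, embeds (A 0%N) (code_algebra B L (pr1 x)) ->
    embeds (A k) (code_algebra B L (pr1 x)) /\
    forall j, (j <= k0 (pr2 x))%N -> embeds (A j) (code_algebra B L (pr1 x)) -> (j <= k)%N.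
  have [e0|n0] := pselect (embeds (A 0%N) (code_algebra B L (pr1 x))); last by exists 0%N.
  pose P j := (j <= k0 (pr2 x))%N && `[< embeds (A j) (code_algebra B L (pr1 x)) >].
  have exP : exists j, P j by exists 0%N; apply/andP; split => //; apply/asboolP.
  have bP j : P j -> (j <= k0 (pr2 x))%N by case/andP.
  case: (ex_maxnP exP bP) => k /andP[_ /asboolP ek] kmax.
  by exists k => _; split => // j jk ej; apply: kmax; apply/andP; split => //; apply/asboolP.
have [kk kkP] := choice exk.
have emb' k : ae w [set x | embeds (A k) (code_algebra B L (pr1 x))].
  by apply/(lifts_ae [set t | embeds (A k) (code_algebra B L t)] v1); exact: emb.
have akk : ae w [set x | embeds (A (kk x)) (code_algebra B L (pr1 x))].
  by apply: ae_sub (emb' 0%N) => x /kkP[].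
have kinf K : ae w [set x | (K <= kk x)%N].
  have k0K : ae w [set x | (K <= k0 (pr2 x))%N] by apply/(lifts_ae [set y | (K <= k0 y)%N] v2); exact: k0inf.
  apply: ae_sub (ae_and k0K (ae_and (emb' 0%N) (emb' K))) => x /= [h1 [h2 h3]].
  by have [_] := kkP x h2; exact.
have expsi (x : V) : exists psi : A (kk x) -> code_algebra B L (pr1 x), embeds (A (kk x)) (code_algebra B L (pr1 x)) ->
    @star_monomorphism R (staralg_of (A (kk x))) (staralg_of (code_algebra B L (pr1 x))) psi.
  have [[psi pm]|n] := pselect (embeds (A (kk x)) (code_algebra B L (pr1 x))); first by exists psi.
  by exists (fun=> 0).
pose psi x := projT1 (cid (expsi x)).
have psiP x : embeds (A (kk x)) (code_algebra B L (pr1 x)) ->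
    @star_monomorphism R (staralg_of (A (kk x))) (staralg_of (code_algebra B L (pr1 x))) (psi x).
  exact: projT2 (cid (expsi x)).
have [z zP] := approximants.
(* The image of the approximation of [y] at the point [x]; [p y x] is the same approximation seen in
   [L]. *)
pose G y x := psi x (z (kk x) y).
pose p y x := phi (z (kk x) y).
have good : ae w [set x | (@star_morphism R (staralg_of (A (kk x))) (staralg_of (code_algebra B L (pr1 x))) (psi x)) 
   /\ forall a, cnorm (psi x a) = cnorm (phi a)].
  apply: ae_sub akk => x /psiP pm; split => [|a]; first by case: pm.
  have [d dA] := fdA (kk x).
  by rewrite phi_isometry (star_monomorphism_isometry dA pm).
have pm k : @star_morphism R (staralg_of (A k)) (staralg_of L) (@phi k).
  by case: cl => /(_ k)[].
have appr y r : 0 < r -> ae w [set x | cnorm (y - p y x) <= r].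
  move=> /(zP y)[K KP]; apply: ae_sub (kinf K) => x /= /KP; exact: ltW.
have exg y : exists g, represents w (G y) g by exact: represents_ex wT _.
have [g gP] := choice exg.
have fin y : ic_fin B (g y).
  split; first exact: (represents_dom wT (gP y)).
  apply/(represents_limited wT (gP y)); exists (cnorm y + 1).
  apply: ae_sub (ae_and good (appr y 1 ltr01)) => x /= [[_ iso] h1].
  rewrite /G iso -/(p y x); have := cnorm_tri 0 (p y x) y.
  have := cnormB_le y (y - p y x); rewrite opprB addrC subrK; lra.
(* All the identities follow from those of L, because psi and phi have the same norms and
   phi (z y) is infinitely close to y. *)
have key b y : (forall r, 0 < r -> ae w [set x | exists2 a : A (kk x),
    b x = psi x a & cnorm (y - phi a) <= r]) -> forall v, represents w b v -> 
    ic_fin B v -> hull_pi B (g y) = hull_pi B v.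
  move=> H v bv fv; apply/(hull_piE L (fin y) fv)/(inf_closeE wT (gP y) bv) => r /divr2_gt0 r0.
  apply: ae_sub (ae_and good (ae_and (H _ r0) (appr y _ r0))) => x /= [[sm iso] [[a -> h1] h2]].
  rewrite /G -(star_morphB sm) iso (star_morphB (pm _)) -/(p y x).
  apply: le_trans (cnorm_tri y _ _) _; rewrite [X in X + _]cnormBC; lra.
exists (fun y => hull_pi B (g y) : hull B); split; last first.
  move=> y y' _ _ /(hull_piE L (fin y) (fin y')) /(inf_closeE wT (gP y) (gP y')) H.
  apply/eqP; rewrite -subr_eq0; apply/eqP/cnorm_eq0/eqP; apply: contraT => n0.
  (* Three errors occur: the two approximations and the distance of the images. With a quarter each
     they cannot add up to the distance of [y] and [y']. *)
  have c0 : 0 < cnorm (y - y') / 4 by rewrite divr_gt0 // lt_def n0 cnorm_ge0.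
  have [x [/= [sm iso] [h1 [h2 h3]]]] := ae_exists (ae_and good (ae_and (H _ c0)
    (ae_and (appr y _ c0) (appr y' _ c0)))).
  move: h1; rewrite /G -(star_morphB sm) iso (star_morphB (pm _)) -/(p y x) -/(p y' x) => h1.
  have t1 := cnorm_tri (p y x) y y'; have t2 := cnorm_tri (p y' x) (p y x) y'.
  rewrite [cnorm (p y' x - y')]cnormBC in t2.
  move: c0 h1 h2 h3 t1 t2; lra.
split.
- by move=> y _; exists (g y).
- move=> y y' _ _; rewrite hull_add //; apply: key (represents_add wT (gP y) (gP y')) _; last exact: fin_add.
  move=> r /divr2_gt0 r0; apply: ae_sub (ae_and good (ae_and (appr y _ r0) (appr y' _ r0))) => x /= [[sm _] [h1 h2]].
  exists (z (kk x) y + z (kk x) y'); first by rewrite (star_morphD sm).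
  rewrite (star_morphD (pm _)) opprD addrACA; apply: le_trans (cnormD_le _ _) _.
  rewrite -/(p y x) -/(p y' x); lra.
- move=> y y' _ _; rewrite hull_mul //; apply: key (represents_mul wT (gP y) (gP y')) _; last exact: fin_mul.
  move=> r r0; pose M := cnorm y + cnorm y' + 1.
  have y0 := cnorm_ge0 y; have y'0 := cnorm_ge0 y'.
  have M0 : 0 < M by rewrite /M; lra.
  have q0 : 0 < r / (2 * M) by rewrite divr_gt0 // mulr_gt0.
  apply: ae_sub (ae_and good (ae_and (ae_and (appr y _ ltr01) (appr y _ q0)) (appr y' _ q0))) => x /= [[sm _] [[h0 h1] h2]].
  exists (z (kk x) y * z (kk x) y'); first by rewrite (star_morphM sm).
  rewrite (star_morphM (pm _)) -/(p y x) -/(p y' x).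
  have -> : y * y' - p y x * p y' x = (y - p y x) * y' + p y x * (y' - p y' x).
    by rewrite mulrBl mulrBr addrA subrK.
  apply: le_trans (cnormD_le _ _) _.
  have b1 : cnorm y' <= M by rewrite /M; lra.
  have b2 : cnorm (p y x) <= M.
    have := cnormB_le y (y - p y x); rewrite opprB addrC subrK /M; lra.
  apply: le_trans (lerD (cnormM_le_of h1 b1) (cnormM_le_of b2 h2)) _.
  have -> : r / (2 * M) * M + M * (r / (2 * M)) = r by field; rewrite gt_eqF.
  by [].
- move=> l y _; rewrite hull_scale //; apply: key (represents_scale wT l (gP y)) _; last exact: fin_scale.
  move=> r r0; pose M := complex.Re `|l| + 1; have L0 := Re_norm_ge0 l.
  have M0 : 0 < M by rewrite ltr_wpDl.
  have q0 : 0 < r / M by rewrite divr_gt0.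
  apply: ae_sub (ae_and good (appr y _ q0)) => x /= [[sm _] h1].
  exists (l *: z (kk x) y); first by rewrite (star_morphZ sm).
  rewrite (star_morphZ (pm _)) -scalerBr cnormZE -/(p y x).
  apply: (@le_trans _ _ (M * (r / M))); last by rewrite mulrC divfK // gt_eqF.
  by apply: ler_pM => //; [exact: cnorm_ge0|rewrite lerDl].
- move=> y _; rewrite hull_adj //; apply: key (represents_adj wT (gP y)) _; last exact: fin_adj.
  move=> r r0; apply: ae_sub (ae_and good (appr y _ r0)) => x /= [[sm _] h1].
  exists (adj (z (kk x) y)); first by rewrite (star_morph_adj sm).
  by rewrite (star_morph_adj (pm _)) -starB cnorm_adj.
- apply: key (represents_one L wT) _; last exact: fin_one.
  move=> r r0; apply: ae_sub good => x /= [sm _]; exists 1; first by rewrite (star_morph1 sm).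
  by rewrite (star_morph1 (pm _)) subrr cnorm0 ltW.
Qed.

End Embeddings.

(** * Dimension vectors *)

Section Isomorphism.
Variables (R : realType) (A A' : cstarType R) (i : A -> A').
Hypotheses (ib : bijective i) (im : @star_morphism R (staralg_of A) (staralg_of A') i).

Lemma iso_has_dim d : has_dim A d -> has_dim A' d.
Proof.
move=> [b bb]; exists (i \o b).
apply: (@eq_bij _ _ (i \o (fun z : {ffun 'I_d -> R[i]} => \sum_j z j *: b j))).
  exact: bij_comp.
by move=> z /=; rewrite (star_morph_sum im); apply: eq_bigr => j _; rewrite (star_morphZ im).
Qed.

Lemma iso_central_projection e : central_projection (i e) <-> central_projection e.
Proof.
have ii := bij_inj ib; split=> -[ee ae ce]; split.
- by apply: ii; rewrite (star_morphM im).
- by apply: ii; rewrite (star_morph_adj im).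
- by move=> x; apply: ii; rewrite !(star_morphM im).
- by rewrite -(star_morphM im) ee.
- by rewrite -(star_morph_adj im) ae.
- by case: ib => j ji ij x; rewrite -[x]ij -!(star_morphM im) ce.
Qed.

Lemma iso_minimal_central e : minimal_central e -> minimal_central (i e).
Proof.
move=> [ce e0 emin]; have ii := bij_inj ib; split.
- exact/iso_central_projection.
- by apply: contra e0 => /eqP; rewrite -(star_morph0 im) => /ii ->.
- case: ib => j ji ij p; rewrite -[p]ij => /iso_central_projection cp p0.
  rewrite -(star_morphM im) => /ii pe; congr i; apply: emin => //.
  by apply: contra p0 => /eqP ->; rewrite (star_morph0 im).
Qed.

Lemma iso_has_block_dim e d : has_block_dim e d -> has_block_dim (i e) d.
Proof.
move=> [f [fm [ff fi fs]]]; exists (i \o f).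
have ii := bij_inj ib.
have cf : set_fun (sa_dom (matrix_staralg R d)) (sa_dom (corner (i e))) (i \o f).
  by move=> M /ff[x _ fM]; exists (i x) => //=; rewrite -fM (star_morphM im).
split; last first.
  split => //.
  - by move=> M N _ _ /ii; apply: fi; exact: in_setT.
  - move=> _ [x' _ <-]; case: ib => j ji ij.
    have [|M _ fM] := fs (j x' * e); first by exists (j x').
    by exists M => //=; rewrite fM (star_morphM im) ij.
split => //=.
- by move=> M N MA NA; rewrite (star_morphismD fm) //= (star_morphD im).
- by move=> M N MA NA; rewrite (star_morphismM fm) //= (star_morphM im).
- by move=> z M MA; rewrite (star_morphismZ fm) //= (star_morphZ im).
- by move=> M MA; rewrite (star_morphism_adj fm) //= (star_morph_adj im).
- by rewrite (star_morphism1 fm).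
Qed.

End Isomorphism.

Section Interpretation.
Variables (R : realType) (E : nonstandard_extension R) (B : internal_cstar E).
Variable dflt : cstarType R.
Local Notation V := (stdV E).
Local Notation W := (hypV E).
Local Notation st := (@star R E).
Let n := ic_rank B.
Local Notation code_emb t := (@code_emb R E B dflt t).
Local Notation code_algebra := (@code_algebra R E B dflt).

Definition mc_set : set V := [set t | exists (A : cstarType R) (c : A -> V) (e : A),
    [/\ coding n c, minimal_central e & t = opair (tuple_of_code (code c)) (c e)]].

Definition bd_set : set V := [set t | exists (A : cstarType R) (c : A -> V) (e : A) (d : nat),
    [/\ coding n c, minimal_central e, has_block_dim e d &
        t = triple (tuple_of_code (code c)) (c e) (atom d%:R)]].

Definition dim_set : set V := [set t | exists (A : cstarType R) (c : A -> V) (d : nat),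
    [/\ coding n c, has_dim A d & t = opair (tuple_of_code (code c)) (atom d%:R)]].

Lemma mc_bdd : mc_set `<=` level (n + 23).
Proof.
move=> _ [A [c [e [cc _ ->]]]]; rewrite -[23%N]/(21 + 2)%N addnA addn2.
apply: level_opair; first exact: level_code.
by apply: level_mono (cc.2 e); exact: leq_addr.
Qed.

Lemma bd_bdd : bd_set `<=` level (n + 25).
Proof.
move=> _ [A [c [e [d [cc _ _ ->]]]]]; rewrite -[25%N]/(21 + 4)%N addnA.
apply: level_triple; [exact: level_code| |exact: level_atom].
by apply: level_mono (cc.2 e); exact: leq_addr.
Qed.

Lemma dim_bdd : dim_set `<=` level (n + 23).
Proof.
move=> _ [A [c [d [cc _ ->]]]]; rewrite -[23%N]/(21 + 2)%N addnA addn2.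
by apply: level_opair; [exact: level_code|exact: level_atom].
Qed.

(** The standard sets below [t] quantify over all algebras with code [t], while the proofs work in
    the chosen one, [code_algebra t]; this isomorphism mediates. *)
Lemma code_rep_iso (A : cstarType R) (c : A -> V) t : coding n c ->
  t = tuple_of_code (code c) -> [/\ is_code B t, coding n (code_emb t) &
  exists i : A -> code_algebra t, [/\ bijective i, forall x, code_emb t (i x) = c x &
    @star_morphism R (staralg_of A) (staralg_of (code_algebra t)) i]].
Proof.
move=> cc e; have ct : is_code B t by exists A, c.
have [cr er] := code_repP dflt ct; split => //.
by apply: (code_iso cc cr); rewrite -e.
Qed.

Lemma hyperfinite_ae : hyperfinite_dim B -> ae (tuple_of_code B) [set t | finite_dim (code_algebra t)].
Proof.
move=> [N [_ H]].
have aD : ae (opair (tuple_of_code B) N) dim_set by apply/(star_set_ae _ dim_bdd).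
have [Bi Ni] := opair_internal (ae_internal aD).
have [v1 _] := lifts_pr Bi Ni.
apply/(lifts_ae _ v1); apply: ae_sub aD => _ [A [c [d [cc dA ->]]]] /=; rewrite pr1E.
have [_ _ [i [ib _ im]]] := code_rep_iso cc erefl.
by exists d; exact: iso_has_dim ib im _ dA.
Qed.

Lemma ic_minimal_central_dom y : ic_minimal_central B y -> elem y (c_dom B).
Proof.
move=> H; have aD : ae (opair (tuple_of_code B) y) mc_set by apply/(star_set_ae _ mc_bdd).
have [Bi yi] := opair_internal (ae_internal aD).
have [v1 v2] := lifts_pr Bi yi.
have [vd _ _ _] := master_fields dflt (v1 : master B _ _).
apply/(lifts_elem v2 vd); apply: ae_sub aD => _ [A [c [e [cc _ ->]]]] /=.
rewrite pr1E pr2E; have [_ cr [i [_ ie _]]] := code_rep_iso cc erefl.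
by apply/(code_dom cr); exists (i e); rewrite ie.
Qed.

Section MasterElement.
Variables (w : W) (T : V -> V) (a : forall x, code_algebra (T x)) (y : W).
Hypotheses (wT : master B w T) (ay : represents w a y).

Lemma ic_minimal_centralE :
  ic_minimal_central B y <-> ae w [set x | minimal_central (a x)].
Proof.
have v := lifts_pair wT ay.
rewrite /ic_minimal_central /mkset /minimal_central_graph -/n -/mc_set (star_set_lifts mc_bdd v).
have ac := ae_code wT.
split=> H; apply: ae_sub (ae_and H ac) => x /= [].
  move=> [A [c [e [cc me /opair_inj[eT ea]]]]] _.
  have [_ cr [i [ib ie im]]] := code_rep_iso cc eT.
  have -> : a x = i e by apply: cr.1; rewrite ie.
  exact: iso_minimal_central.
move=> me /(code_repP dflt)[cr er]; exists (code_algebra (T x)), (code_emb (T x)), (a x).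
by split => //; rewrite -er.
Qed.

(** Finite dimension guarantees at almost every point that the block has a size, and this size is
    unique, so the definite description in [ic_block_dim] has exactly one candidate. *)
Lemma ic_block_dimE : ae w [set x | finite_dim (code_algebra (T x))] ->
  ae w [set x | minimal_central (a x)] ->
  lifts_real (fun x => (block_dim (a x))%:R) w (ic_block_dim B y).
Proof.
move=> fd mc; have wi := master_internal wT.
have [t ht] := lifts_real_ex (fun x => (block_dim (a x))%:R) wi.
suff -> : ic_block_dim B y = t by [].
have U : forall q, elem (triple (tuple_of_code B) y q) (st (setof bd_set)) <-> q = atom t.
  apply: (lifts_unique (kV := fun x q => triple (T x) (code_emb (T x) (a x)) q) 
    (lifts_const _ wi) ht).
  - by move=> q /opair_internal[_ /opair_internal[]].
  - move=> q qi; apply: lifts_triple; [exact: (lifts_pr1' wT)|exact: (lifts_pr1' ay)|exact: lifts_pr2'].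
  - apply: ae_sub (ae_and fd (ae_and mc (ae_code wT))) => x /= [[d dA] [me ct]] q.
    rewrite (elem_setofE _ bd_bdd); split=> [|->].
      move=> [A [c [e [d' [cc me' hd /triple_inj[eT ea ->]]]]]].
      have [_ cr [i [ib ie im]]] := code_rep_iso cc eT.
      have aie : a x = i e by apply: cr.1; rewrite ie.
      congr (atom _%:R); apply/esym/block_dimE; first exact: minimal_central_proj.
      by rewrite aie; exact: iso_has_block_dim.
    have [cr er] := code_repP dflt ct.
    exists (code_algebra (T x)), (code_emb (T x)), (a x), (block_dim (a x)); split => //.
      exact: (block_dimP dA).
    by rewrite -er.
by apply: the_eq => [|q /U e]; [exact/U|exact: atom_inj e].
Qed.

End MasterElement.

Lemma hnatE w (r : V -> R) u : lifts_real r w u ->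
  @hnat R E (atom u) <-> ae w [set x | exists k : nat, r x = k%:R].
Proof.
move=> hu; rewrite /hnat /natset (star_set_lifts (n := 0) _ hu); last first.
  by move=> _ [k _ <-]; exact: level_atom.
split; apply: ae_sub => x /=.
  by move=> [k _ e]; exists k; exact: esym (atom_inj e).
by move=> [k ->]; exists k.
Qed.

Lemma hnat_atom N : @hnat R E N -> exists u, N = atom u.
Proof.
move=> H; suff [u _ <-] : range (atom (s := W)) N by exists u.
apply: (@elem_setofE _ W 0 (range atom) N (fun _ H => H)).1; rewrite -star_reals.
apply: (@star_set_sub _ _ 0) H => // _ [k _ <-]; by exists k%:R.
Qed.

End Interpretation.

(** * Finite sums of hyperreals *)

Section FiniteSums.
Variables (R : realType) (E : nonstandard_extension R).
Local Notation V := (stdV E).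
Local Notation W := (hypV E).

Lemma lifts_real_bigop (I : Type) (s : seq I) (r : I -> V -> R) (F : I -> hreal E) (w : W) :
  internal w -> (forall i, lifts_real (r i) w (F i)) ->
  lifts_real (fun x => \sum_(i <- s) r i x) w (\big[@hadd R E/std 0]_(i <- s) F i).
Proof.
move=> wi H; elim: s => [|i s IH].
  rewrite big_nil; apply: lifts_real_ext (lifts_real_std 0 wi) _.
  by apply: ae_all => // x /=; rewrite big_nil.
rewrite big_cons; apply: lifts_real_ext (hop_hr +%R (H i) IH) _.
by apply: ae_all => // x /=; rewrite big_cons.
Qed.

(** The sum over a set runs over its finite support in an unspecified order. It is lifted term by
    term along that list, and the reindexing and the insertion of vanishing terms take place among
    real sums at standard points. *)
Lemma lifts_real_fsbig (T : choiceType) (I : set T) m (e : 'I_m -> T) (r : 'I_m -> V -> R)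
    (F : T -> hreal E) (w : W) : internal w -> injective e -> I = range e ->
  (forall i, lifts_real (r i) w (F (e i))) ->
  lifts_real (fun x => \sum_i r i x) w (\big[@hadd R E/std 0]_(t \in I) F t).
Proof.
move=> wi ei IE H.
set s := finite_support _ _ _.
have sE : s =i I `&` (fun t => F t) @^-1` [set~ std 0].
  apply: in_finite_support; rewrite IE; apply: (@sub_finite_set _ _ (range e)) => [t []//|].
  exact: finite_image.
have us : uniq s by exact: finite_support_uniq.
(* The functions [r] reindexed by [T], with 0 off the range of [e]. *)
pose r' t x := if pselect (exists i, t = e i) is left h then r (projT1 (cid h)) x else 0.
have r'E i : r' (e i) = r i.
  rewrite /r'; case: pselect => [h|[]]; last by exists i.
  by have := projT2 (cid h) => /ei <-.
have H' t : lifts_real (r' t) w (if t \in I then F t else std 0).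
  case: ifP; rewrite IE; last first.
    move=> /negP tI; apply: lifts_real_ext (lifts_real_std 0 wi) _; apply: ae_all => // x /=.
    rewrite /r'; case: pselect => // h; exfalso; apply: tI; rewrite inE.
    by have [i ->] := h; exists i.
  by rewrite inE => -[i _ <-]; rewrite r'E.
have h1 := lifts_real_bigop s wi H'.
have -> : \big[@hadd R E/std 0]_(t <- s) F t =
   \big[@hadd R E/std 0]_(t <- s) (if t \in I then F t else std 0).
  apply: eq_big_seq => t; rewrite sE inE => -[tI _].
  by rewrite ifT // inE.
apply: lifts_real_ext h1 _.
have off i : ae w [set x | e i \notin s -> r i x = 0].
  have [es|nes] := boolP (e i \in s); first by apply: ae_all => // x /=.
  have F0 : F (e i) = std 0.
    apply: contrapT => nF; case/negP: nes; rewrite sE inE; split => //.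
    by rewrite IE; exists i.
  by apply: ae_sub ((lifts_real_eq (H i) (lifts_real_std 0 wi)).1 F0) => x /= ->.
apply: ae_sub (ae_fin wi off) => x /= off'.
rewrite (bigID (fun i => e i \in s)) /= [X in _ + X]big1 ?addr0 => [|i /off' //].
rewrite (eq_bigr (fun i => r' (e i) x)) => [|i _]; last by rewrite r'E.
rewrite -(big_map e (fun t => t \in s) (fun t => r' t x)) -[RHS]big_filter.
apply: perm_big; apply: uniq_perm => //.
  by rewrite filter_uniq // map_inj_uniq // index_enum_uniq.
move=> t; rewrite mem_filter; case: (boolP (t \in s)) => //= ts.
move: (ts); rewrite sE inE => -[]; rewrite IE => -[i _ <-] _.
by rewrite map_f // mem_index_enum.
Qed.

End FiniteSums.

(** * Divisibility gives embeddings into standard algebras *)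

Section DivideEmbeds.
Variables (R : realType) (E : nonstandard_extension R) (B : internal_cstar E).
Variables (dflt A : cstarType R).
Local Notation V := (stdV E).
Local Notation W := (hypV E).
Local Notation st := (@star R E).
Local Notation code_emb t := (@code_emb R E B dflt t).
Local Notation code_algebra := (@code_algebra R E B dflt).

Lemma entry_eq (T : choiceType) (Gam : T -> W) (f : W) (e : T) (u : hreal E) :
  elem (opair f (atom u)) (Gam e) ->
  (forall N, elem (opair f N) (Gam e) -> N = atom u) -> entry Gam f e = u.
Proof. by move=> H U; apply: the_eq => [//|z /U e']; exact: atom_inj e'. Qed.

(** The value of the internal function [G] at [y] is a hypernatural, so it is represented by a
    standard function with values in the natural numbers. *)
Lemma row_entry w T (gam : V -> V) (G : W) (a : forall x, code_algebra (T x)) (y : W) :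
  master B w T -> lifts gam w G -> is_function (ic_minimal_central B) (@hnat R E) G ->
  represents w a y -> ic_minimal_central B y ->
  exists kap : V -> nat, exists2 u,
    lifts_real (fun x => (kap x)%:R) w u &
    [/\ ae w [set x | elem (opair (code_emb (T x) (a x)) (atom (kap x)%:R)) (gam x)],
     elem (opair y (atom u)) G & forall N, elem (opair y N) G -> N = atom u].
Proof.
move=> wT vG [F1 F2] ay Jy; have wi := master_internal wT.
have [N [NG NU]] := F2 y Jy.
have hN : hnat N by have [y' [N' [_ hN' /opair_inj[_ ->]]]] := F1 _ NG.
have Ni : internal N by exact: internal_elem (internal_star _) hN.
have [u0 Nu0] := hnat_atom hN.
have [v1 v2] := lifts_pr wi Ni.
(* The value [N] need not be carried by [w]. The existence of a natural value is read off at the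
   pair and then pushed down to [w], where [kap] chooses one; uniqueness identifies it with [N]. *)
have ea : ae (opair w N) [set x | elem (opair (code_emb (T (pr1 x)) (a (pr1 x))) (pr2 x)) (gam (pr1 x))].
  apply/(lifts_elem (lifts_pair (lifts_pr1' ay Ni) v2) (lifts_pr1' vG Ni)); exact: NG.
have eb : ae (opair w N) [set x | exists k : nat, pr2 x = atom k%:R].
  have h0 : star_set (range (fun k : nat => atom k%:R : V)) N by exact: hN.
  have h1 : range (fun k : nat => atom k%:R : V) `<=` level 0.
    by move=> _ [k _ <-]; exact: level_atom.
  have := (star_set_ae _ h1).1 h0; rewrite (lifts_ae _ v2).
  by apply: ae_sub => x [k _ /= e]; exists k.
have ec : ae w [set x | exists k : nat, elem (opair (code_emb (T x) (a x)) (atom k%:R)) (gam x)].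
  apply/(lifts_ae _ v1); apply: ae_sub (ae_and ea eb) => x /= [h [k e]].
  by exists k; rewrite -e.
have ex x : exists k : nat, (exists k : nat, elem (opair (code_emb (T x) (a x)) (atom k%:R)) (gam x)) ->
    elem (opair (code_emb (T x) (a x)) (atom k%:R)) (gam x).
  have [[k h]|n] := pselect (exists k : nat, elem (opair (code_emb (T x) (a x)) (atom k%:R)) (gam x)).
    by exists k.
  by exists 0%N.
have [kap kapP] := choice ex.
have ed : ae w [set x | elem (opair (code_emb (T x) (a x)) (atom (kap x)%:R)) (gam x)].
  by apply: ae_sub ec => x; exact: kapP.
have [u hu] := lifts_real_ex (fun x => (kap x)%:R) wi.
have eu : elem (opair y (atom u)) G by apply/(lifts_elem (lifts_pair ay hu) vG).
exists kap, u => //; split => // N' N'G.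
by rewrite -(NU _ eu) (NU _ N'G).
Qed.

(** A universal statement about minimal central projections that fails almost everywhere has a
    family of counterexamples; its value at [w] is an internal minimal central projection that
    violates the divisibility hypothesis. So divisibility descends to almost every standard
    algebra. *)
Lemma embeds_of_dimvec : finite_dim A -> hyperfinite_dim B -> dimvec_divides A B ->
  ae (tuple_of_code B) [set t | embeds A (code_algebra t)].
Proof.
move=> [d dA] hB [Gam [[Gfun _ Gcol] Geq]].
have [q [e [fe ce eonto]]] := central_decomposition dA.
have ei := orth_family_inj fe.
have IE : @minimal_central R A = range e.
  apply/seteqP; split => [f /eonto[i ->]|_ [i _ <-]]; last exact: ce.
  by exists i.
have Gi i := Gfun (e i) (ce i).
have aF := hyperfinite_ae dflt hB.
have Bi := ae_internal aF.
pose F o := if o is Some i then Gam (e i) else tuple_of_code B.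
have [|w [f [wi vf]]] := @lifts_family _ E _ (enum {: option 'I_q}) F.
  by move=> [i|] _ //=; case: (Gi i).
pose T := f None; pose gam i := f (Some i).
have wT : master B w T by apply: (vf None); rewrite mem_enum.
have vG i : lifts (gam i) w (Gam (e i)) by apply: (vf (Some i)); rewrite mem_enum.
have aF' : ae w [set x | finite_dim (code_algebra (T x))].
  by apply/(lifts_ae [set t | finite_dim (code_algebra t)] wT).
(* At the standard point [x], [k] is an entry of column i at the block [g]. That there is at most
   one such [k] must itself be proved, which is [P3]. *)
pose Rel i x (g : code_algebra (T x)) (k : nat) := elem (opair (code_emb (T x) g) (atom k%:R)) (gam i x).
have P3 i : ae w [set x | forall (g : code_algebra (T x)) k k', minimal_central g ->
    Rel i x g k -> Rel i x g k' -> k = k'].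
  apply: contrapT => /(ae_not _ wi).2 na.
  have ex x : exists p : code_algebra (T x) * nat * nat, (~ forall (g : code_algebra (T x)) k k', minimal_central g ->
     Rel i x g k -> Rel i x g k' -> k = k') ->
     [/\ minimal_central p.1.1, Rel i x p.1.1 p.1.2, Rel i x p.1.1 p.2 & p.1.2 <> p.2].
    have [h|] := pselect (forall (g : code_algebra (T x)) k k', minimal_central g ->
     Rel i x g k -> Rel i x g k' -> k = k'); first by exists (0, 0%N, 0%N) => /(_ h).
    move=> /existsNP[g /existsNP[k /existsNP[k' /not_implyP[mg /not_implyP[r1 /not_implyP[r2 ne]]]]]].
    by exists (g, k, k') => _.
  pose p x := projT1 (cid (ex x)).
  have ap : ae w [set x | [/\ minimal_central (p x).1.1, Rel i x (p x).1.1 (p x).1.2,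
      Rel i x (p x).1.1 (p x).2 & (p x).1.2 <> (p x).2]].
    by apply: ae_sub na => x; exact: projT2 (cid (ex x)).
  have [y ay] := represents_ex wT (fun x => (p x).1.1).
  have Jy : ic_minimal_central B y.
    by apply/(ic_minimal_centralE wT ay); apply: ae_sub ap => x [].
  have [u1 h1] := lifts_real_ex (fun x => ((p x).1.2)%:R) wi.
  have [u2 h2] := lifts_real_ex (fun x => ((p x).2)%:R) wi.
  have [_ [_ FU]] := Gi i.
  have [N [_ NU]] := FU y Jy.
  have e1 : elem (opair y (atom u1)) (Gam (e i)).
    by apply/(lifts_elem (lifts_pair ay h1) (vG i)); apply: ae_sub ap => x [].
  have e2 : elem (opair y (atom u2)) (Gam (e i)).
    by apply/(lifts_elem (lifts_pair ay h2) (vG i)); apply: ae_sub ap => x [].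
  have /(lifts_real_eq h1 h2) e12 : u1 = u2 by apply: (@atom_inj _ W); rewrite -(NU _ e1) -(NU _ e2).
  apply: ae_false (ae_and ap e12) _ => x /= [[_ _ _ ne] /eqP].
  by rewrite eqr_nat => /eqP.
have P1 : ae w [set x | forall g : code_algebra (T x), minimal_central g ->
    exists2 k : 'I_q -> nat, forall i, Rel i x g (k i) &
      block_dim g = (\sum_i k i * block_dim (e i))%N].
  apply: contrapT => /(ae_not _ wi).2 na.
  pose Q x (g : code_algebra (T x)) := minimal_central g ->
    exists2 k : 'I_q -> nat, forall i, Rel i x g (k i) &
      block_dim g = (\sum_i k i * block_dim (e i))%N.
  have ex x : exists g : code_algebra (T x), (~ forall g : code_algebra (T x), Q x g) -> ~ Q x g.
    have [h|] := pselect (forall g : code_algebra (T x), Q x g); first by exists 0 => /(_ h).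
    by move=> /existsNP[g ng]; exists g.
  pose p x := projT1 (cid (ex x)).
  have ap : ae w [set x | ~ Q x (p x)] by apply: ae_sub na => x; exact: projT2 (cid (ex x)).
  have apm : ae w [set x | minimal_central (p x)].
    by apply: ae_sub ap => x /= /not_implyP[].
  have [y ay] := represents_ex wT p.
  have Jy : ic_minimal_central B y by apply/(ic_minimal_centralE wT ay).
  have rows i := row_entry wT (vG i) (Gi i).2 ay Jy.
  have [kap kapP] := choice rows.
  pose m i : R := (block_dim (e i))%:R.
  have hF i : lifts_real (fun x => (kap i x)%:R * m i) w
     (hmul (entry Gam y (e i)) (std (block_dim (e i))%:R)).
    have [u hu [_ eu uu]] := kapP i; rewrite (entry_eq eu uu).
    exact: hop_hr hu (lifts_real_std _ wi).
  have h1 := @lifts_real_fsbig _ _ _ _ _ e (fun i x => (kap i x)%:R * m i)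
    (fun t => hmul (entry Gam y t) (std (block_dim t)%:R)) w wi ei IE hF.
  have h2 := ic_block_dimE wT ay aF' apm.
  have /(lifts_real_eq h2 h1) eqd := Geq y Jy.
  have aR : ae w [set x | forall i, Rel i x (p x) (kap i x)].
    by apply: ae_fin => // i; have [u _ []] := kapP i.
  apply: ae_false (ae_and ap (ae_and aR eqd)) _ => x /= [nQ [rx eqx]]; apply: nQ => _.
  exists (kap^~ x) => //; apply/eqP; rewrite -(eqr_nat R) eqx natr_sum.
  by apply/eqP; apply: eq_bigr => i _; rewrite natrM.
(* The positive entry in column i is witnessed by one internal [y], which is adjoined to [w]; the
   resulting existence statement no longer mentions [y] and goes back to [w]. *)
have P2 i : ae w [set x | exists (g : code_algebra (T x)) k, [/\ minimal_central g, Rel i x g k & (0 < k)%N]].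
  have [y [Jy hpos]] := Gcol (e i) (ce i).
  have yi := internal_elem (internal_star _) Jy.
  have [_ {}yi] := opair_internal yi.
  have [v1 v2] := lifts_pr wi yi.
  have wT' : master B (opair w y) (fun x => T (pr1 x)) by exact: lifts_pr1' wT yi.
  have [a ay] := represents_of dflt wT' (ic_minimal_central_dom dflt Jy) v2.
  have [kap [u hu [aR eu uu]]] := row_entry wT' (lifts_pr1' (vG i) yi) (Gi i).2 ay Jy.
  rewrite (entry_eq eu uu) in hpos.
  have w'i := internal_opair wi yi.
  have apos := (lifts_real_rel (fun x y : R => x < y) (lifts_real_std 0 w'i) hu).1 hpos.
  have am := (ic_minimal_centralE wT' ay).1 Jy.
  apply/(lifts_ae _ v1); apply: ae_sub (ae_and aR (ae_and apos am)) => x /= [h1 [h2 h3]].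
  by exists (a x), (kap x); split => //; rewrite -(ltr0n R).
apply/(lifts_ae [set t | embeds A (code_algebra t)] wT).
apply: ae_sub (ae_and aF' (ae_and P1 (ae_and (ae_fin wi P2) (ae_fin wi P3)))).
move=> x /= [[d' dA'] [p1 [p2 p3]]].
have [q' [e' [fe' ce' eonto']]] := central_decomposition dA'.
have ex j : exists k : 'I_q -> nat, (forall i, Rel i x (e' j) (k i)) /\
      block_dim (e' j) = (\sum_i k i * block_dim (e i))%N.
  by have [k k1 k2] := p1 _ (ce' j); exists k.
have [k kP] := choice ex.
apply: (@embedding_of_multiplicities _ _ _ _ _ e e' fe _ fe' _ (fun i => block_dim (e i))
  (fun j => block_dim (e' j)) k).
- by move=> i; exact: minimal_central_proj (ce i).
- by move=> i; exact: minimal_central_proj (ce' i).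
- by move=> i; exact: (block_dimP dA).
- by move=> i; exact: (block_dimP dA').
- by move=> j; have [] := kP j.
- move=> i; have [g [k0 [mg rg k0p]]] := p2 i.
  have [j gj] := eonto' _ mg; subst g; exists j.
  (* Uniqueness identifies the positive entry from [p2] with the multiplicity chosen from [p1]. *)
  have [rj _] := kP j; by rewrite (p3 i _ _ _ mg (rj i) rg).
Qed.

End DivideEmbeds.

Lemma finite_lower_bound (R : realType) (I : finType) (f : I -> R) :
  (forall i, 0 < f i) -> exists2 r, 0 < r & forall i, r <= f i.
Proof.
move=> f0; have s0 : 0 <= \sum_i (f i)^-1 by apply: sumr_ge0 => i _; rewrite invr_ge0 ltW.
exists (1 + \sum_i (f i)^-1)^-1; first by rewrite invr_gt0 ltr_pwDl.
move=> i; rewrite -[leRHS]invrK lef_pV2 ?posrE ?invr_gt0 ?ltr_pwDl //.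
rewrite (bigD1 i) //= addrCA lerDl addr_ge0 //.
by apply: sumr_ge0 => j _; rewrite invr_ge0 ltW.
Qed.

Lemma seq_upper_bound (R : realType) (I : eqType) (s : seq I) (f : I -> R) :
  exists2 M, 1 <= M & forall i, i \in s -> f i <= M.
Proof.
have s0 : 0 <= \sum_(i <- s) `|f i| by apply: sumr_ge0.
exists (1 + \sum_(i <- s) `|f i|); first by rewrite lerDl.
move=> i si; apply: le_trans (ler_norm _) _; rewrite (big_rem i) //=.
by rewrite addrCA lerDl addr_ge0 // sumr_ge0.
Qed.

(** * An embedding into the hull gives multiplicities almost everywhere *)

Section EmbeddingDivides.
Variables (R : realType) (E : nonstandard_extension R) (B : internal_cstar E).
Variables (A : cstarType R) (F : staralg_of A -> hull B).
Hypotheses (fdA : finite_dim A) (hB : hyperfinite_dim B) (Fmono : star_monomorphism F).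
Local Notation V := (stdV E).
Local Notation W := (hypV E).
Local Notation st := (@star R E).
Local Notation code_emb t := (@code_emb R E B A t).
Local Notation code_algebra := (@code_algebra R E B A).
Let n := ic_rank B.

Let Fm : star_morphism F := Fmono.1.

Lemma hull_mul_lift (c c' : A) y z : ic_fin B y -> ic_fin B z ->
  hull_pi B y = F c -> hull_pi B z = F c' -> hull_pi B (ic_mul B y z) = F (c * c').
Proof.
move=> fy fz yc zc; rewrite -(hull_mul A fy fz) yc zc; apply/esym.
by apply: (star_morphismM Fm); rewrite in_setT.
Qed.

Lemma hull_add_lift (c c' : A) y z : ic_fin B y -> ic_fin B z ->
  hull_pi B y = F c -> hull_pi B z = F c' -> hull_pi B (ic_add B y z) = F (c + c').
Proof.
move=> fy fz yc zc; rewrite -(hull_add A fy fz) yc zc; apply/esym.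
by apply: (star_morphismD Fm); rewrite in_setT.
Qed.

Lemma hull_scale_lift l (c : A) y : ic_fin B y ->
  hull_pi B y = F c -> hull_pi B (ic_scale B l y) = F (l *: c).
Proof.
move=> fy yc; rewrite -(hull_scale A l fy) yc; apply/esym.
by apply: (star_morphismZ Fm); rewrite in_setT.
Qed.

Lemma hull_adj_lift (c : A) y : ic_fin B y ->
  hull_pi B y = F c -> hull_pi B (ic_adj B y) = F (adj c).
Proof.
move=> fy yc; rewrite -(hull_adj A fy) yc; apply/esym.
by apply: (star_morphism_adj Fm); rewrite in_setT.
Qed.

Lemma hull_eq_close w T (a b : forall x, code_algebra (T x)) y z : master B w T ->
  ic_fin B y -> ic_fin B z -> represents w a y -> represents w b z -> hull_pi B y = hull_pi B z ->
  forall r, 0 < r -> ae w [set x | cnorm (a x - b x) <= r].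
Proof.
by move=> wT fy fz ay bz /(hull_piE A fy fz)/(inf_closeE wT ay bz).
Qed.

(** The matrix unit relations hold exactly in the hull, so for representatives in B they hold up to
    any positive real almost everywhere. There are finitely many of them, so all hold at once for
    the [ep] of [approx_matrix_units_multiplicities]. *)
Lemma exists_multiplicities q (e : 'I_q -> A) : orth_family e -> (forall i, minimal_central (e i)) ->
  exists w T, master B w T /\ ae w [set x | exists Gam : code_algebra (T x) -> 'I_q -> nat,
     (forall f, minimal_central f -> block_dim f = (\sum_i Gam f i * block_dim (e i))%N) /\
     (forall i, exists2 f, minimal_central f & (0 < Gam f i)%N)].
Proof.
move=> fe ce; have [d dA] := fdA; have [pe e0 eo e1] := fe.
have exb c : exists b, ic_fin B b /\ hull_pi B b = F c.
  by have [|b fb bc] := star_morphism_fun Fm (x := c); [exact: I|exists b].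
have [beta betaP] := choice exb.
pose m i := block_dim (e i).
have hb i : has_block_dim (e i) (m i) := block_dimP dA (ce i).
have mpos i : (0 < m i)%N := block_dim_gt0 (e0 i) (hb i).
have H i : exists gr : ('M[R[i]]_(m i) -> A) * (A -> 'M[R[i]]_(m i)), is_block (e i) gr.1 gr.2.
  by have [g [r b]] := has_block_dimP (hb i); exists (g, r).
pose gr i := projT1 (cid (H i)); pose bl i : is_block (e i) (gr i).1 (gr i).2 := projT2 (cid (H i)).
pose U i (a b : 'I_(m i)) : A := (gr i).1 (delta_mx a b).
have Uadj i a b : adj (U i a b) = U i b a.
  rewrite /U -(blockA (bl i)); congr ((gr i).1 _); apply/matrixP => k l.
  by rewrite !mxE andbC; case: (_ && _); rewrite ?conjc1 ?conjc0.
have Umul i a b c : U i a b * U i b c = U i a c.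
  by rewrite /U -(blockM (bl i)) mul_delta_mx.
have Uorth (s t : {i : 'I_q & 'I_(m i)}) : s != t ->
    U (tag s) (tagged s) (tagged s) * U (tag t) (tagged t) (tagged t) = 0.
  case: s t => [i a] [j b] /=; have [ij|ij] := eqVneq i j.
    subst j; rewrite eq_Tagged /= => ab.
    by rewrite /U -(blockM (bl i)) mul_delta_mx_0 // (block0 (bl i)).
  move=> _; rewrite /U -(block_f (bl i)) -(block_f (bl j)).
  have [_ _ cj] := minimal_central_proj (ce j).
  by rewrite -mulrA -cj (mulrA (e i)) eo // mul0r mulr0.
have U1 : \sum_(s : {i : 'I_q & 'I_(m i)}) U (tag s) (tagged s) (tagged s) = 1.
  rewrite -e1 -(sig_big_dep xpredT (fun _ => xpredT) (fun i a => U i a a)) /=.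
  apply: eq_bigr => i _; rewrite -(block1 (bl i)) mx1_sum_delta.
  by rewrite (big_morph _ (blockD (bl i)) (block0 (bl i))).
have U0 i a b : U i a b != 0.
  apply/eqP; rewrite -(block0 (bl i)) => /(block_inj (bl i)) /matrixP/(_ a b).
  by rewrite !mxE !eqxx => /eqP; rewrite oner_eq0.
pose T3 : finType := {i : 'I_q & ('I_(m i) * 'I_(m i))%type}.
(* The elements whose lifts are packed in [w]. The 0 is listed because the hull has no named zero:
   the class of the zero family is identified with [F 0] by scaling the lift of 0 with the scalar
   0. *)
pose xs : seq A := 0 :: [seq U (tag t) (tagged t).1 (tagged t).2 | t <- enum T3].
have Uxs i a b : U i a b \in xs.
  rewrite inE; apply/orP; right.
  apply/mapP; exists (Tagged (fun i => ('I_(m i) * 'I_(m i))%type) (a, b)) => //.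
  by rewrite mem_enum.
have xs0 : 0 \in xs by rewrite mem_head.
have [|w [T [bb [wT el_bb]]]] := @master_family _ _ B A _ xs beta.
  by move=> c _; case: (betaP c) => -[].
exists w, T; split => //; have wi := master_internal wT.
have [y0 el0] := represents_ex wT (fun x => 0 : code_algebra (T x)).
have fy0 : ic_fin B y0.
  split; first exact: (represents_dom wT el0).
  by apply/(represents_limited wT el0); exists 0; apply: ae_all => // x /=; rewrite cnorm0.
have [fb0 b0E] := betaP 0.
have y0E : hull_pi B y0 = F 0.
  rewrite -[X in F X](scale0r (0 : A)) -(hull_scale_lift 0 fb0 b0E).
  apply/(hull_piE A fy0 (fin_scale A 0 fb0))/(inf_closeE wT el0 (represents_scale wT 0 (el_bb _ xs0))).
  by move=> r r0; apply: ae_all => // x /=; rewrite scale0r subrr cnorm0 ltW.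
have close_mul c c' v b : c \in xs -> c' \in xs -> ic_fin B v -> represents w b v ->
    hull_pi B v = F (c * c') -> forall r, 0 < r -> ae w [set x | cnorm (bb c x * bb c' x - b x) <= r].
  move=> cx c'x fv bv vE; have [fc cE] := betaP c; have [fc' c'E] := betaP c'.
  apply: (hull_eq_close wT (fin_mul A fc fc') fv (represents_mul wT (el_bb _ cx) (el_bb _ c'x)) bv).
  by rewrite (hull_mul_lift fc fc' cE c'E).
have sums (s : seq A) : {subset s <= xs} -> exists v, [/\ represents w (fun x => \sum_(c <- s) bb c x) v,
    ic_fin B v & hull_pi B v = F (\sum_(c <- s) c)].
  elim: s => [|c s IH] sx.
    exists y0; rewrite big_nil; split => //.
    by apply: (represents_ext el0); apply: ae_all => // x /=; rewrite big_nil.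
  have [|v [elv fv vE]] := IH; first by move=> c' c's; apply: sx; rewrite inE c's orbT.
  have cx : c \in xs by apply: sx; rewrite mem_head.
  have [fc cE] := betaP c.
  exists (ic_add B (beta c) v); split; [|exact: fin_add|].
    apply: (represents_ext (represents_add wT (el_bb _ cx) elv)); apply: ae_all => // x /=.
    by rewrite big_cons.
  by rewrite big_cons; exact: hull_add_lift.
have bound c : exists M, c \in xs -> ae w [set x | cnorm (bb c x) <= M].
  have [cx|_] := boolP (c \in xs); last by exists 0.
  have [[_ lc] _] := betaP c.
  by have [M HM] := (represents_limited wT (el_bb _ cx)).1 lc; exists M.
have [Mf MfP] := choice bound.
have [M M1 MP] := seq_upper_bound xs Mf.
(* If no positive real bounded the norms from below, the lift would be infinitesimal and its class
   equal to [F 0], contrary to injectivity. *)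
have low (s : {i : 'I_q & 'I_(m i)}) : exists2 r, 0 < r &
    ae w [set x | r <= cnorm (bb (U (tag s) (tagged s) (tagged s)) x)].
  set c := U _ _ _; have cx : c \in xs by exact: Uxs.
  have [fc cE] := betaP c; apply: contrapT => no.
  have : hull_pi B (beta c) = hull_pi B y0.
    apply/(hull_piE A fc fy0)/(inf_closeE wT (el_bb _ cx) el0) => r r0.
    apply: contrapT => /(ae_not _ wi).2 na; apply: no; exists r => //.
    by apply: ae_sub na => x /= /negP; rewrite subr0 -ltNge => /ltW.
  rewrite cE y0E => /(Fmono.2) /=; rewrite !in_setT => /(_ isT isT) c0.
  by have := U0 _ (tagged s) (tagged s); rewrite -/c c0 eqxx.
have lowf (s : {i : 'I_q & 'I_(m i)}) : exists r, 0 < r /\ ae w [set x | r <= cnorm (bb (U (tag s) (tagged s) (tagged s)) x)].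
  by have [r r0 hr0] := low s; exists r.
have [rf rfP] := choice lowf.
have [rho rho0 rhoP] := finite_lower_bound (fun s => (rfP s).1).
(* [M] and [rho] are standard reals valid almost everywhere, so [ep] is one standard real for all
   points. *)
have [ep ep0 epP] := approx_matrix_units_multiplicities mpos M1 rho0.
have aF : ae w [set x | finite_dim (code_algebra (T x))].
  by apply/(lifts_ae [set t | finite_dim (code_algebra t)] wT); exact: hyperfinite_ae.
have a1 : ae w [set x | forall i a b, cnorm (adj (bb (U i a b) x) - bb (U i b a) x) <= ep].
  apply: ae_fin => // i; apply: ae_fin => // a; apply: ae_fin => // b.
  have [fc cE] := betaP (U i a b); have [fc' c'E] := betaP (U i b a).
  apply: (hull_eq_close wT (fin_adj A fc) fc' (represents_adj wT (el_bb _ (Uxs _ _ _))) (el_bb _ (Uxs _ _ _))) ep0.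
  by rewrite (hull_adj_lift fc cE) Uadj c'E.
have a2 : ae w [set x | forall i a b c, 
    cnorm (bb (U i a b) x * bb (U i b c) x - bb (U i a c) x) <= ep].
  apply: ae_fin => // i; apply: ae_fin => // a; apply: ae_fin => // b; apply: ae_fin => // c.
  have [fc cE] := betaP (U i a c).
  by apply: (close_mul _ _ _ _ (Uxs _ _ _) (Uxs _ _ _) fc (el_bb _ (Uxs _ _ _))) ep0; rewrite Umul.
have a3 : ae w [set x | forall s t : {i : 'I_q & 'I_(m i)}, s != t ->
    cnorm (bb (U (tag s) (tagged s) (tagged s)) x * bb (U (tag t) (tagged t) (tagged t)) x) <= ep].
  apply: ae_fin => // s; apply: ae_fin => // t.
  have [->|st'] := eqVneq s t; first by apply: ae_all => // x /=; rewrite eqxx.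
  have := close_mul _ _ _ _ (Uxs _ (tagged s) (tagged s)) (Uxs _ (tagged t) (tagged t)) fy0 el0.
  rewrite Uorth // => /(_ y0E _ ep0); apply: ae_sub => x /= + _.
  by rewrite subr0.
have a4 : ae w [set x | cnorm (\sum_(s : {i : 'I_q & 'I_(m i)}) bb (U (tag s) (tagged s) (tagged s)) x - 1) <= ep].
  have [|v [elv fv vE]] := sums [seq U (tag s) (tagged s) (tagged s) | s <- enum {: {i : 'I_q & 'I_(m i)}}].
    by move=> c /mapP[s _ ->]; exact: Uxs.
  rewrite big_map big_enum U1 (star_morphism1 Fm) in vE.
  have := hull_eq_close wT fv (fin_one B A) elv (represents_one A wT) vE ep0.
  by apply: ae_sub => x /=; rewrite big_map big_enum.
have a5 : ae w [set x | forall i a b, cnorm (bb (U i a b) x) <= M].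
  apply: ae_fin => // i; apply: ae_fin => // a; apply: ae_fin => // b.
  apply: ae_sub (MfP _ (Uxs i a b)) => x /= h.
  by apply: le_trans h _; exact: MP.
have a6 : ae w [set x | forall i a, rho <= cnorm (bb (U i a a) x)].
  apply: ae_fin => // i; apply: ae_fin => // a.
  apply: ae_sub ((rfP (Tagged (fun i => 'I_(m i)) a)).2) => x /= h.
  by apply: le_trans h; exact: rhoP.
apply: ae_sub (ae_and aF (ae_and (ae_and a1 a2) (ae_and (ae_and a3 a4) (ae_and a5 a6)))).
move=> x /= [[d' dA'] [[h1 h2] [[h3 h4] [h5 h6]]]].
by apply: (epP _ _ (fun i a b => bb (U i a b) x) dA').
Qed.

End EmbeddingDivides.

(** * The internal inclusion matrix *)

Section EmbeddingDivides.
Variables (R : realType) (E : nonstandard_extension R) (B : internal_cstar E).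
Variables (A : cstarType R) (F : staralg_of A -> hull B).
Hypotheses (fdA : finite_dim A) (hB : hyperfinite_dim B) (Fmono : star_monomorphism F).
Local Notation V := (stdV E).
Local Notation W := (hypV E).
Local Notation st := (@star R E).
Local Notation code_emb t := (@code_emb R E B A t).
Local Notation code_algebra := (@code_algebra R E B A).
Let n := ic_rank B.

Lemma dimvec_of_embedding : dimvec_divides A B.
Proof.
have [d dA] := fdA.
have [q [e [fe ce eonto]]] := central_decomposition dA.
have ei := orth_family_inj fe.
have IE : @minimal_central R A = range e.
  apply/seteqP; split => [f /eonto[i ->]|_ [i _ <-]]; last exact: ce.
  by exists i.
have [w [T [wT aG]]] := exists_multiplicities fdA hB Fmono fe ce.
have wi := master_internal wT.
have aF : ae w [set x | finite_dim (code_algebra (T x))].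
  by apply/(lifts_ae [set t | finite_dim (code_algebra t)] wT); exact: hyperfinite_ae.
pose good x (G : code_algebra (T x) -> 'I_q -> nat) :=
  (forall f, minimal_central f -> block_dim f = (\sum_i G f i * block_dim (e i))%N) /\
     (forall i, exists2 f, minimal_central f & (0 < G f i)%N).
have exG x : exists G : code_algebra (T x) -> 'I_q -> nat, (exists G, good x G) -> good x G.
  have [[G gG]|no] := pselect (exists G, good x G); first by exists G.
  by exists (fun _ _ => 0%N).
pose G x := projT1 (cid (exG x)).
have {}aG : ae w [set x | good x (G x)].
  by apply: ae_sub aG => x; exact: (projT2 (cid (exG x))).
have acode : ae w [set x | coding n (code_emb (T x))].
  by apply: ae_sub (ae_code wT) => x /(code_repP A)[].
(* The graph of column i of the multiplicity matrix at the point [x]. Its value [GW i] at [w] is the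
   internal column. *)
pose gset i x : set V := [set p | exists f : code_algebra (T x), minimal_central f /\
  p = opair (code_emb (T x) f) (atom (G x f i)%:R)].
pose gam i x : V := setof (gset i x).
have gbdd i x : coding n (code_emb (T x)) -> gset i x `<=` level n.+2.
  by move=> cc _ [f [_ ->]]; apply: level_opair; [exact: cc.2|exact: level_atom].
have exW i : exists g, lifts (gam i) w g.
  apply: (@lifts_ex _ _ _ _ n.+3); apply: ae_sub acode => x cc.
  exact: level_setof (gbdd i x cc).
have [GW vG] := choice exW.
(* Columns have to be indexed by the minimal central projections themselves; elsewhere the value is
   arbitrary. *)
pose Gam (c : A) : W := the (tuple_of_code B) [set g | exists2 i, c = e i & g = GW i].
have GamE i : Gam (e i) = GW i.
  by apply: the_eq => [|z [j /ei -> ->]//]; exists i.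
(* To evaluate the matrix at an internal [y], adjoin [y] to [w]: the row is then represented by the
   standard multiplicities [K] of the blocks behind [y]. *)
have row y : ic_minimal_central B y -> exists w' T' (a : forall x, code_algebra (T' x)) (K : 'I_q -> V -> nat),
  [/\ master B w' T', represents w' a y,
      ae w' [set x | finite_dim (code_algebra (T' x))] /\ ae w' [set x | minimal_central (a x)],
      ae w' [set x | block_dim (a x) = (\sum_i K i x * block_dim (e i))%N] &
      forall i, exists2 u, lifts_real (fun x => (K i x)%:R) w' u &
        forall z, elem (opair y z) (GW i) <-> z = atom u].
  move=> Jy; have yi := internal_elem (internal_star _) Jy.
  have [_ {}yi] := opair_internal yi.
  have [v1 v2] := lifts_pr wi yi.
  have wT' : master B (opair w y) (fun x => T (pr1 x)) by exact: lifts_pr1' wT yi.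
  have w'i := internal_opair wi yi.
  have [a ay] := represents_of A wT' (ic_minimal_central_dom A Jy) v2.
  have am := (ic_minimal_centralE wT' ay).1 Jy.
  have aG' := ae_pr1 wi yi aG.
  exists (opair w y), (fun x => T (pr1 x)), a, (fun i x => G (pr1 x) (a x) i); split => //.
  - by split => //; exact: ae_pr1 wi yi aF.
  - by apply: ae_sub (ae_and am aG') => x /= [mx [H _]]; exact: H.
  move=> i; have [u hu] := lifts_real_ex (fun x => (G (pr1 x) (a x) i)%:R) w'i.
  exists u => //.
  apply: (lifts_unique (kV := fun x z => opair (code_emb (T (pr1 x)) (a x)) z)
    (lifts_pr1' (vG i) yi) hu).
  - by move=> z /opair_internal[].
  - by move=> z zi; apply: lifts_pair; [exact: (lifts_pr1' ay)|exact: lifts_pr2'].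
  - apply: ae_sub (ae_and am (ae_pr1 wi yi acode)) => x /= [mx cc] z.
    rewrite (elem_setofE _ (gbdd i _ cc)); split=> [[f [mf /opair_inj[/cc.1 <- ->]]] //|->].
    by exists (a x).
have Gent y i u : (forall z, elem (opair y z) (GW i) <-> z = atom u) -> entry Gam y (e i) = u.
  by move=> H; apply: entry_eq => [|N]; rewrite GamE; [exact/H|move=> /H].
exists Gam; split; first split.
- move=> c; rewrite IE => -[i _ <-]; rewrite GamE.
  have [_ Gi] := lifts_internal (vG i).
  split => //; split.
    move=> p pG; have pi := internal_elem Gi pG.
    have [v1 v2] := lifts_pr wi pi.
    have wT' : master B (opair w p) (fun x => T (pr1 x)) by exact: lifts_pr1' wT pi.
    have wpi := internal_opair wi pi.
    have ap := (lifts_elem v2 (lifts_pr1' (vG i) pi)).1 pG.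
    (* An arbitrary element [p] of the internal column is decomposed pointwise; the chosen first
       coordinates represent the internal projection [y]. *)
    have exf x : exists f : code_algebra (T (pr1 x)), gset i (pr1 x) (pr2 x) -> minimal_central f /\
        pr2 x = opair (code_emb (T (pr1 x)) f) (atom (G (pr1 x) f i)%:R).
      have [[f h]|no] := pselect (gset i (pr1 x) (pr2 x)); first by exists f.
      by exists 0 => /no.
    pose f x := projT1 (cid (exf x)).
    have af : ae (opair w p) [set x | minimal_central (f x) /\
        pr2 x = opair (code_emb (T (pr1 x)) (f x)) (atom (G (pr1 x) (f x) i)%:R)].
      apply: ae_sub (ae_and ap (ae_pr1 wi pi acode)) => x /= [h cc].
      by apply: (projT2 (cid (exf x))); apply/(elem_setofE _ (gbdd i _ cc)).
    have [y fy] := represents_ex wT' f.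
    have [u hu] := lifts_real_ex (fun x => (G (pr1 x) (f x) i)%:R) wpi.
    exists y, (atom u); split.
    - by apply/(ic_minimal_centralE wT' fy); apply: ae_sub af => x [].
    - by apply/(hnatE hu); apply: ae_all => // x; exists (G (pr1 x) (f x) i).
    - by apply/(lifts_eq v2 (lifts_pair fy hu)); apply: ae_sub af => x [].
  move=> y /row[w' [T' [a [K [_ _ _ _ /(_ i)[u _ uu]]]]]].
  by exists (atom u); split => [|z /uu ->//]; exact/uu.
- move=> y Jy; have [w' [T' [a [K [wT' ay [af am] ad rows]]]]] := row y Jy.
  have w'i := master_internal wT'.
  apply: contrapT => no.
  (* A row without positive entry would vanish almost everywhere and give a nonzero block of size
     0. *)
  have aK : ae w' [set x | forall i, K i x = 0%N].
    apply: ae_fin => // i; apply: contrapT => /(ae_not _ w'i).2 na; apply: no.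
    exists (e i); split; first exact: ce.
    have [u hu uu] := rows i; rewrite (Gent _ _ _ uu).
    apply/(lifts_real_rel (fun x y : R => x < y) (lifts_real_std 0 w'i) hu); apply: ae_sub na => x /= /eqP.
    by rewrite ltr0n lt0n.
  apply: ae_false (ae_and (ae_and aK ad) (ae_and af am)) _ => x /= [[K0 bE] [[d' dx] mx]].
  have := block_dim_gt0 (minimal_central_neq0 mx) (block_dimP dx mx).
  by rewrite bE big1 // => i _; rewrite K0.
- move=> c; rewrite IE => -[i _ <-].
  have exf x : exists f : code_algebra (T x), good x (G x) -> minimal_central f /\ (0 < G x f i)%N.
    have [gx|no] := pselect (good x (G x)); last by exists 0 => /no.
    by have [f mf f0] := gx.2 i; exists f.
  pose f x := projT1 (cid (exf x)).
  have af : ae w [set x | minimal_central (f x) /\ (0 < G x (f x) i)%N].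
    by apply: ae_sub aG => x; exact: (projT2 (cid (exf x))).
  have [y fy] := represents_ex wT f.
  have Jy : ic_minimal_central B y.
    by apply/(ic_minimal_centralE wT fy); apply: ae_sub af => x [].
  exists y; split => //.
  have [w' [T' [a [K [_ _ _ _ /(_ i)[u _ uu]]]]]] := row y Jy.
  have [u' hu'] := lifts_real_ex (fun x => (G x (f x) i)%:R) wi.
  have uE : atom u' = atom u :> W.
    apply/uu/(lifts_elem (lifts_pair fy hu') (vG i)).
    apply: ae_sub (ae_and af acode) => x /= [[mf _] cc].
    by apply/(elem_setofE _ (gbdd i _ cc)); exists (f x).
  rewrite (Gent _ _ _ uu) -(atom_inj uE).
  apply/(lifts_real_rel (fun x y : R => x < y) (lifts_real_std 0 wi) hu'); apply: ae_sub af => x /= [_].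
  by rewrite ltr0n.
move=> y Jy; have [w' [T' [a [K [wT' ay [af am] ad rows]]]]] := row y Jy.
have w'i := master_internal wT'.
pose m i : R := (block_dim (e i))%:R.
have hF i : lifts_real (fun x => (K i x)%:R * m i) w'
   (hmul (entry Gam y (e i)) (std (block_dim (e i))%:R)).
  have [u hu uu] := rows i; rewrite (Gent _ _ _ uu).
  exact: hop_hr hu (lifts_real_std _ w'i).
have h1 := @lifts_real_fsbig _ _ _ _ _ e (fun i x => (K i x)%:R * m i)
    (fun t => hmul (entry Gam y t) (std (block_dim t)%:R)) w' w'i ei IE hF.
have h2 := ic_block_dimE wT' ay af am.
apply/(lifts_real_eq h2 h1); apply: ae_sub ad => x /= ->.
by rewrite natr_sum; apply: eq_bigr => i _; rewrite natrM.
Qed.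

End EmbeddingDivides.

Theorem proposition5p6 (R : realType) (E : nonstandard_extension R)
    (A : nat -> cstarType R) (h : forall k : nat, A k -> A k.+1)
    (L : cstarType R) (phi : forall k : nat, A k -> L)
    (B : internal_cstar E) :
  (forall k : nat, finite_dim (A k)) ->
  (forall k : nat,
     @star_monomorphism R (staralg_of (A k)) (staralg_of (A k.+1)) (h k)) ->
  closure_of_union h phi ->
  hyperfinite_dim B ->
  (exists f : staralg_of L -> hull B, star_monomorphism f) <->
  (forall k : nat, dimvec_divides (A k) B).
Proof.
move=> fdA hm cl hB; split=> [[f fm] k|dv].
  have [pm _ _] := cl.
  exact: (dimvec_of_embedding (fdA k) hB (star_monomorphism_comp (pm k) fm)).
apply: (embedding_of_embeds fdA hm cl) => k.
exact: embeds_of_dimvec (fdA k) hB (dv k).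
Qed.
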